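(* Let $(A,\sigma)$ be an algebra with involution of the first kind over $K$. The product $\widetilde{SGW}(A,\sigma)\times\widetilde{SGW}(A,\sigma)\to\widetilde{SGW}(A,\sigma)$ defined in the context makes $\widetilde{SGW}(A,\sigma)$ a commutative $\Gamma$-graded semiring, and it induces on $\widetilde{GW}(A,\sigma)$ a structure of commutative $\Gamma$-graded $GW(K)$-algebra.
   Context: $K$ is a field of characteristic $\neq2$; $(A,\sigma)$ is a central simple $K$-algebra with a $K$-linear involution $\sigma$ (orthogonal or symplectic). For $\varepsilon=\pm1$, an $\varepsilon$-hermitian module over $(A,\sigma)$ is a finitely generated right $A$-module $U$ with a nondegenerate biadditive $h:U\times U\to A$, $h(ua,vb)=\sigma(a)h(u,v)b$, $h(v,u)=\varepsilon\sigma(h(u,v))$. $SGW(K)$, $SGW^-(K)$, $SGW^{+}(A,\sigma)$, $SGW^-(A,\sigma)$ are the commutative monoids (under orthogonal sum) of isometry classes of, respectively, nondegenerate symmetric bilinear $K$-spaces, nondegenerate alternating bilinear $K$-spaces, hermitian ($\varepsilon=1$) and anti-hermitian ($\varepsilon=-1$) modules over $(A,\sigma)$. Put $$\widetilde{SGW}(A,\sigma)=SGW(K)\oplus SGW^-(K)\oplus SGW^+(A,\sigma)\oplus SGW^-(A,\sigma)$$ and let $\widetilde{GW}(A,\sigma)=GW(K)\oplus GW^-(K)\oplus GW^+(A,\sigma)\oplus GW^-(A,\sigma)$ be its Grothendieck group. Grading: $\Gamma=\{+,-,o,s\}$ is the Klein four-group with neutral element $+$. The $+$ component is $SGW(K)$,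 the $-$ component is $SGW^-(K)$; the $o$ component is $SGW^+(A,\sigma)$ if $\sigma$ is orthogonal and $SGW^-(A,\sigma)$ if $\sigma$ is symplectic; the $s$ component is the remaining one (so elements of the $o$, resp. $s$, component have orthogonal, resp. symplectic, adjoint involution). Similarly for $\widetilde{GW}$. Product (biadditive, defined componentwise): the product of two bilinear spaces over $K$, or of a bilinear space over $K$ with an $\varepsilon$-hermitian module over $(A,\sigma)$ (in either order), is the tensor product over $K$. The product of an $\varepsilon$-hermitian module $(U,h)$ and an $\varepsilon'$-hermitian module $(V,g)$ over $(A,\sigma)$ is the bilinear $K$-space $(W,h\cdot g)$, where $W=(U\otimes_KV)\otimes_{A\otimes_KA}A$, $A$ being a left $A\otimes_KA$-module via $(a\otimes b)\cdot x=ax\sigma(b)$, and $$(h\cdot g)\bigl((u\otimes v)\otimes a,(u'\otimes v')\otimes a'\bigr)=\mathrm{Trd}_A\bigl(\sigma(a)\,h(u,u')\,a'\,\sigma(g(v,v'))\bigr).$$ *)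

(* Defs.v *)
From HB Require Import structures.
From mathcomp Require Import all_boot all_order all_algebra all_field.
From mathcomp Require Import boolp classical_sets.

Set Implicit Arguments.
Unset Strict Implicit.
Unset Printing Implicit Defensive.

Import GRing.Theory.
Local Open Scope classical_set_scope.
Local Open Scope ring_scope.

(* Isometry classes of spaces are not elements of an nmodType if taken as     *)
(* sets of spaces, for universe reasons. Instead, the class of x : T is       *)
(* encoded by a complete invariant (code x), a subset of a small type S.      *)
Section Classes.
Variables (T S : Type) (code : T -> set S).

Definition classes : Type := {C : set S | exists x, C = code x}.
Definition cls (x : T) : classes := exist _ (code x) (ex_intro _ x erefl).
Definition rep (c : classes) : T := sval (cid (svalP c)).

HB.instance Definition _ := gen_eqMixin classes.
HB.instance Definition _ := gen_choiceMixin classes.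

Lemma repK c : cls (rep c) = c.
Proof. by case: c => C p; apply: eq_exist; rewrite /rep; case: cid. Qed.

Variable R : T -> T -> Prop.
Hypothesis codeP : forall x y, code x = code y <-> R x y.

Lemma clsP x y : cls x = cls y <-> R x y.
Proof.
split=> [/(congr1 sval)/codeP // | /codeP Rxy].
exact: eq_exist.
Qed.

Lemma rep_cls x : R (rep (cls x)) x.
Proof. by apply/clsP; rewrite repK. Qed.

Variables (op : T -> T -> T) (o : T).
Hypothesis opR : forall x x' y y', R x x' -> R y y' -> R (op x y) (op x' y').
Hypothesis opA : forall x y z, R (op x (op y z)) (op (op x y) z).
Hypothesis opC : forall x y, R (op x y) (op y x).
Hypothesis op0 : forall x, R (op o x) x.

Definition cop (x y : classes) : classes := cls (op (rep x) (rep y)).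

Lemma cop_cls x y : cop (cls x) (cls y) = cls (op x y).
Proof. by apply/clsP/opR; apply: rep_cls. Qed.

Lemma copA : associative cop.
Proof.
by move=> x y z; rewrite -[x]repK -[y]repK -[z]repK !cop_cls; apply/clsP.
Qed.

Lemma copC : commutative cop.
Proof. by move=> x y; rewrite -[x]repK -[y]repK !cop_cls; apply/clsP. Qed.

Lemma cop0 : left_id (cls o) cop.
Proof. by move=> x; rewrite -[x]repK cop_cls; apply/clsP. Qed.

End Classes.

(* x : M * M represents the formal difference x.1 - x.2.                      *)
Section Grothendieck.
Variable M : nmodType.

Definition groth_rel (x y : M * M) : Prop :=
  exists k, x.1 + y.2 + k = y.1 + x.2 + k.

Let grxx x : groth_rel x x. Proof. by exists 0. Qed.

Let grsym x y : groth_rel x y -> groth_rel y x.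
Proof. by case=> k E; exists k. Qed.

Let grtrans x y z : groth_rel x y -> groth_rel y z -> groth_rel x z.
Proof.
case=> k E [l F]; exists (y.1 + y.2 + k + l).
transitivity ((x.1 + y.2 + k) + (y.1 + z.2 + l)).
  by rewrite !addrA [LHS](ACl (1*4*5*3*2*6)).
by rewrite E F !addrA [LHS](ACl (4*2*1*5*3*6)).
Qed.

Let gcodeP x y : groth_rel x = groth_rel y <-> groth_rel x y.
Proof.
split=> [-> | xy]; first exact: grxx.
apply: funext => z; apply: propext; split; last exact: grtrans.
exact/grtrans/grsym.
Qed.

Definition groth : Type := classes groth_rel.
Definition groth_in (x : M) : groth := cls groth_rel (x, 0).

Definition groth_addr (x y : M * M) : M * M := (x.1 + y.1, x.2 + y.2).
Definition groth_oppr (x : M * M) : M * M := (x.2, x.1).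

Let gaddR x x' y y' :
  groth_rel x x' -> groth_rel y y' ->
  groth_rel (groth_addr x y) (groth_addr x' y').
Proof.
case=> k E [l F]; exists (k + l); rewrite /groth_addr /=.
transitivity ((x.1 + x'.2 + k) + (y.1 + y'.2 + l)).
  by rewrite !addrA [LHS](ACl (1*3*5*2*4*6)).
by rewrite E F !addrA [LHS](ACl (1*4*2*5*3*6)).
Qed.

Let gaddA x y z :
  groth_rel (groth_addr x (groth_addr y z)) (groth_addr (groth_addr x y) z).
Proof. by rewrite /groth_addr /= !addrA; apply: grxx. Qed.

Let gaddC x y : groth_rel (groth_addr x y) (groth_addr y x).
Proof. by rewrite /groth_addr addrC [x.2 + _]addrC; apply: grxx. Qed.

Let gadd0 x : groth_rel (groth_addr (0, 0) x) x.
Proof. by rewrite /groth_addr /= !add0r -surjective_pairing; apply: grxx. Qed.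

Definition groth_opp (x : groth) : groth := cls groth_rel (groth_oppr (rep x)).

Let gaddN : left_inverse (cls groth_rel (0, 0)) groth_opp
  (@cop _ _ groth_rel groth_addr).
Proof.
move=> x; rewrite /groth_opp -{2}[x]repK.
rewrite (cop_cls gcodeP gaddR); apply/(clsP gcodeP).
by exists 0; rewrite /groth_addr /groth_oppr /= !addr0 add0r addrC.
Qed.

HB.instance Definition _ := Choice.copy groth (classes groth_rel).
HB.instance Definition _ := GRing.isZmodule.Build groth
  (copA gcodeP gaddR gaddA) (copC gcodeP gaddR gaddC)
  (cop0 gcodeP gaddR gadd0) gaddN.

End Grothendieck.

(* Biadditive, and independent of the representatives, if f is biadditive.    *)
Definition groth_ext2 (M N P : nmodType) (f : M -> N -> P)
    (x : groth M) (y : groth N) : groth P :=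
  let: (a, b) := rep x in let: (c, d) := rep y in
  groth_in (f a c + f b d) - groth_in (f a d + f b c).

(* Tensor products over a ring R, given by their universal property. Only the *)
(* actions ra of R on the right of M and la of R on the left of N matter.     *)
Definition balanced (R : Type) (M N X : zmodType)
    (ra : M -> R -> M) (la : R -> N -> N) (f : M -> N -> X) : Prop :=
  [/\ forall m m' n, f (m + m') n = f m n + f m' n,
      forall m n n', f m (n + n') = f m n + f m n'
    & forall m r n, f (ra m r) n = f m (la r n)].

Definition is_tensor (R : Type) (M N T : zmodType)
    (ra : M -> R -> M) (la : R -> N -> N) (t : M -> N -> T) : Prop :=
  balanced ra la t /\
  forall (X : zmodType) (f : M -> N -> X), balanced ra la f ->
    exists2 g : {additive T -> X}, forall m n, g (t m n) = f m n
      & forall g' : {additive T -> X},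
          (forall m n, g' (t m n) = f m n) -> g' =1 g.

(* Signs are booleans, as in (-1) ^+ e, and are multiplied with addb: in what *)
(* follows [false] stands for +1 and [true] for -1.                           *)

(* Two nondegenerate forms with the same Gram matrices on generating families *)
(* p, p' are isometric.                                                       *)
Lemma gram_isometry (C U U' V : zmodType) (p : C -> U) (p' : C -> U')
    (h : U -> U -> V) (h' : U' -> U' -> V) :
  (forall c d, p (c - d) = p c - p d) ->
  (forall c d, p' (c - d) = p' c - p' d) ->
  (forall u, exists c, u = p c) -> (forall u, exists c, u = p' c) ->
  (forall v, h 0 v = 0) -> (forall v, h' 0 v = 0) ->
  (forall u, (forall v, h u v = 0) -> u = 0) ->
  (forall u, (forall v, h' u v = 0) -> u = 0) ->
  (forall c d, h (p c) (p d) = h' (p' c) (p' d)) ->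
  exists f : U -> U', [/\ forall c, f (p c) = p' c, bijective f
    & forall u v, h' (f u) (f v) = h u v].
Proof.
move=> pB pB' ps ps' h0 h0' hn hn' hh.
have ker c : p c = 0 <-> p' c = 0.
  split=> c0; [apply: hn' | apply: hn] => v.
    by have [d ->] := ps' v; rewrite -hh c0 h0.
  by have [d ->] := ps v; rewrite hh c0 h0'.
pose l u := sval (cid (ps u)); pose l' u := sval (cid (ps' u)).
have lP u : u = p (l u) by rewrite /l; case: cid.
have lP' u : u = p' (l' u) by rewrite /l'; case: cid.
have fp c : p' (l (p c)) = p' c.
  by apply/eqP; rewrite -subr_eq0 -pB'; apply/eqP/ker; rewrite pB -lP subrr.
have fp' c : p (l' (p' c)) = p c.
  by apply/eqP; rewrite -subr_eq0 -pB; apply/eqP/ker; rewrite pB' -lP' subrr.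
exists (fun u => p' (l u)); split=> //.
  by exists (fun u => p (l' u)) => u; rewrite ?fp' ?fp -?lP -?lP'.
by move=> u v; rewrite -hh -!lP.
Qed.

Section BilinearSpaces.
Variable K : fieldType.

(* Nondegenerate symmetric (e = false) or alternating (e = true) spaces.      *)
Record bilSpace (e : bool) := BilSpace {
  bs_car :> vectType K;
  bs_form : bs_car -> bs_car -> K;
  bs_bilinear : bilinear_for *%R *%R bs_form;
  bs_sym : if e then forall u, bs_form u u = 0
           else forall u v, bs_form u v = bs_form v u;
  bs_nondegenerate : forall u, (forall v, bs_form u v = 0) -> u = 0 }.

Definition isomK e (M N : bilSpace e) : Prop :=
  exists f : M -> N, [/\ linear f, bijective f
    & forall u v, bs_form (f u) (f v) = bs_form u v].

Lemma bs_0r e (M : bilSpace e) u : bs_form u (0 : M) = 0.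
Proof.
by have := (bs_bilinear M).2 u 1 0 0; rewrite scaler0 add0r /= mul1r => /eqP;
   rewrite -subr_eq0 opprD addNKr oppr_eq0 => /eqP.
Qed.

Lemma bs_0l e (M : bilSpace e) u : bs_form (0 : M) u = 0.
Proof.
by have := (bs_bilinear M).1 u 1 0 0; rewrite scaler0 add0r /= mul1r => /eqP;
   rewrite -subr_eq0 opprD addNKr oppr_eq0 => /eqP.
Qed.

Section Sum.
Variables (e : bool) (M N : bilSpace e).

Definition sumK_form (x y : M * N) : K := bs_form x.1 y.1 + bs_form x.2 y.2.

Let sumf_bilinear : bilinear_for *%R *%R sumK_form.
Proof.
by split=> u k x y; rewrite /sumK_form /= ?(bs_bilinear M).1 ?(bs_bilinear M).2;
   rewrite ?(bs_bilinear N).1 ?(bs_bilinear N).2 mulrDr addrACA.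
Qed.

Let sumf_sym : if e then forall u, sumK_form u u = 0
               else forall u v, sumK_form u v = sumK_form v u.
Proof.
have if_impl b (P P' Q Q' R R' : Prop) : (P -> Q -> R) -> (P' -> Q' -> R') ->
  (if b then P else P') -> (if b then Q else Q') -> if b then R else R'.
  by case: b => f f'; [apply: f | apply: f'].
apply: (if_impl _ _ _ _ _ _ _ _ _ (bs_sym M) (bs_sym N)) => sM sN.
  by move=> u; rewrite /sumK_form sM sN addr0.
by move=> u v; rewrite /sumK_form sM sN.
Qed.

Let sumf_nondegenerate u : (forall v, sumK_form u v = 0) -> u = 0.
Proof.
case: u => a b u0; congr (_, _); apply: bs_nondegenerate => v.
  by have := u0 (v, 0); rewrite /sumK_form /= bs_0r addr0.
by have := u0 (0, v); rewrite /sumK_form /= bs_0r add0r.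
Qed.

Definition osumK : bilSpace e :=
  @BilSpace e (M * N)%type sumK_form sumf_bilinear sumf_sym sumf_nondegenerate.

End Sum.

Section Zero.
Variable e : bool.

Definition zeroK_form (u v : 'rV[K]_0) : K := 0.

Let zerof_bilinear : bilinear_for *%R *%R zeroK_form.
Proof. by split=> u k x y; rewrite /zeroK_form /= mulr0 addr0. Qed.

Let zerof_sym : if e then forall u, zeroK_form u u = 0
                else forall u v, zeroK_form u v = zeroK_form v u.
Proof. by case: e. Qed.

Let zerof_nondegenerate u : (forall v, zeroK_form u v = 0) -> u = 0.
Proof. by move=> _; apply/rowP => -[]. Qed.

Definition zeroK : bilSpace e :=
  @BilSpace e 'rV[K]_0 zeroK_form zerof_bilinear zerof_sym zerof_nondegenerate.

End Zero.

Section Unit.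

Definition unitK_form (u v : K^o) : K := u * v.

Let unitf_bilinear : bilinear_for *%R *%R unitK_form.
Proof.
split=> u k x y; rewrite /unitK_form /= ?mulrDl ?mulrDr; congr (_ + _).
  by rewrite -mulrA.
by rewrite mulrCA.
Qed.

Let unitf_sym u v : unitK_form u v = unitK_form v u.
Proof. exact: mulrC. Qed.

Let unitf_nondegenerate u : (forall v, unitK_form u v = 0) -> u = 0.
Proof. by move/(_ 1); rewrite /unitK_form mulr1. Qed.

Definition unitK : bilSpace false :=
  @BilSpace false K^o unitK_form unitf_bilinear unitf_sym unitf_nondegenerate.

End Unit.

Section Monoid.
Variable e : bool.
Implicit Types M N P : bilSpace e.

Let comb n M (g : 'I_n -> M) (c : {ffun 'I_n -> K}) : M := \sum_i c i *: g i.

(* The set of the Gram matrices of the finite generating families of M; it    *)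
(* determines the isometry class of M.                                        *)
Definition gramK M : set {n & 'M[K]_n} := fun G =>
  exists g : 'I_(projT1 G) -> M,
    (forall u, exists c : {ffun _}, u = \sum_i c i *: g i) /\
    forall i j, projT2 G i j = bs_form (g i) (g j).

Let bs_comb n M (g : 'I_n -> M) c d :
  bs_form (comb g c) (comb g d)
    = \sum_i \sum_j c i * (d j * bs_form (g i) (g j)).
Proof.
have addl v : {morph (fun u : M => bs_form u v) : x y / x + y}.
  by move=> x y; have := (bs_bilinear M).1 v 1 x y; rewrite scale1r /= mul1r.
have addr u : {morph (bs_form (u : M)) : x y / x + y}.
  by move=> x y; have := (bs_bilinear M).2 u 1 x y; rewrite scale1r /= mul1r.
have scl k u v : bs_form (k *: u : M) v = k * bs_form u v.
  by have := (bs_bilinear M).1 v k u 0; rewrite /= addr0 bs_0l addr0.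
have scr k u v : bs_form (u : M) (k *: v) = k * bs_form u v.
  by have := (bs_bilinear M).2 u k v 0; rewrite /= addr0 bs_0r addr0.
rewrite /comb (big_morph _ (addl _) (bs_0l _)); apply: eq_bigr => i _.
rewrite scl (big_morph _ (addr _) (bs_0r _)) mulr_sumr.
by apply: eq_bigr => j _; rewrite scr.
Qed.

Let gramKP M N : gramK M = gramK N <-> isomK M N.
Proof.
have fwd M1 N1 : isomK M1 N1 -> gramK M1 `<=` gramK N1.
  case=> f [lf [f' fK f'K] fb] [n G] [g [gs gG]].
  have fZ k u : f (k *: u) = k *: f u.
    have f0 : f 0 = 0.
      have := lf 1 0 0; rewrite !scale1r addr0 => /eqP.
      by rewrite -subr_eq0 opprD addNKr oppr_eq0 => /eqP.
    by have := lf k u 0; rewrite f0 !addr0.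
  have fD : {morph f : x y / x + y}.
    by move=> x y; have := lf 1 x y; rewrite !scale1r.
  have f0 : f 0 = 0 by have := fZ 0 0; rewrite !scale0r.
  exists (f \o g); split=> [u|i j]; last by rewrite gG /= fb.
  have [c cP] := gs (f' u); exists c.
  rewrite -[LHS]f'K cP (big_morph f fD f0); apply: eq_bigr => i _.
  by rewrite fZ.
split=> [gMN | iMN]; last first.
  apply/seteqP; split; apply: fwd => //.
  case: iMN => f [lf [g fK gK] fb]; exists g; split.
  - by move=> k u v; apply: (can_inj fK); rewrite lf !gK.
  - by exists f.
  - by move=> u v; rewrite -fb !gK.
pose n := \dim {:M}; pose g (i : 'I_n) : M := (vbasis {:M})`_i.
pose G := \matrix_(i, j < n) bs_form (g i) (g j).
have gs u : exists c : {ffun 'I_n -> K}, u = comb g c.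
  exists [ffun i => coord (vbasis {:M}) i u].
  rewrite {1}(coord_vbasis (memvf u)); apply: eq_bigr => i _.
  by rewrite ffunE.
have : gramK M (existT _ n G) by exists g; split=> // i j; rewrite mxE.
rewrite gMN => -[/= g' [gs' gG]].
have combB P (k : 'I_n -> P) c d : comb k (c - d) = comb k c - comb k d.
  by rewrite /comb -sumrB; apply: eq_bigr => i _; rewrite !ffunE scalerBl.
have combZ P (k : 'I_n -> P) a c d :
    a *: comb k c + comb k d = comb k [ffun i => a * c i + d i].
  rewrite /comb scaler_sumr -big_split; apply: eq_bigr => i _ /=.
  by rewrite ffunE scalerDl scalerA.
have [|f [fp bf fb]] := gram_isometry (combB _ g) (combB _ g') gs gs'
  (bs_0l (M := M)) (bs_0l (M := N)) (@bs_nondegenerate _ M)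
  (@bs_nondegenerate _ N).
  move=> c d; rewrite !bs_comb; apply: eq_bigr => i _; apply: eq_bigr => j _.
  by rewrite -gG mxE.
exists f; split=> // a u v.
have [c ->] := gs u; have [d ->] := gs v.
by rewrite combZ !fp combZ.
Qed.

Let iop M M' N N' :
  isomK M M' -> isomK N N' -> isomK (osumK M N) (osumK M' N').
Proof.
case=> f [lf [f' fK f'K] fb] [g [lg [g' gK g'K] gb]].
exists (fun x => (f x.1, g x.2)); split.
- by move=> k u v /=; rewrite lf lg.
- by exists (fun x => (f' x.1, g' x.2)) => -[a b] /=; rewrite ?fK ?gK ?f'K ?g'K.
- by move=> u v; rewrite /= /sumK_form /= fb gb.
Qed.

Let iA M N P : isomK (osumK M (osumK N P)) (osumK (osumK M N) P).
Proof.
exists (fun x => ((x.1, x.2.1), x.2.2)); split=> //.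
  by exists (fun x => (x.1.1, (x.1.2, x.2))) => [[? []]|[[]]].
by move=> u v; rewrite /= /sumK_form /= addrA.
Qed.

Let iC M N : isomK (osumK M N) (osumK N M).
Proof.
exists (fun x => (x.2, x.1)); split=> //.
  by exists (fun x => (x.2, x.1)); case.
by move=> u v; rewrite /= /sumK_form /= addrC.
Qed.

Let i0 M : isomK (osumK (zeroK e) M) M.
Proof.
exists snd; split=> //; last first.
  by move=> u v; rewrite /= /sumK_form /= /zeroK_form add0r.
exists (fun x => (0, x)) => // -[a b] /=; congr (_, _).
by apply/rowP => -[].
Qed.

(* SGWK false is SGW(K) and SGWK true is SGW^-(K).                            *)
Definition SGWK : Type := classes gramK.
Definition clsK (M : bilSpace e) : SGWK := cls gramK M.

Lemma clsKP M N : clsK M = clsK N <-> isomK M N.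
Proof. exact: clsP gramKP M N. Qed.

HB.instance Definition _ := Choice.copy SGWK (classes gramK).
HB.instance Definition _ := GRing.isNmodule.Build SGWK
  (copA gramKP iop iA) (copC gramKP iop iC) (cop0 gramKP iop i0).

End Monoid.
End BilinearSpaces.

(* A right A-module is a left module over the converse ring A^c.              *)
Definition ract (K : fieldType) (A : falgType K) (U : lmodType A^c) (u : U)
  (a : A) : U := (a : A^c) *: u.

Definition involution_first_kind (K : fieldType) (A : falgType K)
    (sigma : {linear A -> A}) : Prop :=
  (forall a b, sigma (a * b) = sigma b * sigma a) /\ involutive sigma.

Definition central_simple (K : fieldType) (A : falgType K) : Prop :=
  ('Z({:A}) = 1 :> {vspace A})%VS /\
  forall I : {vspace A}, ({:A} * I <= I)%VS -> (I * {:A} <= I)%VS ->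
    I = 0%VS \/ I = {:A}%VS.

Section HermitianModules.
Variables (K : fieldType) (A : falgType K) (sigma : {linear A -> A}).

Record hermMod (e : bool) := HermMod {
  hm_car :> lmodType A^c;
  hm_form : hm_car -> hm_car -> A;
  hm_fg : exists n (g : 'I_n -> hm_car),
    forall u, exists c : {ffun 'I_n -> A}, u = \sum_i ract (g i) (c i);
  hm_addl : forall u u' v, hm_form (u + u') v = hm_form u v + hm_form u' v;
  hm_addr : forall u v v', hm_form u (v + v') = hm_form u v + hm_form u v';
  hm_sesqui : forall a b u v,
    hm_form (ract u a) (ract v b) = sigma a * hm_form u v * b;
  hm_sym : forall u v, hm_form v u = (-1) ^+ e * sigma (hm_form u v);
  hm_nondegenerate : forall u, (forall v, hm_form u v = 0) -> u = 0 }.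

Definition isomA e (M N : hermMod e) : Prop :=
  exists f : M -> N, [/\ linear f, bijective f
    & forall u v, hm_form (f u) (f v) = hm_form u v].

Lemma hm_0l e (M : hermMod e) u : hm_form (0 : M) u = 0.
Proof. by apply: (addrI (hm_form 0 u)); rewrite -hm_addl !addr0. Qed.

Lemma hm_0r e (M : hermMod e) u : hm_form u (0 : M) = 0.
Proof. by apply: (addrI (hm_form u 0)); rewrite -hm_addr !addr0. Qed.

Section Sum.
Variables (e : bool) (M N : hermMod e).

Local Notation V := (M * N)%type.

Definition sumA_form (x y : V) : A := hm_form x.1 y.1 + hm_form x.2 y.2.

Let sumf_fg : exists n (g : 'I_n -> V),
  forall u, exists c : {ffun 'I_n -> A}, u = \sum_i ract (g i) (c i).
Proof.
have [m [g gs]] := hm_fg M; have [n [k ks]] := hm_fg N.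
exists (m + n)%N, (fun i => match split i with
  inl j => (g j, 0) | inr j => (0, k j) end) => -[u v].
have [c cP] := gs u; have [d dP] := ks v.
exists [ffun i => match split i with inl j => c j | inr j => d j end].
have pairE p (F : 'I_p -> V) : \sum_i F i = (\sum_i (F i).1, \sum_i (F i).2).
  elim/big_rec3: _ => [|i x y z _ -> ]; first by [].
  by case: (F i).
rewrite big_split_ord /= !pairE; congr (_, _) => /=.
  rewrite [X in _ + X]big1 ?addr0 => [|i _].
    rewrite cP; apply: eq_bigr => i _; rewrite ffunE.
    by have /= -> := unsplitK (inl i : 'I_m + 'I_n).
  rewrite ffunE; have /= -> := unsplitK (inr i : 'I_m + 'I_n).
  by rewrite /ract /= scaler0.
rewrite [X in X + _]big1 ?add0r => [|i _].
  rewrite dP; apply: eq_bigr => i _; rewrite ffunE.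
  by have /= -> := unsplitK (inr i : 'I_m + 'I_n).
rewrite ffunE; have /= -> := unsplitK (inl i : 'I_m + 'I_n).
by rewrite /ract /= scaler0.
Qed.

Let sumf_addl u u' v : sumA_form (u + u') v = sumA_form u v + sumA_form u' v.
Proof. by rewrite /sumA_form !hm_addl addrACA. Qed.

Let sumf_addr u v v' : sumA_form u (v + v') = sumA_form u v + sumA_form u v'.
Proof. by rewrite /sumA_form !hm_addr addrACA. Qed.

Let sumf_sesqui a b u v :
  sumA_form (ract u a) (ract v b) = sigma a * sumA_form u v * b.
Proof. by rewrite /sumA_form !hm_sesqui mulrDr mulrDl. Qed.

Let sumf_sym u v : sumA_form v u = (-1) ^+ e * sigma (sumA_form u v).
Proof. by rewrite /sumA_form hm_sym [X in _ + X]hm_sym linearD mulrDr. Qed.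

Let sumf_nondegenerate u : (forall v, sumA_form u v = 0) -> u = 0.
Proof.
case: u => a b u0; congr (_, _); apply: hm_nondegenerate => v.
  by have := u0 (v, 0); rewrite /sumA_form /= hm_0r addr0.
by have := u0 (0, v); rewrite /sumA_form /= hm_0r add0r.
Qed.

Definition osumA : hermMod e := @HermMod e (M * N)%type sumA_form sumf_fg
  sumf_addl sumf_addr sumf_sesqui sumf_sym sumf_nondegenerate.

End Sum.

Section Zero.
Variable e : bool.

Local Notation V := 'rV[A^c]_0.

Definition zeroA_form (u v : V) : A := 0.

Let zerof_fg : exists n (g : 'I_n -> V),
  forall u, exists c : {ffun 'I_n -> A}, u = \sum_i ract (g i) (c i).
Proof. by exists 0%N, (fun=> 0) => u; exists [ffun=> 0]; apply/rowP => -[]. Qed.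

Let zerof_addl u u' v :
  zeroA_form (u + u') v = zeroA_form u v + zeroA_form u' v.
Proof. by rewrite /zeroA_form addr0. Qed.

Let zerof_addr u v v' :
  zeroA_form u (v + v') = zeroA_form u v + zeroA_form u v'.
Proof. by rewrite /zeroA_form addr0. Qed.

Let zerof_sesqui a b u v :
  zeroA_form (ract u a) (ract v b) = sigma a * zeroA_form u v * b.
Proof. by rewrite /zeroA_form mulr0 mul0r. Qed.

Let zerof_sym u v : zeroA_form v u = (-1) ^+ e * sigma (zeroA_form u v).
Proof. by rewrite /zeroA_form linear0 mulr0. Qed.

Let zerof_nondegenerate u : (forall v, zeroA_form u v = 0) -> u = 0.
Proof. by move=> _; apply/rowP => -[]. Qed.

Definition zeroA : hermMod e := @HermMod e V zeroA_form zerof_fg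
  zerof_addl zerof_addr zerof_sesqui zerof_sym zerof_nondegenerate.

End Zero.

Section Monoid.
Variable e : bool.
Implicit Types M N P : hermMod e.

Let comb n M (g : 'I_n -> M) (c : {ffun 'I_n -> A}) : M :=
  \sum_i ract (g i) (c i).

(* The analogue of gramK.                                                     *)
Definition gramA M : set {n & 'M[A]_n} := fun G =>
  exists g : 'I_(projT1 G) -> M,
    (forall u, exists c : {ffun _ -> A}, u = \sum_i ract (g i) (c i)) /\
    forall i j, projT2 G i j = hm_form (g i) (g j).

Let hm_comb n M (g : 'I_n -> M) c d :
  hm_form (comb g c) (comb g d)
    = \sum_i \sum_j sigma (c i) * hm_form (g i) (g j) * d j.
Proof.
rewrite /comb (big_morph (fun u => hm_form u _)
  (fun x y => hm_addl x y _) (hm_0l _)); apply: eq_bigr => i _.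
rewrite (big_morph (hm_form _) (hm_addr _) (hm_0r _)).
by apply: eq_bigr => j _; rewrite hm_sesqui.
Qed.

Let gramAP M N : gramA M = gramA N <-> isomA M N.
Proof.
have fwd M1 N1 : isomA M1 N1 -> gramA M1 `<=` gramA N1.
  case=> f [lf [f' fK f'K] fb] [n G] [g [gs gG]].
  have f0 : f 0 = 0.
    have := lf 1 0 0; rewrite !scale1r addr0 => /eqP.
    by rewrite -subr_eq0 opprD addNKr oppr_eq0 => /eqP.
  have fZ k u : f (k *: u) = k *: f u.
    by have := lf k u 0; rewrite f0 !addr0.
  have fD : {morph f : x y / x + y}.
    by move=> x y; have := lf 1 x y; rewrite !scale1r.
  exists (f \o g); split=> [u|i j]; last by rewrite gG /= fb.
  have [c cP] := gs (f' u); exists c.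
  rewrite -[LHS]f'K cP (big_morph f fD f0); apply: eq_bigr => i _.
  by rewrite /ract fZ.
split=> [gMN | iMN]; last first.
  apply/seteqP; split; apply: fwd => //.
  case: iMN => f [lf [g fK gK] fb]; exists g; split.
  - by move=> k u v; apply: (can_inj fK); rewrite lf !gK.
  - by exists f.
  - by move=> u v; rewrite -fb !gK.
have [n [g gs]] := hm_fg M.
pose G := \matrix_(i, j < n) hm_form (g i) (g j).
have : gramA M (existT _ n G) by exists g; split=> // i j; rewrite mxE.
rewrite gMN => -[/= g' [gs' gG]].
have combB P (k : 'I_n -> P) c d : comb k (c - d) = comb k c - comb k d.
  by rewrite /comb -sumrB; apply: eq_bigr => i _; rewrite /ract !ffunE scalerBl.
have combZ P (k : 'I_n -> P) (a : A^c) c d :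
    a *: comb k c + comb k d = comb k [ffun i => c i * a + d i].
  rewrite /comb scaler_sumr -big_split; apply: eq_bigr => i _ /=.
  by rewrite /ract ffunE scalerDl scalerA.
have [|f [fp bf fb]] := gram_isometry (combB _ g) (combB _ g') gs gs'
  (hm_0l (M := M)) (hm_0l (M := N)) (@hm_nondegenerate _ M)
  (@hm_nondegenerate _ N).
  move=> c d; rewrite !hm_comb; apply: eq_bigr => i _; apply: eq_bigr => j _.
  by rewrite -gG mxE.
exists f; split=> // a u v.
have [c ->] := gs u; have [d ->] := gs v.
by rewrite combZ !fp combZ.
Qed.

Let iop M M' N N' :
  isomA M M' -> isomA N N' -> isomA (osumA M N) (osumA M' N').
Proof.
case=> f [lf [f' fK f'K] fb] [g [lg [g' gK g'K] gb]].
exists (fun x => (f x.1, g x.2)); split.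
- by move=> k u v /=; rewrite lf lg.
- by exists (fun x => (f' x.1, g' x.2)) => -[a b] /=; rewrite ?fK ?gK ?f'K ?g'K.
- by move=> u v; rewrite /= /sumA_form /= fb gb.
Qed.

Let iA M N P : isomA (osumA M (osumA N P)) (osumA (osumA M N) P).
Proof.
exists (fun x => ((x.1, x.2.1), x.2.2)); split=> //.
  by exists (fun x => (x.1.1, (x.1.2, x.2))) => [[? []]|[[]]].
by move=> u v; rewrite /= /sumA_form /= addrA.
Qed.

Let iC M N : isomA (osumA M N) (osumA N M).
Proof.
exists (fun x => (x.2, x.1)); split=> //.
  by exists (fun x => (x.2, x.1)); case.
by move=> u v; rewrite /= /sumA_form /= addrC.
Qed.

Let i0 M : isomA (osumA (zeroA e) M) M.
Proof.
exists snd; split=> //; last first.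
  by move=> u v; rewrite /= /sumA_form /= /zeroA_form add0r.
exists (fun x => (0, x)) => // -[a b] /=; congr (_, _).
by apply/rowP => -[].
Qed.

(* SGWA false is SGW^+(A, sigma) and SGWA true is SGW^-(A, sigma).            *)
Definition SGWA : Type := classes gramA.
Definition clsA (M : hermMod e) : SGWA := cls gramA M.

Lemma clsAP M N : clsA M = clsA N <-> isomA M N.
Proof. exact: clsP gramAP M N. Qed.

HB.instance Definition _ := Choice.copy SGWA (classes gramA).
HB.instance Definition _ := GRing.isNmodule.Build SGWA
  (copA gramAP iop iA) (copC gramAP iop iC) (cop0 gramAP iop i0).

End Monoid.
End HermitianModules.

(* Splittings of A: the L-linear extension A (x)_K L -> M_n(L) of phi is an   *)
(* isomorphism, i.e. phi maps a K-basis of A to an L-basis of M_n(L).         *)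
Definition is_splitting (K : fieldType) (A : falgType K) (L : fieldType)
    (iota : {rmorphism K -> L}) n (phi : {rmorphism A -> 'M[L]_n}) : Prop :=
  (forall k a, phi (k *: a) = iota k *: phi a) /\
  basis_of fullv (map phi (vbasis {:A})).

(* The reduced trace of a is the element of K which becomes the trace of      *)
(* phi a in a splitting.                                                      *)
Definition Trd (K : fieldType) (A : falgType K) (a : A) : K :=
  xget 0 [set t | exists (L : fieldType) (iota : {rmorphism K -> L}) n
    (phi : {rmorphism A -> 'M[L]_n}),
    is_splitting iota phi /\ iota t = \tr (phi a)].

(* sigma is orthogonal if over some splitting it becomes the adjoint          *)
(* involution of a nondegenerate symmetric bilinear form, of matrix B, and    *)
(* symplectic otherwise.                                                      *)
Definition orthogonal_involution (K : fieldType) (A : falgType K)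
    (sigma : A -> A) : Prop :=
  exists (L : fieldType) (iota : {rmorphism K -> L}) n
    (phi : {rmorphism A -> 'M[L]_n}) (B : 'M[L]_n),
    [/\ is_splitting iota phi, B \in unitmx, B^T = B
      & forall a, phi (sigma a) = invmx B *m (phi a)^T *m B].

Section Products.
Variables (K : fieldType) (A : falgType K) (sigma : {linear A -> A}).

Definition kr (V : lmodType K) (v : V) (k : K) : V := k *: v.
Definition kl (V : lmodType K) (k : K) (v : V) : V := k *: v.
Definition akr (U : lmodType A^c) (u : U) (k : K) : U := ract u k%:A.
Definition akl (U : lmodType A^c) (k : K) (u : U) : U := ract u k%:A.

(* The following relations say that P, with a suitable balanced map t, is     *)
(* the product of the first two arguments.                                    *)
Definition prodKK e e' (V : bilSpace K e) (W : bilSpace K e')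
    (P : bilSpace K (e (+) e')) : Prop :=
  exists t : V -> W -> P,
  [/\ is_tensor (@kr V) (@kl W) t,
      forall k v w, t (k *: v) w = k *: t v w
    & forall v w v' w',
        bs_form (t v w) (t v' w') = bs_form v v' * bs_form w w'].

Definition prodKA e e' (V : bilSpace K e) (U : hermMod sigma e')
    (P : hermMod sigma (e (+) e')) : Prop :=
  exists t : V -> U -> P,
  [/\ is_tensor (@kr V) (@akl U) t,
      forall v u a, t v (ract u a) = ract (t v u) a
    & forall v u v' u',
        hm_form (t v u) (t v' u') = bs_form v v' *: hm_form u u'].

Definition prodAK e e' (U : hermMod sigma e) (V : bilSpace K e')
    (P : hermMod sigma (e (+) e')) : Prop :=
  exists t : U -> V -> P,
  [/\ is_tensor (@akr U) (@kl V) t,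
      forall u v a, t (ract u a) v = ract (t u v) a
    & forall u v u' v',
        hm_form (t u v) (t u' v') = bs_form v v' *: hm_form u u'].

(* P is T (x)_E A, where E is A (x)_K A, T is U (x)_K V, rho is the right     *)
(* action of E on T, and lam is the left action (a (x) b) c = a c sigma(b) of *)
(* E on A.                                                                    *)
Definition prodAA e e' (U : hermMod sigma e) (V : hermMod sigma e')
    (P : bilSpace K (e (+) e')) : Prop :=
  exists (E : zmodType) (tE : A -> A -> E) (T : zmodType) (tT : U -> V -> T)
    (rho : T -> E -> T) (lam : E -> A -> A) (t : T -> A -> P),
  [/\ is_tensor (@kr A) (@kl A) tE /\ is_tensor (@akr U) (@akl V) tT,
      (forall y y' x, rho (y + y') x = rho y x + rho y' x) /\
      (forall y x x', rho y (x + x') = rho y x + rho y x') /\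
      (forall u v a b, rho (tT u v) (tE a b) = tT (ract u a) (ract v b)),
      (forall x x' c, lam (x + x') c = lam x c + lam x' c) /\
      (forall x c c', lam x (c + c') = lam x c + lam x c') /\
      (forall a b c, lam (tE a b) c = a * c * sigma b),
      is_tensor rho lam t /\ (forall k y a, t y (k *: a) = k *: t y a)
    & forall u v a u' v' a', bs_form (t (tT u v) a) (t (tT u' v') a') =
        Trd (sigma a * hm_form u u' * a' * sigma (hm_form v v'))].

End Products.

(* Tensor products being defined up to isomorphism only, a product of objects *)
(* is a relation (prod M N P); it induces an operation on classes when        *)
(* well_defined_prod holds.                                                   *)
Section ClassProduct.
Variables (T1 T2 T3 : Type) (S1 S2 : Type) (S3 : nmodType).
Variables (c1 : T1 -> S1) (c2 : T2 -> S2) (c3 : T3 -> S3).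
Variable prod : T1 -> T2 -> T3 -> Prop.

Definition class_prod (x : S1) (y : S2) : S3 :=
  xget 0 [set z | exists M N P,
    [/\ x = c1 M, y = c2 N, z = c3 P & prod M N P]].

Definition well_defined_prod : Prop :=
  forall M N, (exists P, prod M N P) /\
    forall P, prod M N P -> class_prod (c1 M) (c2 N) = c3 P.

End ClassProduct.

(* The grading group: the Klein four-group with neutral element Gp (for +).   *)
Inductive Gamma := Gp | Gm | Go | Gs.

Definition Gamma_mul (g d : Gamma) : Gamma :=
  match g, d with
  | Gp, x | x, Gp => x
  | Gm, Gm | Go, Go | Gs, Gs => Gp
  | Gm, Go | Go, Gm => Gs
  | Gm, Gs | Gs, Gm => Go
  | Go, Gs | Gs, Go => Gm
  end.

(* The components are those of signs +, - over K, then +, - over (A, sigma).  *)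
Section FourSum.
Variables XK XA : bool -> nmodType.

Definition foursum : nmodType :=
  (XK false * XK true * XA false * XA true)%type.

Definition inK0 (x : XK false) : foursum := (x, 0, 0, 0).
Definition inK1 (x : XK true) : foursum := (0, x, 0, 0).
Definition inA0 (x : XA false) : foursum := (0, 0, x, 0).
Definition inA1 (x : XA true) : foursum := (0, 0, 0, x).

Variable pKK : forall e e', XK e -> XK e' -> XK (e (+) e').
Variable pKA : forall e e', XK e -> XA e' -> XA (e (+) e').
Variable pAK : forall e e', XA e -> XK e' -> XA (e (+) e').
Variable pAA : forall e e', XA e -> XA e' -> XK (e (+) e').

Definition foursum_mul (x y : foursum) : foursum :=
  let: (x0, x1, u0, u1) := x in let: (y0, y1, v0, v1) := y in
  (pKK x0 y0 + pKK x1 y1 + pAA u0 v0 + pAA u1 v1,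
   pKK x0 y1 + pKK x1 y0 + pAA u0 v1 + pAA u1 v0,
   pKA x0 v0 + pKA x1 v1 + pAK u0 y0 + pAK u1 y1,
   pKA x0 v1 + pKA x1 v0 + pAK u0 y1 + pAK u1 y0).

(* orth tells whether the involution is orthogonal.                           *)
Definition foursum_comp (orth : Prop) (g : Gamma) : set foursum :=
  match g with
  | Gp => range inK0
  | Gm => range inK1
  | Go => if `[< orth >] then range inA0 else range inA1
  | Gs => if `[< orth >] then range inA1 else range inA0
  end.

End FourSum.

Arguments inK0 : clear implicits.

Definition comm_semiring (S : nmodType) (one : S) (mul : S -> S -> S) : Prop :=
  [/\ associative mul, commutative mul, left_id one mul,
      left_distributive mul +%R & left_zero 0 mul].

Definition Gamma_graded (S : nmodType) (one : S) (mul : S -> S -> S)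
    (comp : Gamma -> set S) : Prop :=
  [/\ forall g, comp g 0 /\ forall x y, comp g x -> comp g y -> comp g (x + y),
      forall x, exists! c : Gamma -> S, (forall g, comp g (c g)) /\
        x = c Gp + c Gm + c Go + c Gs,
      comp Gp one
    & forall g d x y, comp g x -> comp d y -> comp (Gamma_mul g d) (mul x y)].

Definition comm_graded_semiring (S : nmodType) (one : S) (mul : S -> S -> S)
    (comp : Gamma -> set S) : Prop :=
  comm_semiring one mul /\ Gamma_graded one mul comp.

(* A commutative ring is a commutative semiring whose additive monoid is a    *)
(* group (a zmodType).                                                        *)
Definition comm_graded_algebra (R S : zmodType) (oneR : R) (mulR : R -> R -> R)
    (scale : R -> S -> S) (one : S) (mul : S -> S -> S)
    (comp : Gamma -> set S) : Prop :=
  [/\ comm_semiring oneR mulR,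
      comm_graded_semiring one mul comp,
      [/\ forall a b x, scale a (scale b x) = scale (mulR a b) x,
          left_id oneR scale, right_distributive scale +%R
        & forall x, {morph scale^~ x : a b / a + b}],
      forall a x y, mul (scale a x) y = scale a (mul x y)
    & forall g a x, comp g x -> comp g (scale a x)].

Section MixedMonoid.
Variables (K : fieldType) (A : falgType K) (sigma : {linear A -> A}).

Definition mulKK e e' : SGWK K e -> SGWK K e' -> SGWK K (e (+) e') :=
  class_prod (@clsK K e) (@clsK K e') (@clsK K _) (@prodKK K e e').
Definition mulKA e e' : SGWK K e -> SGWA sigma e' -> SGWA sigma (e (+) e') :=
  class_prod (@clsK K e) (@clsA K A sigma e') (@clsA K A sigma _)
    (@prodKA K A sigma e e').
Definition mulAK e e' : SGWA sigma e -> SGWK K e' -> SGWA sigma (e (+) e') :=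
  class_prod (@clsA K A sigma e) (@clsK K e') (@clsA K A sigma _)
    (@prodAK K A sigma e e').
Definition mulAA e e' : SGWA sigma e -> SGWA sigma e' -> SGWK K (e (+) e') :=
  class_prod (@clsA K A sigma e) (@clsA K A sigma e') (@clsK K _)
    (@prodAA K A sigma e e').

Definition well_defined_products : Prop := forall e e',
  [/\ well_defined_prod (@clsK K e) (@clsK K e') (@clsK K _) (@prodKK K e e'),
      well_defined_prod (@clsK K e) (@clsA K A sigma e') (@clsA K A sigma _)
        (@prodKA K A sigma e e'),
      well_defined_prod (@clsA K A sigma e) (@clsK K e') (@clsA K A sigma _)
        (@prodAK K A sigma e e')
    & well_defined_prod (@clsA K A sigma e) (@clsA K A sigma e') (@clsK K _)
        (@prodAA K A sigma e e')].

Definition SGWt : nmodType := foursum (SGWK K) (SGWA sigma).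
Definition SGWt_mul : SGWt -> SGWt -> SGWt :=
  foursum_mul mulKK mulKA mulAK mulAA.
Definition SGWt_one : SGWt := inK0 (SGWK K) (SGWA sigma) (clsK (unitK K)).
Definition SGWt_comp : Gamma -> set SGWt :=
  @foursum_comp (SGWK K) (SGWA sigma) (orthogonal_involution sigma).

Definition GWK (e : bool) : zmodType := groth (SGWK K e).
Definition GWA (e : bool) : zmodType := groth (SGWA sigma e).

Definition GWt : zmodType :=
  (GWK false * GWK true * GWA false * GWA true)%type.
Definition GWt_in (x : SGWt) : GWt :=
  (groth_in x.1.1.1, groth_in x.1.1.2, groth_in x.1.2, groth_in x.2).

Definition GWt_mul : GWt -> GWt -> GWt :=
  @foursum_mul GWK GWA (fun e e' => groth_ext2 (@mulKK e e'))
    (fun e e' => groth_ext2 (@mulKA e e'))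
    (fun e e' => groth_ext2 (@mulAK e e'))
    (fun e e' => groth_ext2 (@mulAA e e')).
Definition GWt_one : GWt := GWt_in SGWt_one.
Definition GWt_comp : Gamma -> set GWt :=
  @foursum_comp GWK GWA (orthogonal_involution sigma).

Definition GWK_mul : GWK false -> GWK false -> GWK false :=
  groth_ext2 (@mulKK false false).
Definition GWK_one : GWK false := groth_in (clsK (unitK K)).
Definition GWt_scale (a : GWK false) : GWt -> GWt :=
  GWt_mul (inK0 GWK GWA a).

End MixedMonoid.

(* Main.v *)
Require Import Defs.
From mathcomp Require Import all_boot all_algebra all_field.
From HB Require Import structures.
From mathcomp Require Import boolp classical_sets.

(** Every law asserted here is an isometry between two products, and products
    are generated by pure tensors. Two nondegenerate forms with equal Gram
    values on families that generate additively are isometric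
    ([family_isometry]). So a product is determined by the Gram values of its
    pure tensors ([gram_prod_unique]); distributivity, the unit law,
    commutativity and all cases of associativity but one are identities
    between Gram values ([gram_mulC], [gram_mulA]).

    The remaining case is associativity for three modules U, V, W over A,
    where u (x) (v (x) w) and (u (x) v) (x) w have different Gram values. Let
    g = sum_i x_i (x) b_i be the Goldman element of A (x) A, i.e. the one with
    sum_i x_i a b_i = Trd a for all a; over a splitting field it is the
    operator exchanging two vectors. The twisted family
    sum_i u x_i (x) (v (x) w b_i) still generates, because g has square 1
    ([goldman_square]), and it has the Gram values of (u (x) v) (x) w
    ([twisted_gram]); this is what [assoc_family] says.

    For the existence of products, a tensor product of abelian groups is
    given scalars and a form ([tensor_space]); the point is that the form is
    nondegenerate. This follows from dual frames, families with
    u = sum_i w_i h(g_i, u) for all u. They exist over K by linear algebra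
    ([dual_frame]); over A they are obtained from a K-frame of the form
    Trd o h, corrected by an element of reduced trace 1 ([herm_frame]).

    All this rests on the reduced trace, which is defined by a choice among
    all splittings of A, over unrelated fields. A splitting exists: among all
    unital maps from A to n by n matrices over an extension of K, one with n
    minimal has scalar centraliser, as adjoining an eigenvalue of a nonscalar
    matrix in the centraliser would decrease n ([semirep_shrink]), and then it
    is a splitting, since the operators x |-> sum_i a_i x b_i are all the
    endomorphisms of A ([sandwich_onto]). Its value does not depend on the
    splitting: there sigma becomes y |-> C y^T C^-1 with C^T = C or C^T = -C
    ([split_invol_adjoint]), so the trace of the K-linear operator
    x |-> a sigma(x) is the trace of a up to that sign
    ([split_invol_trace]), and the sign can be read off from the dimensions
    over K of the spaces of symmetric and of skew elements ([split_sign]).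

    Finally GW is reached from SGW because its elements are differences of
    elements of SGW ([semiring_completion]). *)

Set Implicit Arguments.
Unset Strict Implicit.
Unset Printing Implicit Defensive.
Import GRing.Theory.
Local Open Scope ring_scope.

(** * The multiplication algebra of a central simple algebra *)

Definition lin_of (R : pzRingType) (U V : lmodType R) (f : U -> V)
  (fL : linear f) : {linear U -> V} :=
  HB.pack f (GRing.isLinear.Build R U V *:%R f fL).

Lemma sum_pair (I J : finType) (V : nmodType) (F : I * J -> V) :
  \sum_p F p = \sum_i \sum_j F (i, j).
Proof. by rewrite pair_bigA; apply: eq_bigr => -[]. Qed.

(** The largest subspace all of whose vectors satisfy P contains every vector
    satisfying P, as it could otherwise be enlarged. *)
Lemma vspace_of (F : fieldType) (V : vectType F) (P : V -> Prop) :
  P 0 -> (forall k u v, P u -> P v -> P (k *: u + v)) ->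
  exists W : {vspace V}, forall v, v \in W <-> P v.
Proof.
move=> P0 PD.
pose Q d := `[< exists2 W : {vspace V}, {in W, forall v, P v} & \dim W = d >].
have exQ : exists d, Q d.
  exists 0%N; apply/asboolP; exists 0%VS; last exact: dimv0.
  by move=> v; rewrite memv0 => /eqP->.
have Qle d : Q d -> (d <= dim V)%N.
  by move/asboolP=> [W _ <-]; rewrite -dimvf dimvS ?subvf.
case: (ex_maxnP exQ Qle) => d /asboolP[W WP dW] dmax.
exists W => v; split=> [/WP //|Pv]; apply/negPn/negP => vW.
suff /dmax : Q (\dim (W + <[v]>)).
  rewrite -dW (leqNgt _ (\dim W)) => /negP; apply.
  rewrite ltn_neqAle dimvS ?addvSl // andbT.
  apply/negP => /eqP/(esym)/eqP; rewrite eq_sym (dimv_leqif_sup (addvSl _ _)).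
  by rewrite subv_add => /andP[_]; rewrite -memvE (negPf vW).
apply/asboolP; eexists; last by [].
move=> _ /memv_addP[w Ww [_ /vlineP[k ->] ->]].
by rewrite addrC; apply: PD => //; apply: WP.
Qed.

Section Sandwich.
Variables (K : fieldType) (A : falgType K).
Hypothesis csA : central_simple A.

(** Injectivity of the map from the tensor square of A to its endomorphisms.
    The first coefficients of the relations sum_i a_i x c_i = 0 form a
    two-sided ideal. If it is not 0, some relation has a_0 = 1; its
    commutators with any d are shorter relations, hence vanish, so that all
    its coefficients are scalars and the c_i are dependent. *)
Lemma sandwich_free n (a c : 'I_n -> A) :
  (forall k : 'I_n -> K, \sum_i k i *: c i = 0 -> forall i, k i = 0) ->
  (forall x, \sum_i a i * x * c i = 0) -> forall i, a i = 0.
Proof.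
have [cA sA] := csA.
elim: n a c => [|n IH] a c freec rel; first by case.
have tail (b : 'I_n.+1 -> A) : b ord0 = 0 ->
    (forall x, \sum_i b i * x * c i = 0) -> forall i, b i = 0.
  move=> b0 relb i; case: (unliftP ord0 i) => [j ->|-> //].
  apply: (IH (fun j => b (lift ord0 j)) (fun j => c (lift ord0 j)))
    => [k k0 {}j|x].
    pose k' i := if unlift ord0 i is Some j then k j else 0.
    have := freec k' _ (lift ord0 j); rewrite /k' liftK; apply.
    rewrite big_ord_recl unlift_none scale0r add0r -[RHS]k0.
    by apply: eq_bigr => l _; rewrite liftK.
  by have := relb x; rewrite big_ord_recl b0 !mul0r add0r.
pose P w := exists2 b : 'I_n.+1 -> A, b ord0 = w &
  forall x, \sum_i b i * x * c i = 0.
have [I IP] : exists I : {vspace A}, forall w, w \in I <-> P w.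
  apply: vspace_of => [|k u v [b <- br] [d <- dr]].
    by exists (fun=> 0) => // x; rewrite big1 // => i _; rewrite !mul0r.
  exists (fun i => k *: b i + d i) => // x.
  transitivity (k *: (\sum_i b i * x * c i) + \sum_i d i * x * c i).
    rewrite scaler_sumr -big_split /=; apply: eq_bigr => i _.
    by rewrite !mulrDl !scalerAl.
  by rewrite br dr scaler0 addr0.
have {sA} [| |I0|IA] := sA I.
- apply/prodvP => y w _ /IP[b <- br]; apply/IP.
  exists (fun i => y * b i) => // x.
  transitivity (y * \sum_i b i * x * c i); last by rewrite br mulr0.
  by rewrite mulr_sumr; apply: eq_bigr => i _; rewrite !mulrA.
- apply/prodvP => w y /IP[b <- br] _; apply/IP.
  exists (fun i => b i * y) => // x; rewrite -[RHS](br (y * x)).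
  by apply: eq_bigr => i _; rewrite !mulrA.
- apply: tail => //; apply/eqP; rewrite -memv0 -I0; apply/IP.
  by exists a.
have /IP[b b0 br] : 1 \in I by rewrite IA memvf.
have comm d i : d * b i = b i * d.
  apply/eqP; rewrite -subr_eq0; apply/eqP; move: i.
  apply: (tail (fun i => d * b i - b i * d));
    first by rewrite b0 mulr1 mul1r subrr.
  move=> x.
  transitivity (d * (\sum_i b i * x * c i) - \sum_i b i * (d * x) * c i).
    rewrite mulr_sumr -sumrB; apply: eq_bigr => i _.
    by rewrite !mulrBl !mulrA.
  by rewrite !br mulr0 subr0.
have /fin_all_exists[k kP] i : exists k, b i = k%:A.
  apply/vlineP; have : b i \in 'Z({:A})%VS.
    by rewrite memv_cap memvf; apply/centvP => d _; rewrite comm.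
  by rewrite cA.
have /(freec k)/(_ ord0) k0 : \sum_i k i *: c i = 0.
  rewrite -[RHS](br 1); apply: eq_bigr => i _.
  by rewrite mulr1 kP mulr_algl.
by move: b0; rewrite kP k0 scale0r => /esym/eqP; rewrite oner_eq0.
Qed.

Local Notation N := (\dim {:A}).
Local Notation b i := ((vbasis {:A})`_i).

Lemma coordK (x : A) : x = \sum_(i < N) coord (vbasis {:A}) i x *: b i.
Proof. exact/coord_vbasis/memvf. Qed.

Lemma vbasis_indep (k : 'I_N -> K) :
  \sum_i k i *: b i = 0 -> forall i, k i = 0.
Proof. exact/freeP/basis_free/vbasisP. Qed.

(** By [sandwich_free] and a count of dimensions. *)
Lemma sandwich_onto (f : 'End(A)) :
  exists a : 'I_N -> A, forall x, f x = \sum_i a i * x * b i.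
Proof.
pose T := {ffun 'I_N -> A}.
pose op (a : T) (x : A) : A := \sum_i a i * x * b i.
have opL a : linear (op a).
  move=> k x y; rewrite /op scaler_sumr -big_split /=; apply: eq_bigr => i _.
  by rewrite mulrDr mulrDl -scalerAr -scalerAl.
pose opl a : {linear A -> A} := lin_of (opL a).
pose Phi (a : T) : 'End(A) := linfun (opl a).
have PhiE a x : Phi a x = op a x by rewrite lfunE.
have PhiL : linear Phi.
  move=> k a c; apply/lfunP => x; rewrite add_lfunE scale_lfunE !PhiE /op.
  rewrite scaler_sumr -big_split /=; apply: eq_bigr => i _.
  by rewrite !ffunE !mulrDl !scalerAl.
pose Phil : {linear T -> 'End(A)} := lin_of PhiL.
pose P : 'Hom(T, 'End(A)) := linfun Phil.
have kerP : lker P == 0%VS.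
  apply/lker0P => a c; rewrite !lfunE /= => eqac.
  apply/ffunP => i; apply/eqP; rewrite -subr_eq0; apply/eqP; move: i.
  apply: (sandwich_free vbasis_indep) => x.
  have := congr1 (fun f : 'End(A) => f x) eqac; rewrite !PhiE /op => E.
  rewrite -[RHS](subrr (op a x)) {2}/op E -sumrB.
  by apply: eq_bigr => i _; rewrite !mulrBl.
have /memv_imgP[a _ Pa] : f \in limg P.
  suff -> : limg P = fullv by apply: memvf.
  apply/eqP; rewrite eqEdim subvf /= limg_dim_eq ?(eqP kerP) ?capv0 //.
  have -> : \dim {:T} = (#|'I_N| * dim A)%N by apply: dimvf.
  have -> : \dim {:'End(A)} = (dim A * dim A)%N by apply: dimvf.
  by rewrite card_ord dimvf.
by exists a => x; rewrite Pa lfunE PhiE.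
Qed.

(** A relation between operators of A holds already in the tensor square of A
    over K, so every K-balanced map respects it. *)
Lemma sandwich_bilin (X : zmodType) (beta : A -> A -> X) (I : Type)
    (r : seq I) (a c : I -> A) :
  (forall x y z, beta (x + y) z = beta x z + beta y z) ->
  (forall x y z, beta x (y + z) = beta x y + beta x z) ->
  (forall k x y, beta x (k *: y) = beta (k *: x) y) ->
  (forall x, \sum_(s <- r) a s * x * c s = 0) ->
  \sum_(s <- r) beta (a s) (c s) = 0.
Proof.
move=> betaDl betaDr betaZ rel.
have beta0l y : beta 0 y = 0.
  by apply: (addrI (beta 0 y)); rewrite -betaDl !addr0.
have beta0r x : beta x 0 = 0.
  by apply: (addrI (beta x 0)); rewrite -betaDr !addr0.
pose k i s := coord (vbasis {:A}) i (c s).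
have rel0 : forall i, \sum_(s <- r) k i s *: a s = 0.
  apply: (sandwich_free vbasis_indep) => x; rewrite -[RHS](rel x).
  under eq_bigr do rewrite mulr_suml mulr_suml.
  rewrite exchange_big; apply: eq_bigr => s _.
  rewrite [c s]coordK mulr_sumr; apply: eq_bigr => i _.
  by rewrite -!scalerAl scalerAr.
transitivity (\sum_(s <- r) \sum_i beta (k i s *: a s) (b i)).
  apply: eq_bigr => s _; rewrite {1}[c s]coordK.
  rewrite (big_morph _ (betaDr _) (beta0r _)); apply: eq_bigr => i _.
  by rewrite betaZ.
rewrite exchange_big big1 // => i _.
by rewrite -(big_morph (beta^~ _) (fun x y => betaDl x y _) (beta0l _)) rel0.
Qed.

Lemma sandwich_bilin_eq (X : zmodType) (beta : A -> A -> X) (I J : Type)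
    (r : seq I) (a c : I -> A) (s : seq J) (d e : J -> A) :
  (forall x y z, beta (x + y) z = beta x z + beta y z) ->
  (forall x y z, beta x (y + z) = beta x y + beta x z) ->
  (forall k x y, beta x (k *: y) = beta (k *: x) y) ->
  (forall x, \sum_(i <- r) a i * x * c i = \sum_(j <- s) d j * x * e j) ->
  \sum_(i <- r) beta (a i) (c i) = \sum_(j <- s) beta (d j) (e j).
Proof.
move=> betaDl betaDr betaZ rel.
have betaN x y : beta (- x) y = - beta x y.
  apply: (addrI (beta x y)); rewrite -betaDl !subrr.
  by apply: (addrI (beta 0 y)); rewrite -betaDl !addr0.
pose t := [seq (a i, c i) | i <- r] ++ [seq (- d j, e j) | j <- s].
have := @sandwich_bilin X beta _ t fst snd betaDl betaDr betaZ.
rewrite !big_cat !big_map /= => H; apply/eqP; rewrite -subr_eq0; apply/eqP.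
rewrite -sumrN -[RHS]H => [|x]; last first.
  rewrite big_cat !big_map /= rel.
  rewrite -[RHS](subrr (\sum_(j <- s) d j * x * e j)) -sumrN.
  by congr (_ + _); apply: eq_bigr => j _; rewrite !mulNr.
by congr (_ + _); apply: eq_bigr => j _; rewrite betaN.
Qed.

End Sandwich.

(** * Existence of a splitting field *)

(** Adjoin a root of an irreducible factor. *)
Lemma adjoin_root (L : fieldType) (p : {poly L}) : (1 < size p)%N ->
  exists (M : fieldType) (j : {rmorphism L -> M}) x, root (map_poly j p) x.
Proof.
have [n] := ubnP (size p); elim: n p => // n IH p pn p1.
have [irr|] := EM (irreducible_poly p).
  have [M _ [z rz _]] := irredp_FAdjoin irr.
  by exists M, (in_alg M), z.
move=> nirr; have [q [q1 qp qnp]] :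
    exists q : {poly L}, [/\ size q != 1, q %| p & ~~ (q %= p)].
  apply: contrapT => noq; apply: nirr; split=> // q q1 qp.
  by apply/negPn/negP => qnp; apply: noq; exists q.
have p0 : p != 0 by rewrite -size_poly_gt0 ltnW.
have q0 : q != 0 by apply: contraNneq p0 => q0; move: qp; rewrite q0 dvd0p.
have qs : (size q < size p)%N.
  rewrite ltn_neqAle dvdp_leq // andbT.
  by rewrite (dvdp_size_eqp qp).
have [| |M [j [x rx]]] := IH q.
- by apply: leq_trans qs _; rewrite -ltnS.
- by rewrite ltn_neqAle eq_sym q1 size_poly_gt0.
exists M, j, x; move: rx; rewrite !root_factor_theorem => /dvdp_trans; apply.
by rewrite dvdp_map.
Qed.

Section Splitting.
Variables (K : fieldType) (A : falgType K).

(** The conditions on a splitting, apart from the one on bases. *)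
Record semirep (L : fieldType) (iota : {rmorphism K -> L}) n
    (phi : A -> 'M[L]_n) : Prop := Semirep {
  srD : forall a b, phi (a + b) = phi a + phi b;
  sr1 : phi 1 = 1%:M;
  srM : forall a b, phi (a * b) = phi a *m phi b;
  srZ : forall k a, phi (k *: a) = iota k *: phi a }.

Section Semirep.
Variables (L : fieldType) (iota : {rmorphism K -> L}) (n : nat).
Variable phi : A -> 'M[L]_n.
Hypothesis rep : semirep iota phi.

Lemma sr0 : phi 0 = 0.
Proof. by rewrite -(scale0r (0 : A)) (srZ rep) rmorph0 scale0r. Qed.

Lemma sr_sum I (r : seq I) (F : I -> A) :
  phi (\sum_(i <- r) F i) = \sum_(i <- r) phi (F i).
Proof. exact: (big_morph phi (srD rep) sr0). Qed.

Lemma srB a b : phi (a - b) = phi a - phi b.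
Proof. by rewrite (srD rep) -scaleN1r (srZ rep) rmorphN1 scaleN1r. Qed.

Lemma semirep_rmorphism : exists psi : {rmorphism A -> 'M[L]_n}, psi =1 phi.
Proof.
have phiB : zmod_morphism phi by move=> a b; apply: srB.
have phiM : monoid_morphism phi by split; [apply: (sr1 rep) | apply: (srM rep)].
pose psi : {rmorphism A -> 'M[L]_n} := HB.pack phi
  (GRing.isZmodMorphism.Build _ _ _ phiB)
  (GRing.isMonoidMorphism.Build _ _ _ phiM).
by exists psi.
Qed.

(** Let x be an eigenvalue of y in an extension of L. Then y - x is neither 0
    nor invertible, and its row space is stable under A. *)
Lemma semirep_shrink y : (0 < n)%N -> (forall a, phi a *m y = y *m phi a) ->
  (forall l, y <> l%:M) ->
  exists m, [/\ (0 < m)%N, (m < n)%N & exists (M : fieldType)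
    (iota' : {rmorphism K -> M}) (psi : A -> 'M[M]_m), semirep iota' psi].
Proof.
move=> n0 yC yns.
have [|M [j [x rx]]] := @adjoin_root L (char_poly y).
  by rewrite size_char_poly.
pose z := map_mx j y - x%:M; pose r := \rank z.
have zC a : map_mx j (phi a) *m z = z *m map_mx j (phi a).
  by rewrite mulmxBr mulmxBl -!map_mxM yC scalar_mxC.
have z0 : z != 0.
  apply/eqP => /eqP; rewrite subr_eq0 => /eqP yx.
  apply: (yns (y (Ordinal n0) (Ordinal n0))); apply/matrixP => i k.
  apply: (fmorph_inj j); have yE a b := congr1 (fun m : 'M_n => m a b) yx.
  have := yE i k; rewrite !mxE => ->; have := yE (Ordinal n0) (Ordinal n0).
  by rewrite !mxE eqxx mulr1n => <-; rewrite rmorphMn.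
have rn : (r < n)%N.
  rewrite ltn_neqAle rank_leq_row andbT; apply/negP => zf.
  have /eigenvalueP[v vy v0] : eigenvalue (map_mx j y) x.
    by rewrite eigenvalue_root_char -map_char_poly.
  have : v *m z = 0 by rewrite mulmxBr vy mul_mx_scalar subrr.
  rewrite -(mul0mx _ z) => /(row_free_inj zf) v00.
  by rewrite v00 eqxx in v0.
pose W := row_base z.
pose psi a := W *m map_mx j (phi a) *m pinvmx W.
have psiE a : psi a *m W = W *m map_mx j (phi a).
  rewrite mulmxKpV // eq_row_base (eqmxMr _ (eq_row_base z)) -zC.
  exact: submxMl.
have psi_inj a B : B *m W = W *m map_mx j (phi a) -> psi a = B.
  by move=> E; apply: (row_free_inj (row_base_free z)); rewrite psiE.
exists r; split=> //; first by rewrite lt0n mxrank_eq0.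
exists M, (j \o iota : {rmorphism K -> M}), psi; split=> [a b||a b|k a].
- by apply: psi_inj; rewrite mulmxDl !psiE (srD rep) map_mxD mulmxDr.
- by apply: psi_inj; rewrite (sr1 rep) map_mx1 mulmx1 mul1mx.
- by apply: psi_inj; rewrite -mulmxA psiE mulmxA psiE -mulmxA (srM rep) map_mxM.
- by apply: psi_inj; rewrite -scalemxAl psiE (srZ rep) map_mxZ scalemxAr.
Qed.
End Semirep.

Local Notation N := (\dim {:A}).
Local Notation b i := ((vbasis {:A})`_i).

(** Right multiplication: matrices act on row vectors. *)
Lemma regular_semirep :
  semirep (idfun : {rmorphism K -> K})
    (fun a => \matrix_(i < N, j < N) coord (vbasis {:A}) j (b i * a)).
Proof.
have free_b : free (vbasis {:A}) by apply/basis_free/vbasisP.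
split=> [a c||a c|k a]; apply/matrixP => i j; rewrite !mxE.
- by rewrite mulrDr linearD.
- by rewrite mulr1 coord_free // -val_eqE.
- rewrite mulrA {1}[b i * a]coordK mulr_suml linear_sum.
  apply: eq_bigr => l _ /=.
  by rewrite -scalerAl linearZ !mxE.
- by rewrite -scalerAr linearZ.
Qed.

Hypothesis csA : central_simple A.

(** The coordinate functionals of A, as operators with scalar values. *)
Lemma dual_operators : exists a : 'I_N -> 'I_N -> A,
  (forall k x, \sum_i a k i * x * b i = (coord (vbasis {:A}) k x)%:A).
Proof.
have /fin_all_exists[a aP] k : exists a : 'I_N -> A,
    forall x, \sum_i a i * x * b i = (coord (vbasis {:A}) k x)%:A.
  pose f (x : A) : A := (coord (vbasis {:A}) k x)%:A.
  have fL : linear f by move=> c x y; rewrite /f linearP scalerDl scalerA.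
  have [a aP] := sandwich_onto csA (linfun (lin_of fL)).
  by exists a => x; rewrite -aP lfunE.
by exists a.
Qed.

(** Applied inside the matrix algebra, the operators of [dual_operators]
    project any matrix y onto the centraliser of A (FC) and recover y from
    these projections (FK). When the centraliser consists of scalars, the
    images of a basis of A therefore span. The same projections extract the
    coefficients of a linear relation between these images. *)
Lemma splitting_exists : exists (L : fieldType) (iota : {rmorphism K -> L}) n
  (phi : {rmorphism A -> 'M[L]_n}), is_splitting iota phi.
Proof.
pose Q n := `[< (0 < n)%N /\ exists (L : fieldType) (iota : {rmorphism K -> L})
  (phi : A -> 'M[L]_n), semirep iota phi >].
have exQ : exists n, Q n.
  exists N; apply/asboolP; split; last by do 3 eexists; apply: regular_semirep.
  rewrite lt0n dimv_eq0; apply/eqP => A0.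
  by have := memvf (1 : A); rewrite A0 memv0 oner_eq0.
case: (ex_minnP exQ) => n /asboolP[n0 [L [iota [phi rep]]]] nmin {exQ}.
have [psi psiE] := semirep_rmorphism rep.
exists L, iota, n, psi; split=> [k a|]; first by rewrite !psiE (srZ rep).
have scal y : (forall a, phi a *m y = y *m phi a) -> exists l, y = l%:M.
  move=> yC; apply: contrapT => yns.
  have [l yl|m [m0 mn ex]] := semirep_shrink rep n0 yC.
    by apply: yns; exists l.
  by have := nmin m; rewrite leqNgt mn => /(_ _)/negP; case=> //; apply/asboolP.
have [a aP] := dual_operators.
pose F k (y : 'M[L]_n) : 'M[L]_n := \sum_i phi (a k i) *m y *m phi (b i).
have bil y I J (r : seq I) (c d : I -> A) (s : seq J) (c' d' : J -> A) :
    (forall x, \sum_(i <- r) c i * x * d i = \sum_(j <- s) c' j * x * d' j) ->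
    \sum_(i <- r) phi (c i) *m y *m phi (d i)
      = \sum_(j <- s) phi (c' j) *m y *m phi (d' j).
  apply: (sandwich_bilin_eq (beta := fun c d => phi c *m y *m phi d) csA)
    => [x x' z|x z z'|k x z].
  - by rewrite (srD rep) !mulmxDl.
  - by rewrite (srD rep) !mulmxDr.
  - by rewrite !(srZ rep) -scalemxAr !scalemxAl.
have FC k y c : phi c *m F k y = F k y *m phi c.
  rewrite mulmx_sumr mulmx_suml.
  under eq_bigr do rewrite !mulmxA -(srM rep).
  under [RHS]eq_bigr do rewrite -mulmxA -(srM rep).
  apply: bil => x.
  transitivity (c * \sum_i a k i * x * b i).
    by rewrite mulr_sumr; apply: eq_bigr => i _; rewrite !mulrA.
  transitivity ((\sum_i a k i * x * b i) * c).
    by rewrite aP mulr_algl mulr_algr.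
  by rewrite mulr_suml; apply: eq_bigr => i _; rewrite !mulrA.
have FK (y : 'M[L]_n) : y = \sum_(k < N) phi (b k) *m F k y.
  transitivity (\sum_(i <- [:: tt]) phi 1 *m y *m phi 1).
    by rewrite big_seq1 (sr1 rep) mul1mx mulmx1.
  rewrite (bil _ _ _ _ _ _ (index_enum ('I_N * 'I_N)%type)
    (fun p : 'I_N * 'I_N => b p.1 * a p.1 p.2) (fun p => b p.2)).
    rewrite sum_pair; apply: eq_bigr => k _.
    rewrite mulmx_sumr; apply: eq_bigr => i _.
    by rewrite (srM rep) !mulmxA.
  move=> x; rewrite big_seq1 mul1r mulr1.
  rewrite sum_pair /= {1}[x]coordK.
  apply: eq_bigr => k _; rewrite -mulr_algr -aP mulr_sumr.
  by apply: eq_bigr => i _; rewrite !mulrA.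
have phib i : (map psi (vbasis {:A}))`_i = psi (b i).
  have [iN|iN] := ltnP i N; first by rewrite (nth_map 0) ?size_tuple.
  by rewrite !nth_default ?rmorph0 ?size_map ?size_tuple.
rewrite /basis_of; apply/andP; split.
  rewrite eqEsubv subvf /=; apply/subvP => y _.
  rewrite [y]FK memv_suml // => k _; have [l ->] := scal _ (fun c => FC k y c).
  rewrite mul_mx_scalar memvZ // memv_span // -psiE.
  by rewrite map_f // mem_nth // size_tuple.
have /(@freeP _ _ N (map_tuple psi (vbasis {:A}))) : forall c : 'I_N -> L,
    \sum_i c i *: (map psi (vbasis {:A}))`_i = 0 -> forall i, c i = 0.
  move=> c c0 k.
  have : F k (\sum_i c i *: phi (b i)) = 0.
    transitivity (F k 0).
      congr (F k _); rewrite -[RHS]c0; apply: eq_bigr => i _.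
      by rewrite phib psiE.
    by rewrite /F big1 // => i _; rewrite mulmx0 mul0mx.
  have -> : F k (\sum_i c i *: phi (b i)) = (c k)%:M.
    transitivity (\sum_i c i *: F k (phi (b i))).
      rewrite /F; under [RHS]eq_bigr do rewrite scaler_sumr.
      rewrite exchange_big; apply: eq_bigr => j _.
      rewrite mulmx_sumr mulmx_suml; apply: eq_bigr => i _.
      by rewrite -scalemxAr -scalemxAl.
    have Fphi x : F k (phi x) = (iota (coord (vbasis {:A}) k x))%:M.
      transitivity (phi (\sum_i a k i * x * b i)).
        by rewrite (sr_sum rep); apply: eq_bigr => i _; rewrite !(srM rep).
      by rewrite aP (srZ rep) (sr1 rep) scalemx1.
    rewrite (bigD1 k) //= big1 => [|i ik];
      rewrite Fphi coord_free ?(basis_free (vbasisP _)) //.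
      by rewrite eqxx rmorph1 scalemx1 addr0.
    case: (_ =P _) => [E|_]; last by rewrite (rmorph0 iota) raddf0 scaler0.
    by case/eqP: ik; apply: val_inj; rewrite /= E.
  move=> /(congr1 (fun m : 'M_n => m (Ordinal n0) (Ordinal n0))).
  by rewrite !mxE eqxx.
by [].
Qed.
End Splitting.

(** * Matrix algebras and splittings *)

Section MatrixAlgebra.
Variables (L : fieldType) (n : nat).
Hypothesis n0 : (0 < n)%N.
Implicit Types y z : 'M[L]_n.

Lemma central_mx_scalar y : (forall z, z *m y = y *m z) -> exists l, y = l%:M.
Proof.
move=> yC; pose i0 := Ordinal n0; exists (y i0 i0); apply/matrixP => j k.
have := congr1 (fun m : 'M_n => m i0 k) (yC (delta_mx i0 j)).
rewrite !mxE (bigD1 j) //= big1 => [|l lj];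
  last by rewrite mxE (negPf lj) andbF mul0r.
rewrite mxE !eqxx mul1r addr0 (bigD1 i0) //= big1 => [|l lj];
  last by rewrite mxE (negPf lj) mulr0.
by rewrite mxE eqxx addr0 /= => ->; rewrite eq_sym mulr_natr.
Qed.

(** Row i of S is row j of psi (E_0i), where j is chosen such that row j of
    psi (E_00) is not 0. *)
Lemma skolem_noether (psi : {linear 'M[L]_n -> 'M[L]_n}) :
  psi 1%:M = 1%:M ->
  (forall y z, psi (y *m z) = psi y *m psi z) ->
  exists2 S, S \in unitmx & forall y, y *m S = S *m psi y.
Proof.
move=> psi1 psiM; pose i0 := Ordinal n0.
have psi_sum I (r : seq I) (c : I -> L) (F : I -> 'M[L]_n) :
    psi (\sum_(i <- r) c i *: F i) = \sum_(i <- r) c i *: psi (F i).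
  rewrite linear_sum; apply: eq_bigr => i _; exact: linearZ_LR.
have [j [k jk]] : exists j k, psi (delta_mx i0 i0) j k != 0.
  apply: contrapT => no.
  have p0 : psi (delta_mx i0 i0) = 0.
    apply/matrixP => j k; rewrite mxE; apply/eqP/negPn/negP => jk.
    by apply: no; exists j, k.
  have : psi 1%:M = 0.
    rewrite [1%:M]matrix_sum_delta.
    rewrite linear_sum big1 // => i _; rewrite psi_sum big1 // => l _.
    rewrite -(mul_delta_mx i0) -(mul_delta_mx i0 i0) !psiM p0.
    by rewrite mul0mx mulmx0 scaler0.
  rewrite psi1 => /matrixP/(_ i0 i0); rewrite !mxE eqxx => /eqP.
  by rewrite oner_eq0.
pose S := \matrix_(i, l) psi (delta_mx i0 i) j l.
have SE y : y *m S = S *m psi y.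
  apply/matrixP => i l.
  transitivity (psi (delta_mx i0 i *m y) j l); last first.
    by rewrite psiM !mxE; apply: eq_bigr => m _; rewrite mxE.
  have -> : delta_mx i0 i *m y = \sum_m y i m *: delta_mx i0 m.
    apply/matrixP => a c; rewrite !mxE (bigD1 i) //= big1 => [|m mi];
      last first.
      by rewrite mxE (negPf mi) andbF mul0r.
    rewrite summxE (bigD1 c) //= big1 => [|m mc]; last first.
      by rewrite !mxE [c == m]eq_sym (negPf mc) andbF mulr0.
    by rewrite !mxE !eqxx !andbT mulrC !addr0.
  by rewrite psi_sum summxE !mxE; apply: eq_bigr => m _; rewrite !mxE.
exists S => //; rewrite -row_free_unit -kermx_eq0; apply/negPn/negP.
case/rowV0Pn => v /sub_kermxP vS /rV0Pn[m vm].
have S0 y : v *m y *m S = 0 by rewrite -mulmxA SE mulmxA vS mul0mx.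
move: jk => /negP; apply; apply/eqP.
have := congr1 (fun w : 'rV_n => w ord0 k)
  (S0 ((v ord0 m)^-1 *: delta_mx m i0)).
rewrite !mxE (bigD1 i0) //= big1 => [|a ai]; last first.
  rewrite !mxE big1 ?mul0r // => c _.
  by rewrite !mxE (negPf ai) andbF !mulr0.
rewrite !mxE (bigD1 m) //= big1 => [|a am]; last first.
  by rewrite !mxE (negPf am) !mulr0.
by rewrite !mxE !eqxx mulr1 !addr0 divff // mul1r.
Qed.

(** Both sides are the trace of F, computed in two bases. *)
Lemma sum_coord_trace r (X : r.-tuple 'M[L]_n)
    (F : {linear 'M[L]_n -> 'M[L]_n}) :
  basis_of fullv X ->
  \sum_(i < r) coord X i (F X`_i) = \sum_k \sum_l F (delta_mx k l) k l.
Proof.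
move=> bX.
transitivity (\sum_(i < r) \sum_k \sum_l
    X`_i k l * coord X i (F (delta_mx k l))).
  apply: eq_bigr => i _.
  rewrite {1}[X`_i]matrix_sum_delta linear_sum linear_sum.
  apply: eq_bigr => k _; rewrite linear_sum linear_sum.
  by apply: eq_bigr => l _ /=; rewrite linearZ_LR linearZ.
rewrite exchange_big; apply: eq_bigr => k _.
rewrite exchange_big; apply: eq_bigr => l _ /=.
rewrite {2}(coord_basis bX (memvf (F (delta_mx k l)))) summxE.
by apply: eq_bigr => i _; rewrite !mxE mulrC.
Qed.

End MatrixAlgebra.

Section SplitAlgebra.
Variables (K : fieldType) (A : falgType K).
Variables (L : fieldType) (iota : {rmorphism K -> L}) (n : nat).
Variable phi : {rmorphism A -> 'M[L]_n}.
Hypothesis spl : is_splitting iota phi.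

Local Notation N := (\dim {:A}).
Local Notation b i := ((vbasis {:A})`_i).
Local Notation X := (map_tuple phi (vbasis {:A})).

Lemma split_scale k a : phi (k *: a) = iota k *: phi a.
Proof. by case: spl. Qed.

Lemma split_basis : basis_of fullv X.
Proof. by case: spl. Qed.

Lemma nth_split (i : 'I_N) : X`_i = phi (b i).
Proof. by rewrite (nth_map 0) ?size_tuple. Qed.

Lemma split_coordK (y : 'M[L]_n) : y = \sum_i coord X i y *: phi (b i).
Proof.
rewrite {1}(coord_basis split_basis (memvf y)).
by apply: eq_bigr => i _; rewrite nth_split.
Qed.

Lemma split_coord i a : coord X i (phi a) = iota (coord (vbasis {:A}) i a).
Proof.
have freeX := basis_free split_basis.
rewrite {1}[a]coordK rmorph_sum linear_sum (bigD1 i) //= big1 => [|j ji].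
  rewrite split_scale -nth_split linearZ /= coord_free //.
  by rewrite eqxx mulr1 addr0.
rewrite split_scale -nth_split linearZ /= coord_free //.
case: (_ =P _) => [E|_]; last by rewrite mulr0.
by case/eqP: ji; apply: val_inj; rewrite /= E.
Qed.

Lemma split_inj : injective phi.
Proof.
move=> x y xy; rewrite [x]coordK [y]coordK; apply: eq_bigr => i _.
by congr (_ *: _); apply: (fmorph_inj iota); rewrite -!split_coord xy.
Qed.

Lemma split_ext (V : lmodType L) (f g : {linear 'M[L]_n -> V}) :
  (forall a, f (phi a) = g (phi a)) -> f =1 g.
Proof.
move=> fg y; rewrite [y]split_coordK !linear_sum; apply: eq_bigr => i _.
by rewrite !linearZ_LR fg.
Qed.

Lemma split_gt0 : (0 < n)%N.
Proof.
rewrite lt0n; apply/eqP => n0.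
have /split_inj/eqP : phi 1 = phi 0.
  by apply/matrixP => i; have := ltn_ord i; rewrite [X in (_ < X)%N]n0.
by rewrite oner_eq0.
Qed.

(** A K-free family of A is mapped to an L-free one, because the rank of the
    matrix of its coordinates does not change under extension of scalars. *)
Lemma split_dim_le (U : {vspace A}) (W : {vspace 'M[L]_n}) :
  (forall x, x \in U -> phi x \in W) -> (\dim U <= \dim W)%N.
Proof.
move=> UW; pose u (i : 'I_(\dim U)) := (vbasis U)`_i.
pose R := \matrix_(i < \dim U, j < N) coord (vbasis {:A}) j (u i).
have Rfree : row_free R.
  rewrite -kermx_eq0; apply/negPn/negP => /rowV0Pn[v /sub_kermxP vR].
  suff vz : forall i, v ord0 i = 0.
    by case/negP; apply/eqP/rowP => i; rewrite mxE vz.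
  apply: (elimT (@freeP _ _ _ (vbasis U)) (basis_free (vbasisP U))).
  rewrite [LHS]coordK big1 // => j _; rewrite linear_sum /=.
  have := congr1 (fun w : 'rV_N => w ord0 j) vR; rewrite !mxE => v0.
  rewrite (_ : \sum_i _ = 0) ?scale0r // -[RHS]v0.
  by apply: eq_bigr => i _; rewrite linearZ /= mxE.
have Yfree : free (map_tuple phi (vbasis U)).
  apply/freeP => c c0.
  suff /rowP c00 : \row_i c i = 0 by move=> i; have := c00 i; rewrite !mxE.
  have RL : row_free (map_mx iota R) by rewrite row_free_map.
  apply: (row_free_inj RL); rewrite mul0mx; apply/rowP => j; rewrite !mxE.
  have := congr1 (coord X j) c0; rewrite linear_sum linear0 => {}c0.
  rewrite -[RHS]c0; apply: eq_bigr => i _.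
  rewrite linearZ /= (nth_map 0) ?size_tuple //.
  by rewrite split_coord !mxE.
move: Yfree; rewrite /free size_map size_tuple => /eqP<-.
apply/dimvS/span_subvP => _ /mapP[x xU ->]; apply: UW.
exact: (vbasis_mem xU).
Qed.

(** By [split_dim_le] neither the kernel nor the image can shrink, and their
    dimensions have the same sum on both sides. *)
Lemma split_dim_lker (f : 'End(A)) (F : 'End('M[L]_n)) :
  (forall x, phi (f x) = F (phi x)) -> \dim (lker f) = \dim (lker F).
Proof.
move=> fF; have dN : N = \dim {:'M[L]_n} by rewrite (size_basis split_basis).
have kle : (\dim (lker f) <= \dim (lker F))%N.
  by apply: split_dim_le => x; rewrite !memv_ker -fF => /eqP->; rewrite rmorph0.
have ile : (\dim (limg f) <= \dim (limg F))%N.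
  by apply: split_dim_le => _ /memv_imgP[y _ ->]; rewrite fF memv_img ?memvf.
have := limg_ker_dim f fullv; have := limg_ker_dim F fullv.
rewrite -dN !capfv => <- /(congr1 (subn^~ (\dim (limg f)))).
rewrite addnK => E; apply/eqP; rewrite eqn_leq kle E /=.
by rewrite -addnBA // leq_addr.
Qed.

End SplitAlgebra.

(** * The reduced trace and the Goldman element *)

Lemma mul_delta_entry (F : fieldType) n (P Q : 'M[F]_n) i j k l :
  (P *m (delta_mx k l *m Q)) i j = P i k * Q l j.
Proof.
rewrite mxE (bigD1 k) //= big1 => [|m mk]; last first.
  by rewrite !mxE big1 ?mulr0 // => c _; rewrite !mxE (negPf mk) mul0r.
rewrite mxE (bigD1 l) //= big1 => [|m ml];
  last by rewrite !mxE (negPf ml) andbF mul0r.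
by rewrite !mxE !eqxx mul1r !addr0.
Qed.

Section ReducedTrace.
Variables (K : fieldType) (A : falgType K) (sigma : {linear A -> A}).
Hypothesis char2 : 2%N \notin [pchar K].
Hypothesis csA : central_simple A.
Hypothesis invol : involution_first_kind sigma.

Local Notation N := (\dim {:A}).
Local Notation b i := ((vbasis {:A})`_i).

Lemma sigmaM x y : sigma (x * y) = sigma y * sigma x.
Proof. by case: invol. Qed.

Lemma sigmaK : involutive sigma.
Proof. by case: invol. Qed.

Lemma sigma1 : sigma 1 = 1.
Proof. by rewrite -[LHS]mulr1 -{2}[1]sigmaK -sigmaM mulr1 sigmaK. Qed.

Lemma sigmaZ k : sigma k%:A = k%:A.
Proof. by rewrite linearZ /= sigma1. Qed.

Section OneSplitting.
Variables (L : fieldType) (iota : {rmorphism K -> L}) (n : nat).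
Variable phi : {rmorphism A -> 'M[L]_n}.
Hypothesis spl : is_splitting iota phi.

Local Notation X := (map_tuple phi (vbasis {:A})).
Let n0 : (0 < n)%N := split_gt0 spl.

(** The extension of sigma to matrices, by L-linearity. *)
Lemma split_invol_exists : exists s : {linear 'M[L]_n -> 'M[L]_n},
  forall a, s (phi a) = phi (sigma a).
Proof.
pose s (y : 'M[L]_n) : 'M[L]_n := \sum_i coord X i y *: phi (sigma (b i)).
have sL : linear s.
  move=> k y z; rewrite /s scaler_sumr -big_split /=; apply: eq_bigr => i _.
  by rewrite linearP scalerDl scalerA.
exists (lin_of sL) => a; rewrite /= /s {2}[a]coordK linear_sum rmorph_sum.
apply: eq_bigr => i _.
by rewrite linearZ_LR (split_scale spl) (split_coord spl).
Qed.

Section Adjoint.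
Variable s : {linear 'M[L]_n -> 'M[L]_n}.
Hypothesis s_phi : forall a, s (phi a) = phi (sigma a).

Lemma split_involM y z : s (y *m z) = s z *m s y.
Proof.
have ext2 y0 z0 : s (phi y0 *m z0) = s z0 *m s (phi y0).
  pose f := s \o mulmx (phi y0).
  pose g := mulmxr (s (phi y0)) \o s.
  apply: (split_ext (f := f) (g := g) spl) => a.
  by rewrite /= -[phi y0 *m _]rmorphM !s_phi sigmaM rmorphM.
pose f := s \o mulmxr z.
pose g := mulmx (s z) \o s.
by apply: (split_ext (f := f) (g := g) spl) => a; apply: ext2.
Qed.

Lemma split_involK : involutive s.
Proof.
pose g : {linear 'M[L]_n -> 'M[L]_n} := idfun.
by apply: (split_ext (f := s \o s) (g := g) spl) => a; rewrite /= !s_phi sigmaK.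
Qed.

(** Skolem-Noether, applied to y |-> (s y)^T, yields C. That s is an involution
    makes C (C^T)^-1 central, so C = l C^T with l ^ 2 = 1. *)
Lemma split_invol_adjoint : exists (C : 'M[L]_n) (d : bool),
  [/\ C \in unitmx, C = (-1) ^+ d *: C^T
    & forall y, s y = C *m y^T *m invmx C].
Proof.
pose psi : {linear 'M[L]_n -> 'M[L]_n} := trmx \o s.
have [||S uS SE] := skolem_noether n0 (psi := psi).
- by rewrite /= -[1%:M](rmorph1 phi) s_phi sigma1 rmorph1 -[1]/1%:M trmx1.
- by move=> y z; rewrite /= split_involM trmx_mul.
pose C := S^T; have uC : C \in unitmx by rewrite unitmx_tr.
have uCT : C^T \in unitmx by rewrite unitmx_tr.
have sE y : s y = C *m y^T *m invmx C.
  apply: trmx_inj; rewrite !trmx_mul trmx_inv !trmxK -/(psi y).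
  by rewrite SE mulKmx.
pose D := C *m invmx C^T.
have [l lE] : exists l, D = l%:M.
  apply: (central_mx_scalar n0) => y.
  have yC : y *m C = D *m y *m C^T.
    rewrite -{1}[y]split_involK !sE !trmx_mul trmxK trmx_inv !mulmxA.
    by rewrite mulmxKV.
  by rewrite mulmxA yC mulmxK.
have Cl : C = l *: C^T by rewrite -mul_scalar_mx -lE mulmxKV.
have CT : C^T = l *: C by rewrite {1}Cl linearZ /= trmxK.
have : (1 - l ^+ 2) *: C == 0.
  by rewrite scalerBl scale1r expr2 -scalerA -CT -Cl subrr.
rewrite scaler_eq0 orbC => /orP[/eqP C0|]; last first.
  rewrite subr_eq0 eq_sym sqrf_eq1 => /orP[]/eqP ld.
    by exists C, false; split=> //; rewrite expr0 -ld.
  by exists C, true; split=> //; rewrite expr1 -ld.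
have := mulmxV uC; rewrite C0 mul0mx => /matrixP/(_ (Ordinal n0) (Ordinal n0)).
by rewrite !mxE eqxx => /esym/eqP; rewrite oner_eq0.
Qed.
End Adjoint.

Lemma split_invol_exists_adjoint : exists (C : 'M[L]_n) (d : bool),
  [/\ C \in unitmx, C = (-1) ^+ d *: C^T
    & forall a, phi (sigma a) = C *m (phi a)^T *m invmx C].
Proof.
have [s s_phi] := split_invol_exists.
have [C [d [uC CT sE]]] := split_invol_adjoint s_phi.
by exists C, d; split=> // a; rewrite -s_phi sE.
Qed.

(** The trace of the K-linear operator x |-> a (sigma x). *)
Definition invol_trace (a : A) : K :=
  \sum_(i < N) coord (vbasis {:A}) i (a * sigma (b i)).

Section Sign.
Variables (C : 'M[L]_n) (d : bool).
Hypothesis uC : C \in unitmx.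
Hypothesis CT : C = (-1) ^+ d *: C^T.
Hypothesis sC : forall a, phi (sigma a) = C *m (phi a)^T *m invmx C.

Let sg : L := (-1) ^+ d.

Let CT' : C^T = sg *: C.
Proof. by rewrite {1}CT linearZ /= trmxK. Qed.

Lemma split_invol_trace a : iota (invol_trace a) = sg * \tr (phi a).
Proof.
pose F : {linear 'M[L]_n -> 'M[L]_n} :=
  mulmx (phi a *m C) \o mulmxr (invmx C) \o trmx.
transitivity (\sum_i coord X i (F X`_i)).
  rewrite rmorph_sum; apply: eq_bigr => i _.
  by rewrite -(split_coord spl) rmorphM sC nth_split /= -mulmxE !mulmxA.
rewrite (sum_coord_trace F (split_basis spl)) /=; set P := phi a *m C.
transitivity (\sum_k \sum_l P k l * (invmx C) k l).
  apply: eq_bigr => k _; apply: eq_bigr => l _.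
  by rewrite trmx_delta mul_delta_entry.
transitivity (\tr (P *m (invmx C)^T)).
  by apply: eq_bigr => k _; rewrite mxE; apply: eq_bigr => l _; rewrite !mxE.
have uCT : C^T \in unitmx by rewrite unitmx_tr.
by rewrite trmx_inv /P {1}CT -scalemxAr -scalemxAl linearZ /= mulmxK.
Qed.

(** The symmetric elements of A for [e = false], the skew ones for
    [e = true]. *)
Definition eps_space (e : bool) : {vspace A} :=
  lker (linfun sigma - (-1) ^+ e *: \1)%VF.

(** After y |-> y C, the two spaces become those of skew and of symmetric
    matrices. The map w that reflects the entries above the diagonal embeds
    the former in the latter, and misses the identity matrix. *)
Lemma split_sign : (\dim (eps_space (~~ d)) < \dim (eps_space d))%N.
Proof.
pose s : {linear 'M[L]_n -> 'M[L]_n} := mulmx C \o mulmxr (invmx C) \o trmx.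
pose W (e : bool) : {vspace 'M[L]_n} := lker (linfun s - (-1) ^+ e *: \1)%VF.
have dimW e : \dim (eps_space e) = \dim (W e).
  apply: (split_dim_lker spl) => x.
  rewrite !add_lfunE !opp_lfunE !scale_lfunE !id_lfunE !lfunE /= rmorphB.
  by rewrite (split_scale spl) rmorph_sign sC mulmxA.
have WP e y : (y \in W e) = ((y *m C)^T == (-1) ^+ (d (+) e) *: (y *m C)).
  rewrite memv_ker add_lfunE opp_lfunE scale_lfunE id_lfunE lfunE /= subr_eq0.
  rewrite signr_addb -scalerA trmx_mul CT' -scalemxAl mulmxA.
  rewrite (inj_eq (scalerI (negbT (signr_eq0 _ _)))).
  apply/eqP/eqP => E; first by rewrite scalemxAl -E mulmxKV.
  by rewrite E -scalemxAl mulmxK.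
have two0 : 2%:R != 0 :> L.
  by rewrite -(rmorph_nat iota) fmorph_eq0; move: char2; rewrite inE.
pose w (z : 'M[L]_n) : 'M[L]_n :=
  \matrix_(i, j) if (i < j)%N then z i j else if (j < i)%N then z j i else 0.
have wL : linear (fun y => w (y *m C) *m invmx C).
  move=> k y z; rewrite scalemxAl -mulmxDl; congr (_ *m _).
  apply/matrixP => i j; rewrite mulmxDl -scalemxAl !mxE; case: ifP => _ //.
  by case: ifP => _ //; rewrite mulr0 addr0.
pose G : 'End('M[L]_n) := linfun (lin_of wL).
have GE y : G y *m C = w (y *m C) by rewrite lfunE /= mulmxKV.
have skew0 : (W (~~ d) :&: lker G = 0)%VS.
  apply/eqP; rewrite -subv0; apply/subvP => y.
  rewrite memv_cap memv0 WP => /andP[].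
  rewrite addbN addbb expr1 scaleN1r memv_ker => /eqP yC /eqP Gy.
  have skew i j : (y *m C) j i = - (y *m C) i j.
    by have := congr1 (fun m : 'M_n => m i j) yC; rewrite mxE [RHS]mxE.
  have wy : w (y *m C) = 0 by rewrite -GE Gy mul0mx.
  have upper (i j : 'I_n) : (i < j)%N -> (y *m C) i j = 0.
    move=> ij; have := congr1 (fun m : 'M_n => m i j) wy.
    by rewrite [LHS]mxE ij [RHS]mxE.
  rewrite -[y](mulmxK uC) (_ : y *m C = 0) ?mul0mx //; apply/matrixP => i j.
  rewrite [RHS]mxE; have [ij|ji|/val_inj ->] := ltngtP i j.
  - exact: upper.
  - by rewrite skew upper ?oppr0.
  apply/eqP; rewrite -(mulrI_eq0 _ (mulfI two0)) mulr_natl mulr2n.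
  by rewrite {1}skew addNr.
have sub : (G @: W (~~ d) <= W d)%VS.
  apply/subvP => _ /memv_imgP[y _ ->]; rewrite WP addbb scale1r GE.
  apply/eqP/matrixP => i j; rewrite mxE [LHS]mxE [RHS]mxE.
  by case: ltngtP.
rewrite !dimW -(limg_dim_eq skew0) ltn_neqAle (dimvS sub) andbT.
apply/negP => /eqP E.
have /memv_imgP[y _ Cy] : invmx C \in (G @: W (~~ d))%VS.
  have /eqP -> : (G @: W (~~ d))%VS == W d by rewrite eqEdim sub E leqnn.
  by rewrite WP addbb scale1r mulVmx // trmx1.
have := GE y; rewrite -Cy mulVmx // => /matrixP/(_ (Ordinal n0) (Ordinal n0)).
by rewrite !mxE ltnn eqxx => /eqP; rewrite oner_eq0.
Qed.
End Sign.

End OneSplitting.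

(** The sign d0 depends only on A and sigma, so that a single K-linear form,
    [invol_trace] up to this sign, becomes the trace in every splitting. *)
Lemma Trd_splitting (L : fieldType) (iota : {rmorphism K -> L}) n
    (phi : {rmorphism A -> 'M[L]_n}) a :
  is_splitting iota phi -> iota (Trd a) = \tr (phi a).
Proof.
pose d0 : bool := (\dim (eps_space false) < \dim (eps_space true))%N.
have trE (L' : fieldType) (iota' : {rmorphism K -> L'}) n'
    (phi' : {rmorphism A -> 'M[L']_n'}) : is_splitting iota' phi' ->
    iota' ((-1) ^+ d0 * invol_trace a) = \tr (phi' a).
  move=> spl; have [C [d [uC CT sC]]] := split_invol_exists_adjoint spl.
  have -> : d0 = d.
    have := split_sign spl uC CT sC; rewrite /d0; case: d {CT sC} => //= lt10.
    by apply/negbTE; rewrite -leqNgt ltnW.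
  rewrite rmorphM rmorph_sign (split_invol_trace spl uC CT sC) mulrA -expr2.
  by rewrite sqrr_sign mul1r.
move=> spl; have -> : Trd a = (-1) ^+ d0 * invol_trace a;
  last exact: (trE _ _ _ _ spl).
apply: xget_unique.
  by exists L, iota, n, phi; split; [exact: spl | exact: (trE _ _ _ _ spl)].
move=> t [L' [iota' [n' [phi' [spl' tE]]]]].
by apply: (fmorph_inj iota'); rewrite tE (trE _ _ _ _ spl').
Qed.

Lemma Trd_linear k (x y : A) : Trd (k *: x + y) = k * Trd x + Trd y :> K.
Proof.
have [L [iota [n [phi spl]]]] := splitting_exists csA.
apply: (fmorph_inj iota); rewrite rmorphD rmorphM !(Trd_splitting _ spl).
by rewrite rmorphD (split_scale spl) linearP.
Qed.

Lemma TrdD (x y : A) : Trd (x + y) = Trd x + Trd y :> K.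
Proof. by rewrite -[x]scale1r Trd_linear scale1r mul1r. Qed.

Lemma Trd0 : Trd (0 : A) = 0 :> K.
Proof. by apply: (addrI (Trd (0 : A))); rewrite -TrdD !addr0. Qed.

Lemma TrdZ k (x : A) : Trd (k *: x) = k * Trd x :> K.
Proof. by rewrite -[k *: x]addr0 Trd_linear Trd0 addr0. Qed.

Lemma Trd_sum I (r : seq I) (F : I -> A) :
  Trd (\sum_(i <- r) F i) = \sum_(i <- r) Trd (F i) :> K.
Proof. exact: (big_morph _ TrdD Trd0). Qed.

Lemma TrdC (x y : A) : Trd (x * y) = Trd (y * x) :> K.
Proof.
have [L [iota [n [phi spl]]]] := splitting_exists csA.
apply: (fmorph_inj iota).
by rewrite !(Trd_splitting _ spl) !rmorphM /= mxtrace_mulC.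
Qed.

Lemma Trd_sigma x : Trd (sigma x) = Trd x :> K.
Proof.
have [L [iota [n [phi spl]]]] := splitting_exists csA.
have [C [d [uC CT sC]]] := split_invol_exists_adjoint spl.
apply: (fmorph_inj iota); rewrite !(Trd_splitting _ spl) sC.
by rewrite mxtrace_mulC mulKmx // mxtrace_tr.
Qed.

(** The family x is chosen to give the operator a |-> (Trd a)1. Over a
    splitting field sum_i phi(x_i) z phi(b_i) = tr(z), whence
    sum_i Trd(x_i) b_i = 1 on taking matrix units for z. This normalisation
    makes x and b dual bases for the trace form, and the other three
    identities follow. *)
Lemma goldman : exists x : 'I_N -> A,
  [/\ forall a, \sum_(i < N) x i * a * b i = (Trd a)%:A,
      forall a, \sum_(i < N) b i * a * x i = (Trd a)%:A,
      forall a, \sum_(i < N) Trd (b i * a) *: x i = a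
    & forall a, \sum_(i < N) Trd (x i * a) *: b i = a].
Proof.
pose f (a : A) : A := (Trd a)%:A.
have fL : linear f by move=> k y z; rewrite /f Trd_linear scalerDl scalerA.
have [x xP] := sandwich_onto csA (linfun (lin_of fL)).
have {xP} G1 a : \sum_(i < N) x i * a * b i = (Trd a)%:A by rewrite -xP lfunE.
have e1 : \sum_(i < N) Trd (x i) *: b i = 1.
  have [L [iota [n [phi spl]]]] := splitting_exists csA.
  pose F (z : 'M[L]_n) := \sum_i phi (x i) *m (z *m phi (b i)).
  have FL : linear F.
    move=> k y z; rewrite /F scaler_sumr -big_split /=; apply: eq_bigr => i _.
    by rewrite mulmxDl mulmxDr -!scalemxAl -scalemxAr.
  have trL : linear (fun z : 'M[L]_n => (\tr z)%:M : 'M[L]_n).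
    by move=> k y z; rewrite linearP /= raddfD /= scale_scalar_mx.
  have FE z : F z = (\tr z)%:M.
    apply: (split_ext (f := lin_of FL) (g := lin_of trL) spl) => a /=.
    rewrite -(Trd_splitting a spl) -scalemx1 -[1%:M](rmorph1 phi).
    rewrite -(split_scale spl) -G1 rmorph_sum; apply: eq_bigr => i _.
    by rewrite !rmorphM -!mulmxE mulmxA.
  apply: (split_inj spl); rewrite rmorph1 rmorph_sum; apply/matrixP => i j.
  transitivity (\sum_k F (delta_mx k i) k j).
    rewrite summxE; under [RHS]eq_bigr do rewrite summxE.
    rewrite exchange_big; apply: eq_bigr => l _.
    rewrite (split_scale spl) (Trd_splitting _ spl) mxE mulr_suml.
    by apply: eq_bigr => k _; rewrite mul_delta_entry.
  rewrite (bigD1 i) //= big1 => [|k ki]; rewrite FE.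
    rewrite /mxtrace (bigD1 i) //= big1 => [|l li]; rewrite !mxE ?(negPf li) //.
    by rewrite !eqxx !addr0.
  rewrite /mxtrace big1 ?raddf0 ?mxE // => l _; rewrite mxE.
  by case: eqP => //= ->; rewrite (negPf ki).
have G4 a : \sum_(i < N) Trd (b i * a) *: x i = a.
  transitivity (\sum_i x i * (Trd (b i * a))%:A).
    by apply: eq_bigr => i _; rewrite mulr_algr.
  transitivity (\sum_i (Trd (x i))%:A * a * b i).
    under eq_bigr do rewrite -G1 mulr_sumr.
    rewrite exchange_big; apply: eq_bigr => i _ /=.
    rewrite -G1 !mulr_suml; apply: eq_bigr => j _.
    by rewrite !mulrA.
  transitivity (a * \sum_(i < N) Trd (x i) *: b i); last by rewrite e1 mulr1.
  rewrite mulr_sumr; apply: eq_bigr => i _.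
  by rewrite mulr_algl -scalerAl scalerAr.
have G4b (i : 'I_N) : b i = \sum_(j < N) Trd (b i * b j) *: x j.
  by rewrite -{1}[b i]G4; apply: eq_bigr => j _; rewrite TrdC.
exists x; split=> // [a|c].
  rewrite -G1; under eq_bigr => i _.
    rewrite [b i]G4b !mulr_suml; under eq_bigr do rewrite -!scalerAl.
    over.
  rewrite exchange_big; apply: eq_bigr => j _ /=.
  transitivity (x j * a * \sum_(i < N) Trd (b j * b i) *: x i);
    last by rewrite -G4b.
  by rewrite mulr_sumr; apply: eq_bigr => i _; rewrite TrdC scalerAr.
rewrite -[RHS]G4; under eq_bigr => i _.
  rewrite [b i]G4b scaler_sumr; under eq_bigr do rewrite scalerA.
  over.
rewrite exchange_big; apply: eq_bigr => j _ /=; rewrite -scaler_suml.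
congr (_ *: _).
transitivity (Trd ((\sum_(i < N) Trd (b j * b i) *: x i) * c));
  last by rewrite -G4b.
rewrite mulr_suml Trd_sum; apply: eq_bigr => i _.
by rewrite -scalerAl TrdZ mulrC [Trd (b i * b j)]TrdC.
Qed.

End ReducedTrace.

(** * Tensor products of abelian groups *)

(** No inverses occur in the sums: pure tensors are stable under opposite. *)
Definition gen_by (S : Type) (P : zmodType) (p : S -> P) : Prop :=
  forall x, exists l : seq S, x = \sum_(s <- l) p s.

Definition biadditive (M N P : zmodType) (t : M -> N -> P) : Prop :=
  (forall m m' n, t (m + m') n = t m n + t m' n) /\
  (forall m n n', t m (n + n') = t m n + t m n').

Section Biadditive.
Variables (M N P : zmodType) (t : M -> N -> P).
Hypothesis tB : biadditive t.

Lemma biaddl m m' n : t (m + m') n = t m n + t m' n. Proof. by case: tB. Qed.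
Lemma biaddr m n n' : t m (n + n') = t m n + t m n'. Proof. by case: tB. Qed.
Lemma biadd0l n : t 0 n = 0.
Proof. by apply: (addrI (t 0 n)); rewrite -biaddl !addr0. Qed.
Lemma biadd0r m : t m 0 = 0.
Proof. by apply: (addrI (t m 0)); rewrite -biaddr !addr0. Qed.
Lemma biaddNl m n : t (- m) n = - t m n.
Proof. by apply: (addrI (t m n)); rewrite -biaddl !subrr biadd0l. Qed.
Lemma biaddNr m n : t m (- n) = - t m n.
Proof. by apply: (addrI (t m n)); rewrite -biaddr !subrr biadd0r. Qed.
Lemma biadd_suml I (r : seq I) F n :
  t (\sum_(i <- r) F i) n = \sum_(i <- r) t (F i) n.
Proof. exact: (big_morph (t^~ n) (fun x y => biaddl x y n) (biadd0l n)). Qed.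
Lemma biadd_sumr I (r : seq I) F m :
  t m (\sum_(i <- r) F i) = \sum_(i <- r) t m (F i).
Proof. exact: (big_morph (t m) (biaddr m) (biadd0r m)). Qed.
End Biadditive.

Section Generation.
Variable S : Type.

Lemma gen_compl (Q P' X : zmodType) (p : S -> Q) (t : Q -> X -> P') :
  biadditive t -> gen_by p -> gen_by (fun y : Q * X => t y.1 y.2) ->
  gen_by (fun y : S * X => t (p y.1) y.2).
Proof.
move=> tB gp gt x; have [l ->] := gt x.
elim: l => [|[q y] l [l' IH]]; first by exists [::]; rewrite !big_nil.
have [k kq] := gp q; exists ([seq (s, y) | s <- k] ++ l').
by rewrite big_cons big_cat -IH big_map /= kq (biadd_suml tB).
Qed.

Lemma gen_compr (Q P' X : zmodType) (p : S -> Q) (t : X -> Q -> P') :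
  biadditive t -> gen_by p -> gen_by (fun y : X * Q => t y.1 y.2) ->
  gen_by (fun y : X * S => t y.1 (p y.2)).
Proof.
move=> tB gp gt x; have [l ->] := gt x.
elim: l => [|[y q] l [l' IH]]; first by exists [::]; rewrite !big_nil.
have [k kq] := gp q; exists ([seq (y, s) | s <- k] ++ l').
by rewrite big_cons big_cat -IH big_map /= kq (biadd_sumr tB).
Qed.
End Generation.

Section TensorProduct.
Variables (R : Type) (M N : zmodType) (ra : M -> R -> M) (la : R -> N -> N).

Lemma balanced_biadditive (X : zmodType) (f : M -> N -> X) :
  balanced ra la f -> biadditive f.
Proof. by case. Qed.

(** The tensor product is a quotient of the lists of pairs. Two lists are
    identified if every balanced map has the same sum along both; so the
    universal property holds by definition. *)
Section Construction.

Let ev (X : zmodType) (f : M -> N -> X) (s : seq (M * N)) : X :=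
  \sum_(p <- s) f p.1 p.2.

Let teq (s s' : seq (M * N)) : Prop :=
  forall (X : zmodType) (f : M -> N -> X), balanced ra la f -> ev f s = ev f s'.

Let teqP s s' : teq s = teq s' <-> teq s s'.
Proof.
split=> [-> //|ss']; apply: funext => z; apply: propext.
by split=> E X f bf; rewrite -E // ss'.
Qed.

Let ev_cat (X : zmodType) (f : M -> N -> X) s s' :
  ev f (s ++ s') = ev f s + ev f s'.
Proof. exact: big_cat. Qed.

Let catR x x' y y' : teq x x' -> teq y y' -> teq (x ++ y) (x' ++ y').
Proof. by move=> xx' yy' X f bf; rewrite !ev_cat xx' ?yy'. Qed.
Let catAR x y z : teq (x ++ (y ++ z)) ((x ++ y) ++ z).
Proof. by rewrite catA. Qed.
Let catCR x y : teq (x ++ y) (y ++ x).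
Proof. by move=> X f bf; rewrite !ev_cat addrC. Qed.
Let cat0R x : teq ([::] ++ x) x.
Proof. by []. Qed.

Definition tens : Type := classes teq.

Let topp (x : tens) : tens := cls teq [seq (- p.1, p.2) | p <- rep x].

Let addN : left_inverse (cls teq [::]) topp (@cop _ _ teq cat).
Proof.
move=> x; rewrite /topp -{2}[x]repK (cop_cls teqP catR); apply/(clsP teqP).
move=> X f bf; rewrite ev_cat /ev big_map big_nil -big_split big1 //= => p _.
by rewrite (biaddNl (balanced_biadditive bf)) addNr.
Qed.

HB.instance Definition _ := Choice.copy tens (classes teq).
HB.instance Definition _ := GRing.isZmodule.Build tens
  (copA teqP catR catAR) (copC teqP catR catCR) (cop0 teqP catR cat0R) addN.

Definition tmk (m : M) (n : N) : tens := cls teq [:: (m, n)].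

Let tmk_gen (s : seq (M * N)) : cls teq s = \sum_(p <- s) tmk p.1 p.2.
Proof.
elim: s => [|p s IH]; first by rewrite big_nil.
rewrite big_cons -IH; transitivity (cop cat (tmk p.1 p.2) (cls teq s)) => //.
by rewrite (cop_cls teqP catR); case: p.
Qed.

Lemma tens_exists : exists (T : zmodType) (t : M -> N -> T),
  is_tensor ra la t /\ gen_by (fun p : M * N => t p.1 p.2).
Proof.
exists tens, tmk; split; last first.
  by move=> x; exists (rep x); rewrite -tmk_gen repK.
have tmkE s s' : teq s s' ->
    \sum_(p <- s) tmk p.1 p.2 = \sum_(p <- s') tmk p.1 p.2.
  by rewrite -!tmk_gen => ss'; apply/(clsP teqP).
split.
  split=> [m m' n|m n n'|m r n].
  - have := @tmkE [:: (m + m', n)] [:: (m, n); (m', n)].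
    rewrite !big_cons !big_nil !addr0; apply=> X f /balanced_biadditive fB.
    by rewrite /ev !big_cons !big_nil !addr0 /= (biaddl fB).
  - have := @tmkE [:: (m, n + n')] [:: (m, n); (m, n')].
    rewrite !big_cons !big_nil !addr0; apply=> X f /balanced_biadditive fB.
    by rewrite /ev !big_cons !big_nil !addr0 /= (biaddr fB).
  - apply/(clsP teqP) => X f bf; rewrite /ev !big_seq1 /=.
    by case: bf.
move=> X f bf; pose g (x : tens) : X := ev f (rep x).
have gE s : g (cls teq s) = ev f s.
  exact: (rep_cls teqP s) X f bf.
have gB : zmod_morphism g.
  move=> x y; rewrite -[x]repK -[y]repK.
  suff gD u v : g (u + v) = g u + g v.
    apply: (addIr (g (cls teq (rep y)))).
    by rewrite -gD subrK subrK.
  have -> : u + v = (cls teq (rep u ++ rep v) : tens) by [].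
  by rewrite gE ev_cat.
pose gg : {additive tens -> X} :=
  HB.pack g (GRing.isZmodMorphism.Build _ _ _ gB).
exists gg => [m n|g' g'E x]; first by rewrite /= gE /ev big_seq1.
rewrite -[x]repK tmk_gen !raddf_sum; apply: eq_bigr => p _.
by rewrite g'E /= gE /ev big_seq1.
Qed.

End Construction.

Section Universal.
Variables (T : zmodType) (t : M -> N -> T).
Hypothesis tT : is_tensor ra la t.

Lemma tensor_balanced : balanced ra la t. Proof. by case: tT. Qed.
Lemma tensor_biadditive : biadditive t.
Proof. exact/balanced_biadditive/tensor_balanced. Qed.

Lemma tensor_lift (X : zmodType) (f : M -> N -> X) : balanced ra la f ->
  exists g : {additive T -> X}, forall m n, g (t m n) = f m n.
Proof. by case: tT => _ univ bf; have [g gE _] := univ X f bf; exists g. Qed.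

Lemma tensor_ext (X : zmodType) (g g' : {additive T -> X}) :
  (forall m n, g (t m n) = g' (t m n)) -> g =1 g'.
Proof.
move=> gg'; have [tb univ] := tT; have [tDl tDr tr] := tb.
have [|h _ hU] := univ X (fun m n => g' (t m n)).
  by split=> [m m' n|m n n'|m r n]; rewrite ?tDl ?tDr ?tr ?raddfD.
by move=> x; rewrite (hU g) ?(hU g').
Qed.

(** True for the quotient of lists, hence for any tensor product. *)
Lemma tensor_gen : gen_by (fun p : M * N => t p.1 p.2).
Proof.
have [T0 [t0 [[t0b t0U] t0g]]] := tens_exists.
have [g gE] := tensor_lift t0b.
have [h hE _] := t0U T t tensor_balanced.
move=> x; have [l lE] := t0g (g x); exists l.
have -> : x = (h \o g) x.
  apply: (tensor_ext (g := idfun) (g' := h \o g)) => m n.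
  by rewrite /= gE hE.
by rewrite /= lE raddf_sum; apply: eq_bigr => p _; rewrite hE.
Qed.
End Universal.

(** Additive relations between pure tensors have to be checked only for sums
    equal to 0, since - t m n = t (- m) n. *)
Lemma is_tensorI (T : zmodType) (t : M -> N -> T) :
  balanced ra la t -> gen_by (fun p : M * N => t p.1 p.2) ->
  (forall (X : zmodType) (f : M -> N -> X) (l : seq (M * N)),
     balanced ra la f -> \sum_(p <- l) t p.1 p.2 = 0 ->
     \sum_(p <- l) f p.1 p.2 = 0) ->
  is_tensor ra la t.
Proof.
move=> tb tg faith; split=> // X f bf.
pose l x := sval (cid (tg x)).
have lE x : x = \sum_(p <- l x) t p.1 p.2 by rewrite /l; case: cid.
pose g x : X := \sum_(p <- l x) f p.1 p.2.
have gE s : g (\sum_(p <- s) t p.1 p.2) = \sum_(p <- s) f p.1 p.2.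
  set x := \sum_(p <- s) _.
  have := faith X f (l x ++ [seq (- p.1, p.2) | p <- s]) bf.
  have N1 (Y : zmodType) (h : M -> N -> Y) : biadditive h ->
      \sum_(p <- l x ++ [seq (- p.1, p.2) | p <- s]) h p.1 p.2 =
      \sum_(p <- l x) h p.1 p.2 - \sum_(p <- s) h p.1 p.2.
    move=> hB; rewrite big_cat big_map /= -sumrN; congr (_ + _).
    by apply: eq_bigr => p _; rewrite (biaddNl hB).
  rewrite (N1 _ t (balanced_biadditive tb)) (N1 _ f (balanced_biadditive bf)).
  rewrite -(lE x) subrr.
  by move=> /(_ erefl)/eqP; rewrite subr_eq0 => /eqP.
have gD x y : g (x + y) = g x + g y.
  by rewrite {1}[x]lE {1}[y]lE -big_cat gE big_cat.
have gB : zmod_morphism g.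
  by move=> x y; apply: (addIr (g y)); rewrite -gD !subrK.
pose gg : {additive T -> X} := HB.pack g (GRing.isZmodMorphism.Build _ _ _ gB).
have ggE m n : gg (t m n) = f m n.
  by have := gE [:: (m, n)]; rewrite !big_seq1.
exists gg => // g' g'E x; rewrite [x]lE !raddf_sum; apply: eq_bigr => p _.
by rewrite g'E ggE.
Qed.

End TensorProduct.

(** * Tensor products with scalars and forms *)

Lemma is_tensor_swap (R : Type) (M N T : zmodType) (ra : M -> R -> M)
    (la : R -> N -> N) (t : M -> N -> T) :
  is_tensor ra la t ->
  is_tensor (fun n r => la r n) (fun r m => ra m r) (fun n m => t m n).
Proof.
have swap (X : zmodType) (ra' : M -> R -> M) (la' : R -> N -> N)
    (f : M -> N -> X) :
    balanced ra' la' f ->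
    balanced (fun n r => la' r n) (fun r m => ra' m r) (fun n m => f m n).
  by case=> fDl fDr fr; split=> // n r m; rewrite fr.
have swap' (X : zmodType) (f : N -> M -> X) :
    balanced (fun n r => la r n) (fun r m => ra m r) f ->
    balanced ra la (fun m n => f n m).
  by case=> fDl fDr fr; split=> // n r m; rewrite fr.
case=> /swap tb tU; split=> // X f /swap'/tU[g gE gU].
by exists g => [n m|g' g'E]; [apply: gE | apply: gU].
Qed.

Lemma is_tensor_bij (R : Type) (M N T T' : zmodType) (ra : M -> R -> M)
    (la : R -> N -> N) (t : M -> N -> T) (h : {additive T -> T'}) :
  bijective h -> is_tensor ra la t -> is_tensor ra la (fun m n => h (t m n)).
Proof.
case=> h' hK h'K tT; have [tDl tDr tr] := tensor_balanced tT.
apply: is_tensorI => [|x|X f l bf].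
- by split=> *; rewrite ?tDl ?tDr ?raddfD ?tr.
- have [l lE] := tensor_gen tT (h' x); exists l.
  by rewrite -raddf_sum -lE h'K.
rewrite -raddf_sum -(raddf0 h) => /(can_inj hK) l0.
have [g gE] := tensor_lift tT bf.
transitivity (g (\sum_(p <- l) t p.1 p.2)); last by rewrite l0 raddf0.
by rewrite raddf_sum; apply: eq_bigr => p _; rewrite gE.
Qed.

Lemma tensor_lift_param (R : Type) (M N T Z X : zmodType) (ra : M -> R -> M)
    (la : R -> N -> N) (t : M -> N -> T) (mu : M -> N -> Z -> X) :
  is_tensor ra la t -> (forall z, balanced ra la (fun m n => mu m n z)) ->
  (forall m n z z', mu m n (z + z') = mu m n z + mu m n z') ->
  exists G : T -> Z -> X, biadditive G /\ forall m n z, G (t m n) z = mu m n z.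
Proof.
move=> tT mub muD; pose g z := cid (tensor_lift tT (mub z)).
exists (fun x z => sval (g z) x); split=> [|m n z]; last exact: (svalP (g z)).
split=> [x y z|x z z']; first by rewrite raddfD.
have [l ->] := tensor_gen tT x; rewrite !raddf_sum -big_split /=.
apply: eq_bigr => p _.
by rewrite (svalP (g z)) (svalP (g z')) (svalP (g _)) muD.
Qed.

Lemma tensor_pairing (R R' : Type) (M N T M' N' T' X : zmodType)
    (ra : M -> R -> M) (la : R -> N -> N) (t : M -> N -> T)
    (ra' : M' -> R' -> M') (la' : R' -> N' -> N') (t' : M' -> N' -> T')
    (mu : M -> N -> M' -> N' -> X) :
  is_tensor ra la t -> is_tensor ra' la' t' ->
  (forall m' n', balanced ra la (fun m n => mu m n m' n')) ->
  (forall m n, balanced ra' la' (mu m n)) ->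
  exists G : T -> T' -> X, biadditive G /\
    forall m n m' n', G (t m n) (t' m' n') = mu m n m' n'.
Proof.
move=> tT tT' mul mur; pose g m n := cid (tensor_lift tT' (mur m n)).
have gE m n m' n' : sval (g m n) (t' m' n') = mu m n m' n'.
  exact: (svalP (g m n)).
have [|m n z z'|G [GB GE]] :=
  tensor_lift_param (mu := fun m n z => sval (g m n) z) tT.
- move=> z; have [l ->] := tensor_gen tT' z.
  split=> [m m' n|m n n'|m x n]; rewrite !raddf_sum -?big_split;
    by apply: eq_bigr => p _ /=; have [mDl mDr mr] := mul p.1 p.2;
       rewrite !gE ?mDl ?mDr ?mr.
- by rewrite raddfD.
by exists G; split=> // m n m' n'; rewrite GE gE.
Qed.

(** The module axioms for a scalar action on an abelian group. *)
Record scaling (R : pzRingType) (T : zmodType) (f : R -> T -> T) : Prop :=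
  Scaling {
  scalingA : forall a b v, f a (f b v) = f (a * b) v;
  scaling1 : left_id 1 f;
  scalingDr : right_distributive f +%R;
  scalingDl : forall v, {morph f^~ v : a b / a + b} }.

(** A copy of T with the scalar action f. *)
Definition scaled (R : pzRingType) (T : zmodType) (f : R -> T -> T)
  of scaling f : Type := T.

Section Scaled.
Variables (R : pzRingType) (T : zmodType) (f : R -> T -> T) (fS : scaling f).
HB.instance Definition _ := GRing.Zmodule.on (scaled fS).
HB.instance Definition _ := GRing.Zmodule_isLmodule.Build R (scaled fS)
  (scalingA fS) (scaling1 fS) (scalingDr fS) (scalingDl fS).
End Scaled.

(** The tensor product of M and N receives the scalars R' acting through M,
    and the form with prescribed values on pure tensors. *)
Section TensorSpace.
Variables (R : Type) (M N : zmodType) (ra : M -> R -> M) (la : R -> N -> N).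
Variables (R' : pzRingType) (s : R' -> M -> M).
Hypothesis s_addr : forall r m m', s r (m + m') = s r m + s r m'.
Hypothesis s_addl : forall r r' m, s (r + r') m = s r m + s r' m.
Hypothesis s_1 : forall m, s 1 m = m.
Hypothesis s_mul : forall r r' m, s r (s r' m) = s (r * r') m.
Hypothesis s_ra : forall r m x, s r (ra m x) = ra (s r m) x.
Variables (Y : zmodType) (gamma : M -> N -> M -> N -> Y).
Hypothesis gamma_l : forall m' n', balanced ra la (fun m n => gamma m n m' n').
Hypothesis gamma_r : forall m n, balanced ra la (gamma m n).

Lemma tensor_space :
  exists (T : lmodType R') (t : M -> N -> T) (F : T -> T -> Y),
  [/\ is_tensor ra la t, forall r m n, t (s r m) n = r *: t m n, biadditive F
    & forall m n m' n', F (t m n) (t m' n') = gamma m n m' n'].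
Proof.
have [T [t [tT tg]]] := tens_exists ra la.
have [tDl tDr tr] := tensor_balanced tT.
have sc r : exists g : {additive T -> T}, forall m n, g (t m n) = t (s r m) n.
  apply: (tensor_lift tT); split=> [m m' n|m n n'|m x n].
  - by rewrite s_addr tDl.
  - by rewrite tDr.
  - by rewrite s_ra tr.
pose scale r x : T := sval (cid (sc r)) x.
have scale_sum r (l : seq (M * N)) :
    scale r (\sum_(p <- l) t p.1 p.2) = \sum_(p <- l) t (s r p.1) p.2.
  rewrite /scale; case: cid => g gE /=.
  by rewrite raddf_sum; apply: eq_bigr => p _; rewrite gE.
have scale_mk r m n : scale r (t m n) = t (s r m) n.
  by have := scale_sum r [:: (m, n)]; rewrite !big_seq1.
have scaleA a b v : scale a (scale b v) = scale (a * b) v.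
  have [l ->] := tg v; rewrite !scale_sum.
  have := scale_sum a [seq (s b p.1, p.2) | p <- l]; rewrite !big_map /= => ->.
  by apply: eq_bigr => p _; rewrite s_mul.
have scale1 : left_id 1 scale.
  move=> v; have [l ->] := tg v; rewrite scale_sum.
  by apply: eq_bigr => p _; rewrite s_1.
have scaleDr : right_distributive scale +%R.
  by move=> a x y; rewrite /scale raddfD.
have scaleDl v : {morph scale^~ v : a b / a + b}.
  move=> a b; have [l ->] := tg v; rewrite !scale_sum -big_split /=.
  by apply: eq_bigr => p _; rewrite s_addl tDl.
pose TL : lmodType R' := scaled (Scaling scaleA scale1 scaleDr scaleDl).
have [F [FB FE]] := tensor_pairing tT tT gamma_l gamma_r.
by exists TL, t, F; split=> // r m n; rewrite -scale_mk.
Qed.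
End TensorSpace.

(** A spanning family with the least number of elements is a basis. *)
Lemma finite_coordinates (K : fieldType) (V : lmodType K) (I : finType)
    (g : I -> V) :
  (forall u, exists c : I -> K, u = \sum_i c i *: g i) ->
  exists n (f : {linear 'rV[K]_n -> V}), bijective f.
Proof.
move=> gs.
pose Q n := `[< exists g : 'I_n -> V,
  forall u, exists c : 'I_n -> K, u = \sum_i c i *: g i >].
have exQ : exists n, Q n.
  exists #|I|; apply/asboolP; exists (g \o enum_val) => u.
  have [c ->] := gs u; exists (c \o enum_val).
  by rewrite (reindex _ (onW_bij _ (@enum_val_bij I))).
case: (ex_minnP exQ) => n /asboolP[{gs}h hs] nmin.
pose f (c : 'rV[K]_n) := \sum_i c ord0 i *: h i.
have fL : linear f.
  move=> k x y; rewrite /f scaler_sumr -big_split /=; apply: eq_bigr => i _.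
  by rewrite !mxE scalerDl scalerA.
have f0 c : f c = 0 -> c = 0.
  move=> fc; apply/rowP => k; rewrite mxE; apply/eqP/negPn/negP => ck.
  case: n h hs nmin @f fL c fc k ck => [|n] h hs nmin f fL c fc k ck;
    first by case: k ck.
  suff /nmin : Q n by rewrite ltnn.
  apply/asboolP; exists (fun i => h (lift k i)) => u; have [d ->] := hs u.
  exists (fun i => d (lift k i) - d k / c ord0 k * c ord0 (lift k i)).
  have hk : h k = - (c ord0 k)^-1 *: \sum_i c ord0 (lift k i) *: h (lift k i).
    apply: (scalerI ck); rewrite scalerA mulrN divff // scaleN1r.
    apply/eqP; rewrite -subr_eq0 opprK; apply/eqP.
    by rewrite -[RHS]fc /f [RHS](bigD1_ord k).
  rewrite (bigD1_ord k) //= hk scalerA scaler_sumr -big_split /=.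
  apply: eq_bigr => i _; rewrite scalerA -scalerDl addrC mulrN mulNr.
  by rewrite mulrAC.
pose cf u : 'rV[K]_n := \row_i sval (cid (hs u)) i.
have cfK u : f (cf u) = u.
  by rewrite [RHS](svalP (cid (hs u))); apply: eq_bigr => i _; rewrite mxE.
exists n, (lin_of fL), cf => [c|u]; last exact: cfK.
apply/eqP; rewrite -subr_eq0; apply/eqP/f0.
by rewrite -[f _]/(lin_of fL _) linearB /= cfK subrr.
Qed.

(** * Dual frames of nondegenerate forms *)

Lemma gen_ind (S : Type) (P : zmodType) (p : S -> P) (Q : P -> Prop) :
  gen_by p -> Q 0 -> (forall x y, Q x -> Q y -> Q (x + y)) ->
  (forall s, Q (p s)) -> forall x, Q x.
Proof.
by move=> gp Q0 QD Qp x; have [l ->] := gp x; elim/big_ind: _.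
Qed.

Section BilinearForms.
Variable K : fieldType.
Hypothesis char2 : 2%N \notin [pchar K].

Lemma two_neq0 : 2%:R != 0 :> K.
Proof. by move: char2; rewrite inE. Qed.

Section OneSpace.
Variables (e : bool) (V : bilSpace K e).
Implicit Types u v : V.

Lemma bsB : biadditive (@bs_form K e V).
Proof.
split=> [x y u|u x y].
  by have := (bs_bilinear V).1 u 1 x y; rewrite scale1r /= mul1r.
by have := (bs_bilinear V).2 u 1 x y; rewrite scale1r /= mul1r.
Qed.

Lemma bsZl k u v : bs_form (k *: u) v = k * bs_form u v.
Proof. by have := (bs_bilinear V).1 v k u 0; rewrite /= addr0 bs_0l addr0. Qed.

Lemma bsZr k u v : bs_form u (k *: v) = k * bs_form u v.
Proof. by have := (bs_bilinear V).2 u k v 0; rewrite /= addr0 bs_0r addr0. Qed.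

End OneSpace.

Lemma bs_skew e (V : bilSpace K e) (u v : V) :
  bs_form v u = (-1) ^+ e * bs_form u v.
Proof.
case: e V u v => V u v; last by rewrite mul1r (bs_sym V).
have alt := bs_sym V : forall u, bs_form u u = 0.
have := alt (u + v); rewrite (biaddl (bsB V)) !(biaddr (bsB V)) !alt.
rewrite add0r addr0 addrC => /eqP; rewrite addr_eq0 => /eqP->.
by rewrite expr1 mulN1r.
Qed.

(** If G is the Gram matrix of g and G' satisfies G G' G = G, then
    w_j = sum_i G'_ij g_i works: both sides pair equally with every g_k. *)
Lemma dual_frame (V : lmodType K) (f : V -> V -> K) n (g : 'I_n -> V) :
  bilinear_for *%R *%R f -> (forall u, (forall v, f v u = 0) -> u = 0) ->
  (forall u, exists c : 'I_n -> K, u = \sum_i c i *: g i) ->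
  exists w : 'I_n -> V, forall u, u = \sum_i f (g i) u *: w i.
Proof.
move=> [fl fr] fn gs.
have fB : biadditive f.
  by split=> [x y u|u x y]; [have := fl u 1 x y | have := fr u 1 x y];
     rewrite scale1r /= mul1r.
have fZl k x y : f (k *: x) y = k * f x y.
  by have := fl y k x 0; rewrite /= addr0 (biadd0l fB) addr0.
have fZr k x y : f x (k *: y) = k * f x y.
  by have := fr x k y 0; rewrite /= addr0 (biadd0r fB) addr0.
pose G := \matrix_(i, j) f (g i) (g j).
pose w j := \sum_i pinvmx G i j *: g i.
exists w => u; apply/eqP; rewrite -subr_eq0; apply/eqP/fn => v.
have [c ->] := gs v; rewrite (biadd_suml fB) big1 // => k _.
rewrite fZl (biaddr fB) (biaddNr fB); have [{v}d uE] := gs u.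
suff -> : f (g k) (\sum_i f (g i) u *: w i) = f (g k) u by rewrite subrr mulr0.
pose D := \col_i d i; have GD i : f (g i) u = (G *m D) i ord0.
  rewrite uE (biadd_sumr fB) mxE; apply: eq_bigr => j _.
  by rewrite fZr !mxE mulrC.
transitivity ((G *m pinvmx G *m (G *m D)) k ord0); last first.
  by rewrite GD mulmxA mulmxKpV.
rewrite (biadd_sumr fB) mxE; apply: eq_bigr => j _; rewrite fZr GD mulrC.
congr (_ * _); rewrite /w (biadd_sumr fB) mxE; apply: eq_bigr => i _.
by rewrite fZr !mxE mulrC.
Qed.

Lemma bil_frame e (V : bilSpace K e) : exists n (g w : 'I_n -> V),
  forall u, u = \sum_i bs_form (g i) u *: w i.
Proof.
exists (\dim {:V}), (fun i => (vbasis {:V})`_i).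
apply: dual_frame => [|u u0|u]; first exact: bs_bilinear.
  by apply: bs_nondegenerate => v; rewrite bs_skew u0 mulr0.
exists (fun i => coord (vbasis {:V}) i u).
exact/coord_vbasis/memvf.
Qed.

(** The vector space structure of a [bilSpace] is supplied by coordinates.
    In characteristic different from 2 a skew form is alternating. *)
Lemma realize_bilSpace (e : bool) (T : lmodType K) (F : T -> T -> K)
    (I : finType) (g : I -> T) :
  biadditive F -> (forall k x y, F (k *: x) y = k * F x y) ->
  (forall x y, F y x = (-1) ^+ e * F x y) ->
  (forall x, (forall y, F x y = 0) -> x = 0) ->
  (forall x, exists c : I -> K, x = \sum_i c i *: g i) ->
  exists (P : bilSpace K e) (h : {linear T -> P}), bijective h /\
    forall x y, bs_form (h x) (h y) = F x y.
Proof.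
move=> FB FZ Fs Fn gs.
have [n [f [f' fK f'K]]] := finite_coordinates gs.
pose B (x y : 'rV[K]_n) := F (f x) (f y).
have FZr k x y : F x (k *: y) = k * F x y by rewrite Fs FZ mulrCA -Fs.
have Bb : bilinear_for *%R *%R B.
  by split=> u k x y; rewrite /B linearP ?(biaddl FB) ?(biaddr FB) ?FZ ?FZr.
have Bs : if e then forall u, B u u = 0 else forall u v, B u v = B v u.
  case: e Fs => [Fs u|Fs u v]; last by rewrite /B Fs mul1r.
  apply/eqP; rewrite -(mulrI_eq0 _ (mulfI two_neq0)) mulr_natl mulr2n.
  by rewrite {1}/B Fs expr1 mulN1r addNr.
have Bn u : (forall v, B u v = 0) -> u = 0.
  move=> u0; apply: (can_inj fK); rewrite linear0; apply: Fn => y.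
  by rewrite -[y]f'K; apply: u0.
have f'L : linear f' by move=> k x y; apply: (can_inj fK); rewrite linearP !f'K.
exists (BilSpace Bb Bs Bn), (lin_of f'L); split; first by exists f.
by move=> x y; rewrite /= /B !f'K.
Qed.

End BilinearForms.

Section RightActions.
Variables (K : fieldType) (A : falgType K) (U : lmodType A^c).
Implicit Types (u v : U) (a b : A).

Lemma ractM u a b : ract (ract u a) b = ract u (a * b).
Proof. by rewrite /ract scalerA. Qed.

Lemma ract1 u : ract u 1 = u.
Proof. exact: scale1r. Qed.

Lemma ractB : @biadditive U A U (@ract K A U).
Proof. by split=> [x y u|u x y]; rewrite /ract ?scalerDr ?scalerDl. Qed.

Lemma resK_scaling : @scaling K U (fun k u => ract u k%:A).
Proof.
split=> [k l v|v|k x y|v k l].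
- by rewrite ractM mulr_algl scalerA mulrC.
- by rewrite scale1r ract1.
- by rewrite (biaddl ractB).
- by rewrite scalerDl (biaddr ractB).
Qed.

End RightActions.

Section HermitianForms.
Variables (K : fieldType) (A : falgType K) (sigma : {linear A -> A}).
Hypothesis char2 : 2%N \notin [pchar K].
Hypothesis csA : central_simple A.
Hypothesis invol : involution_first_kind sigma.

Local Notation N := (\dim {:A}).
Local Notation b i := ((vbasis {:A})`_i).
Local Notation TrD := (TrdD char2 csA invol).
Local Notation TrZ := (TrdZ char2 csA invol).
Local Notation TrC := (TrdC char2 csA invol).
Local Notation sigM := (sigmaM invol).
Local Notation sigK := (sigmaK invol).

Lemma Trd_nondegenerate (c : A) : (forall a, Trd (a * c) = 0) -> c = 0.
Proof.
have [x [_ _ G3 _]] := goldman char2 csA invol.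
by move=> c0; rewrite -[c]G3 big1 // => i _; rewrite c0 scale0r.
Qed.

Lemma Trd_onto : exists a : A, Trd a = 1.
Proof.
have [a a0] : exists a : A, Trd a != 0.
  apply: contrapT => no; have /eqP : (1 : A) = 0; last by rewrite oner_eq0.
  apply: Trd_nondegenerate => a; apply/eqP/negPn/negP => a0.
  by apply: no; exists (a * 1).
by exists ((Trd a)^-1 *: a); rewrite TrZ mulVf.
Qed.

Section OneModule.
Variables (e : bool) (U : hermMod sigma e).
Implicit Types u v : U.

Lemma hmB : biadditive (@hm_form K A sigma e U).
Proof. by split=> *; rewrite ?hm_addl ?hm_addr. Qed.

Lemma hm_ractl u v a : hm_form (ract u a) v = sigma a * hm_form u v.
Proof. by rewrite -{1}[v]ract1 hm_sesqui mulr1. Qed.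

Lemma hm_ractr u v a : hm_form u (ract v a) = hm_form u v * a.
Proof. by rewrite -{1}[u]ract1 hm_sesqui (sigma1 invol) mul1r. Qed.

Lemma hm_scalel k u v : hm_form (ract u k%:A) v = k *: hm_form u v.
Proof. by rewrite hm_ractl (sigmaZ invol) mulr_algl. Qed.

Lemma hm_scaler k u v : hm_form u (ract v k%:A) = k *: hm_form u v.
Proof. by rewrite hm_ractr mulr_algr. Qed.

Lemma hm_nondegenerate_Trd u : (forall v, Trd (hm_form u v) = 0) -> u = 0.
Proof.
move=> u0; apply: hm_nondegenerate => v; apply: Trd_nondegenerate => a.
by rewrite TrC -hm_ractr u0.
Qed.

Lemma hm_span : exists (I : finType) (g : I -> U),
  forall u, exists c : I -> K, u = \sum_i ract (g i) (c i)%:A.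
Proof.
have [n [g gs]] := hm_fg U.
exists ('I_n * 'I_N)%type, (fun p : 'I_n * 'I_N => ract (g p.1) (b p.2)) => u.
have [c ->] := gs u.
exists (fun p : 'I_n * 'I_N => coord (vbasis {:A}) p.2 (c p.1)).
rewrite sum_pair.
apply: eq_bigr => i _; rewrite {1}[c i]coordK (biadd_sumr (ractB U)).
by apply: eq_bigr => j _; rewrite ractM mulr_algr.
Qed.

(** Let theta have reduced trace 1, and let (g, w) be a frame of the K-form
    Trd o h. Then u = sum_i u x_i theta b_i, as this is u times Trd theta;
    expanding u x_i in the frame gives
    sum_j w_j theta (sum_i Trd (h(g_j, u) x_i) b_i), and the inner sum is
    h(g_j, u). *)
Lemma herm_frame : exists n (g w : 'I_n -> U),
  forall u, u = \sum_i ract (w i) (hm_form (g i) u).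
Proof.
pose V : lmodType K := scaled (resK_scaling U).
pose f (x y : V) : K := Trd (@hm_form _ _ _ _ U x y).
have [I [g0 gs0]] := hm_span.
pose g : 'I_#|I| -> V := g0 \o enum_val.
have [||u|w wP] := @dual_frame K V f _ g.
- split=> u k x y; rewrite /f ?hm_addl ?hm_addr TrD.
    by rewrite hm_scalel TrZ.
  by rewrite hm_scaler TrZ.
- move=> u u0; apply: hm_nondegenerate_Trd => v; rewrite hm_sym.
  rewrite -signr_odd mulr_sign; case: ifP => _;
    last by rewrite (Trd_sigma char2 csA invol) [LHS]u0.
  by rewrite -scaleN1r TrZ (Trd_sigma char2 csA invol) [X in _ * X]u0 mulr0.
- have [c ->] := gs0 u; exists (c \o enum_val).
  by rewrite (reindex _ (onW_bij _ (@enum_val_bij I))).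
have [theta th1] := Trd_onto; have [x [G1 _ _ G4]] := goldman char2 csA invol.
exists #|I|, g, (fun i => ract (w i : U) theta) => u.
transitivity (\sum_i ract (ract (ract u (x i)) theta) (b i)).
  rewrite -{1}[u]ract1 -[1]scale1r -th1 -G1 (biadd_sumr (ractB U)).
  by apply: eq_bigr => i _; rewrite !ractM mulrA.
transitivity (\sum_i \sum_j
    ract (ract (ract (w j : U) (f (g j) (ract u (x i)))%:A) theta) (b i)).
  apply: eq_bigr => i _; rewrite {1}[ract u (x i)]wP.
  by rewrite !(biadd_suml (ractB U)).
rewrite exchange_big; apply: eq_bigr => j _ /=.
rewrite -[X in ract _ X]G4 (biadd_sumr (ractB U)); apply: eq_bigr => i _.
rewrite !ractM; congr (ract _ _); rewrite /f hm_ractr TrC.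
by rewrite mulr_algl scalerAr.
Qed.

End OneModule.
End HermitianForms.

(** * Existence of the products of spaces *)

Lemma span_gen (R : pzRingType) (T : lmodType R) (S : Type) (p : S -> T)
    (I : finType) (g : I -> T) :
  gen_by p -> (forall s, exists c : I -> R, p s = \sum_i c i *: g i) ->
  forall x, exists c : I -> R, x = \sum_i c i *: g i.
Proof.
move=> gp pg; apply: (gen_ind gp) => [|x y [c ->] [d ->]|//].
  by exists (fun=> 0); rewrite big1 // => i _; rewrite scale0r.
exists (fun i => c i + d i); rewrite -big_split.
by apply: eq_bigr => i _; rewrite scalerDl.
Qed.

Lemma gen_ext2 (S S' : Type) (P P' Y : zmodType) (p : S -> P) (p' : S' -> P')
    (F G : P -> P' -> Y) :
  gen_by p -> gen_by p' -> biadditive F -> biadditive G ->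
  (forall s s', F (p s) (p' s') = G (p s) (p' s')) -> forall x y, F x y = G x y.
Proof.
move=> gp gp' FB GB FG x y; have [l ->] := gp x; have [l' ->] := gp' y.
rewrite (biadd_suml FB) (biadd_suml GB); apply: eq_bigr => s _.
by rewrite (biadd_sumr FB) (biadd_sumr GB); apply: eq_bigr => s' _.
Qed.

Lemma sign_scale (K : fieldType) (A : falgType K) (e : bool) (x : A) :
  (-1) ^+ e * x = (-1) ^+ e *: x.
Proof. by rewrite mulr_sign scaler_sign. Qed.

Section Existence.
Variables (K : fieldType) (A : falgType K) (sigma : {linear A -> A}).
Hypothesis char2 : 2%N \notin [pchar K].
Hypothesis csA : central_simple A.
Hypothesis invol : involution_first_kind sigma.
Local Notation TrD := (TrdD char2 csA invol).
Local Notation TrZ := (TrdZ char2 csA invol).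
Local Notation TrC := (TrdC char2 csA invol).
Local Notation sigM := (sigmaM invol).
Local Notation sigK := (sigmaK invol).

(** The form is nondegenerate for the same reason as in the other products: if
    sum_p v_p (x) w_p is orthogonal to everything, expand each w_p in a frame
    (g, w) of the second factor. The coefficient of w_i is a combination of
    the v_p which pairs to 0 with every vector of the first factor. *)
Lemma prodKK_exists e e' (V : bilSpace K e) (W : bilSpace K e') :
  exists P, prodKK V W P.
Proof.
have VB := bsB V; have WB := bsB W.
pose gamma (v : V) (w : W) v' w' : K := bs_form v v' * bs_form w w'.
have [||||||| T [t [F [tT tZ FB Fg]]]] :=
  @tensor_space K V W (@kr K V) (@kl K W) K (fun k v => k *: v)
    _ _ _ _ _ K gamma.
- exact: scalerDr.
- by move=> r r' m; rewrite scalerDl.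
- exact: scale1r.
- by move=> *; rewrite scalerA.
- by move=> *; rewrite /kr !scalerA mulrC.
- move=> v' w'; split=> [x y w|v x y|v k w]; rewrite /gamma.
  + by rewrite (biaddl VB) mulrDl.
  + by rewrite (biaddl WB) mulrDr.
  + by rewrite /kr /kl !bsZl mulrCA mulrA.
- move=> v w; split=> [x y w'|v' x y|v' k w']; rewrite /gamma.
  + by rewrite (biaddr VB) mulrDl.
  + by rewrite (biaddr WB) mulrDr.
  + by rewrite /kr /kl !bsZr mulrCA mulrA.
have tg := tensor_gen tT; have tB := tensor_biadditive tT.
have [tDl tDr tr] := tensor_balanced tT.
have FZ k x y : F (k *: x) y = k * F x y.
  apply: (gen_ext2 (F := fun x y => F (k *: x) y)
    (G := fun x y => k * F x y) tg tg).
  - by split=> *; rewrite ?scalerDr ?(biaddl FB) ?(biaddr FB).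
  - by split=> *; rewrite ?(biaddl FB) ?(biaddr FB) mulrDr.
  - by move=> [v w] [v' w'] /=; rewrite -tZ !Fg /gamma bsZl mulrA.
have Fs x y : F y x = (-1) ^+ (e (+) e')%B * F x y.
  apply: (gen_ext2 (F := fun x y => F y x) (G := fun x y => _ * F x y) tg tg).
  - by split=> *; rewrite ?(biaddl FB) ?(biaddr FB).
  - by split=> *; rewrite ?(biaddl FB) ?(biaddr FB) mulrDr.
  - move=> [v w] [v' w'] /=; rewrite !Fg /gamma.
    by rewrite signr_addb (bs_skew v) (bs_skew w) mulrACA.
have Fn x : (forall y, F x y = 0) -> x = 0.
  have [l ->] := tg x => x0; have [n [g [w wP]]] := bil_frame W.
  transitivity (\sum_(p <- l) \sum_i t (bs_form (g i) p.2 *: p.1) (w i)).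
    apply: eq_bigr => p _; rewrite {1}[p.2]wP (biadd_sumr tB).
    apply: eq_bigr => i _.
    by rewrite -[_ *: p.1]/(kr _ _) tr.
  rewrite exchange_big big1 //= => i _; rewrite -(biadd_suml tB).
  suff -> : \sum_(p <- l) bs_form (g i) p.2 *: p.1 = 0 by rewrite (biadd0l tB).
  apply: bs_nondegenerate => v; rewrite (biadd_suml VB).
  transitivity ((-1) ^+ e' * F (\sum_(p <- l) t p.1 p.2) (t v (g i))).
    rewrite (biadd_suml FB) mulr_sumr; apply: eq_bigr => p _.
    rewrite Fg bsZl /gamma (bs_skew (g i)) mulrCA (mulrA (_ ^+ _)) -expr2.
    by rewrite sqrr_sign mul1r mulrC.
  by rewrite x0 mulr0.
pose g (p : 'I_(\dim {:V}) * 'I_(\dim {:W})) : T :=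
  t (vbasis {:V})`_p.1 (vbasis {:W})`_p.2.
have gs : forall x, exists c, x = \sum_p c p *: g p.
  apply: (span_gen tg) => -[v w] /=.
  exists (fun p => coord (vbasis {:V}) p.1 v * coord (vbasis {:W}) p.2 w).
  rewrite {1}(coord_vbasis (memvf v)) {1}(coord_vbasis (memvf w)).
  rewrite (biadd_suml tB) sum_pair.
  apply: eq_bigr => i _; rewrite (biadd_sumr tB); apply: eq_bigr => j _.
  by rewrite -[_ *: _`_j]/(kl _ _) -tr /kr scalerA tZ mulrC.
have [P [h [hb hF]]] := realize_bilSpace char2 FB FZ Fs Fn gs.
exists P, (fun v w => h (t v w)); split=> [|k v w|v w v' w'].
- exact: is_tensor_bij.
- by rewrite tZ linearZ.
- by rewrite hF Fg.
Qed.

Lemma prodAK_exists e e' (U : hermMod sigma e) (V : bilSpace K e') :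
  exists P, prodAK U V P.
Proof.
have UB := hmB U; have VB := bsB V; have RB := ractB U.
pose gamma (u : U) (v : V) u' v' : A := bs_form v v' *: hm_form u u'.
have [||||||| T [t [F [tT tZ FB Fg]]]] :=
  @tensor_space K U V (@akr K A U) (@kl K V) A^c (fun a u => a *: u)
    _ _ _ _ _ A gamma.
- exact: scalerDr.
- by move=> r r' m; rewrite scalerDl.
- exact: scale1r.
- by move=> *; rewrite scalerA.
- move=> a u k; rewrite /akr -![_ *: u]/(ract u _) -[LHS]/(ract _ a).
  by rewrite !ractM mulr_algl mulr_algr.
- move=> u' v'; split=> [x y w|v x y|u k w]; rewrite /gamma.
  + by rewrite (biaddl UB) scalerDr.
  + by rewrite (biaddl VB) scalerDl.
  + by rewrite /akr /kl bsZl (hm_scalel invol) scalerA mulrC.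
- move=> u v; split=> [x y w'|v' x y|u' k w']; rewrite /gamma.
  + by rewrite (biaddr UB) scalerDr.
  + by rewrite (biaddr VB) scalerDl.
  + by rewrite /akr /kl bsZr (hm_scaler invol) scalerA mulrC.
have tg := tensor_gen tT; have tB := tensor_biadditive tT.
have [tDl tDr tr] := tensor_balanced tT.
have tR u v a : t (ract u a) v = ract (t u v) a by apply: tZ.
have Fsesq a b x y : F (ract x a) (ract y b) = sigma a * F x y * b.
  apply: (gen_ext2 (F := fun x y => F (ract x a) (ract y b))
    (G := fun x y => sigma a * F x y * b) tg tg).
  - by split=> *; rewrite (biaddl (ractB T)) ?(biaddl FB) ?(biaddr FB).
  - by split=> *; rewrite ?(biaddl FB) ?(biaddr FB) mulrDr mulrDl.
  - move=> [u v] [u' v'] /=.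
    by rewrite -!tR !Fg /gamma hm_sesqui -scalerAr -scalerAl.
have Fs x y : F y x = (-1) ^+ (e (+) e')%B * sigma (F x y).
  apply: (gen_ext2 (F := fun x y => F y x)
    (G := fun x y => _ * sigma (F x y)) tg tg).
  - by split=> *; rewrite ?(biaddl FB) ?(biaddr FB).
  - by split=> *; rewrite ?(biaddl FB) ?(biaddr FB) linearD mulrDr.
  - move=> [u v] [u' v'] /=.
    rewrite !Fg /gamma (bs_skew v) (hm_sym u) linearZ /=.
    by rewrite !sign_scale !scalerA signr_addb mulrAC [_ * (-1) ^+ e]mulrC.
have Fn x : (forall y, F x y = 0) -> x = 0.
  have [l ->] := tg x => x0; have [n [g [w wP]]] := bil_frame V.
  transitivity (\sum_(p <- l) \sum_i t (ract p.1 (bs_form (g i) p.2)%:A) (w i)).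
    apply: eq_bigr => p _; rewrite {1}[p.2]wP (biadd_sumr tB).
    apply: eq_bigr => i _.
    by rewrite -[ract _ _]/(akr _ _) tr.
  rewrite exchange_big big1 //= => i _; rewrite -(biadd_suml tB).
  suff -> : \sum_(p <- l) ract p.1 (bs_form (g i) p.2)%:A = 0.
    by rewrite (biadd0l tB).
  apply: hm_nondegenerate => v; rewrite (biadd_suml UB).
  transitivity ((-1) ^+ e' *: F (\sum_(p <- l) t p.1 p.2) (t v (g i))).
    rewrite (biadd_suml FB) scaler_sumr; apply: eq_bigr => p _.
    rewrite Fg (hm_scalel invol) /gamma (bs_skew (g i)) !scalerA mulrA -expr2.
    by rewrite sqrr_sign mul1r.
  by rewrite x0 scaler0.
have Tfg : exists n (g : 'I_n -> T),
    forall u, exists c : {ffun 'I_n -> A}, u = \sum_i ract (g i) (c i).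
  have [n [g gs]] := hm_fg U.
  pose I := ('I_n * 'I_(\dim {:V}))%type.
  pose h (p : I) : T := t (g p.1) (vbasis {:V})`_p.2.
  have hs : forall x, exists c : I -> A^c, x = \sum_p c p *: h p.
    apply: (span_gen tg) => -[u v] /=; have [c ->] := gs u.
    exists (fun p => coord (vbasis {:V}) p.2 v *: c p.1 : A).
    rewrite (biadd_suml tB) sum_pair.
    apply: eq_bigr => i _; rewrite {1}(coord_vbasis (memvf v)) (biadd_sumr tB).
    apply: eq_bigr => j _; rewrite -[_ *: _`_j]/(kl _ _) -tr /akr ractM.
    by rewrite mulr_algr tR.
  exists #|{: I}|, (h \o enum_val) => u; have [c ->] := hs u.
  exists [ffun i => c (enum_val i)].
  rewrite (reindex _ (onW_bij _ (@enum_val_bij I))); apply: eq_bigr => i _.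
  by rewrite ffunE.
by exists (HermMod Tfg (biaddl FB) (biaddr FB) Fsesq Fs Fn), t.
Qed.

(** The product with the factors exchanged. *)
Lemma prodKA_exists e e' (V : bilSpace K e) (U : hermMod sigma e') :
  exists P, prodKA V U P.
Proof.
have cast d : e' (+) e = d -> exists (P : hermMod sigma d) (t : U -> V -> P),
    [/\ is_tensor (@akr K A U) (@kl K V) t,
        forall u v a, t (ract u a) v = ract (t u v) a
      & forall u v u' v',
        hm_form (t u v) (t u' v') = bs_form v v' *: hm_form u u'].
  by move=> <-; apply: prodAK_exists.
have [P [t [tT tR tF]]] := cast _ (addbC e' e).
exists P, (fun v u => t u v); split=> [|v u a|v u v' u'].
- exact: is_tensor_swap tT.
- exact: tR.
- exact: tF.
Qed.

(** The space is constructed as the tensor product over A of U and of V, where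
    A acts on the left of V through sigma. The associated double tensor
    product is then compared with it through t (u (x) v) a = u a (x) v. *)
Lemma prodAA_exists e e' (U : hermMod sigma e) (V : hermMod sigma e') :
  exists P, prodAA U V P.
Proof.
have UB := hmB U; have VB := hmB V; have RU := ractB U; have RV := ractB V.
pose la (a : A) (v : V) := ract v (sigma a).
pose gamma (u : U) (v : V) u' v' : K :=
  Trd (hm_form u u' * sigma (hm_form v v')).
have [||||||| T [t [F [tT tZ FB Fg]]]] :=
  @tensor_space A U V (@ract K A U) la K (fun k u => ract u k%:A)
    _ _ _ _ _ K gamma.
- by move=> *; rewrite (biaddl RU).
- by move=> *; rewrite scalerDl (biaddr RU).
- by move=> m; rewrite scale1r ract1.
- by move=> *; rewrite ractM mulr_algl scalerA mulrC.
- by move=> *; rewrite !ractM mulr_algl mulr_algr.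
- move=> u' v'; split=> [x y w|v x y|u a v]; rewrite /gamma.
  + by rewrite (biaddl UB) mulrDl TrD.
  + by rewrite (biaddl VB) linearD mulrDr TrD.
  + by rewrite hm_ractl /la hm_ractl sigK sigM -mulrA TrC mulrA.
- move=> u v; split=> [x y w'|v' x y|u' a v']; rewrite /gamma.
  + by rewrite (biaddr UB) mulrDl TrD.
  + by rewrite (biaddr VB) linearD mulrDr TrD.
  + by rewrite (hm_ractr invol) /la (hm_ractr invol) sigM sigK mulrA.
have tg := tensor_gen tT; have tB := tensor_biadditive tT.
have [tDl tDr tr] := tensor_balanced tT.
have FZ k x y : F (k *: x) y = k * F x y.
  apply: (gen_ext2 (F := fun x y => F (k *: x) y)
    (G := fun x y => k * F x y) tg tg).
  - by split=> *; rewrite ?scalerDr ?(biaddl FB) ?(biaddr FB).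
  - by split=> *; rewrite ?(biaddl FB) ?(biaddr FB) mulrDr.
  - move=> [u v] [u' v'] /=.
    by rewrite -tZ !Fg /gamma (hm_scalel invol) -scalerAl TrZ.
have Fs x y : F y x = (-1) ^+ (e (+) e')%B * F x y.
  apply: (gen_ext2 (F := fun x y => F y x) (G := fun x y => _ * F x y) tg tg).
  - by split=> *; rewrite ?(biaddl FB) ?(biaddr FB).
  - by split=> *; rewrite ?(biaddl FB) ?(biaddr FB) mulrDr.
  - move=> [u v] [u' v'] /=.
    rewrite !Fg /gamma (hm_sym u) (hm_sym v) !sign_scale.
    rewrite linearZ /= sigK -scalerAl -scalerAr !TrZ mulrA signr_addb.
    by rewrite -[in LHS](Trd_sigma char2 csA invol) sigM sigK TrC.
have Fn x : (forall y, F x y = 0) -> x = 0.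
  have [l ->] := tg x => x0.
  have [n [g [w wP]]] := herm_frame char2 csA invol V.
  transitivity (\sum_(p <- l) \sum_i
      t (ract p.1 (sigma (hm_form (g i) p.2))) (w i)).
    apply: eq_bigr => p _; rewrite {1}[p.2]wP (biadd_sumr tB).
    apply: eq_bigr => i _.
    by rewrite tr /la sigK.
  rewrite exchange_big big1 //= => i _; rewrite -(biadd_suml tB).
  suff -> : \sum_(p <- l) ract p.1 (sigma (hm_form (g i) p.2)) = 0.
    by rewrite (biadd0l tB).
  apply: hm_nondegenerate => v; rewrite (biadd_suml UB).
  apply: (Trd_nondegenerate char2 csA invol) => a.
  rewrite mulr_sumr (Trd_sum char2 csA invol).
  transitivity ((-1) ^+ e' * F (\sum_(p <- l) t p.1 p.2) (t (ract v a) (g i))).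
    rewrite (biadd_suml FB) mulr_sumr; apply: eq_bigr => p _.
    rewrite Fg hm_ractl sigK /gamma (hm_ractr invol) (hm_sym (g i)) sign_scale.
    rewrite linearZ /= sigK -scalerAr TrZ (mulrA (_ ^+ _)) -expr2 sqrr_sign.
    by rewrite mul1r [LHS]TrC -mulrA [LHS]TrC.
  by rewrite x0 mulr0.
have [I [g gs]] := hm_span U; have [J [h hs]] := hm_span V.
have Ts : forall x, exists c, x = \sum_(p : I * J) c p *: t (g p.1) (h p.2).
  apply: (span_gen tg) => -[u v] /=.
  have [c {1}->] := gs u; have [d {1}->] := hs v.
  exists (fun p => c p.1 * d p.2).
  rewrite (biadd_suml tB) sum_pair; apply: eq_bigr => i _.
  rewrite (biadd_sumr tB); apply: eq_bigr => j _.
  rewrite -[(d j)%:A](sigmaZ invol) -[ract (h j) _]/(la _ _) -tr ractM.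
  by rewrite mulr_algl scalerA mulrC -tZ.
have [P [f [fb fF]]] := realize_bilSpace char2 FB FZ Fs Fn Ts.
exists P.
have [E [tE [tET _]]] := tens_exists (@kr K A) (@kl K A).
have [W [tW [tWT _]]] := tens_exists (@akr K A U) (@akl K A V).
have tEB := tensor_biadditive tET; have tWB := tensor_biadditive tWT.
have [_ _ tEr] := tensor_balanced tET; have [_ _ tWr] := tensor_balanced tWT.
have ZC (X : lmodType A^c) (x : X) k a :
    ract (ract x k%:A) a = ract (ract x a) k%:A.
  by rewrite !ractM mulr_algl mulr_algr.
have RZ (X : lmodType A^c) (x : X) k a : ract x (k *: a) = ract (ract x a) k%:A.
  by rewrite ractM mulr_algr.
have [||rho [rhoB rhoE]] := tensor_pairing
  (mu := fun u v a c => tW (ract u a) (ract v c)) tWT tET.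
- move=> a c; split=> [u u' v|u v v'|u k v].
  + by rewrite (biaddl RU) (biaddl tWB).
  + by rewrite (biaddl RV) (biaddr tWB).
  + by rewrite /akr /akl !ZC; apply: tWr.
- move=> u v; split=> [a a' c|a c c'|a k c].
  + by rewrite (biaddr RU) (biaddl tWB).
  + by rewrite (biaddr RV) (biaddr tWB).
  + by rewrite /kr /kl (RZ _ u) (RZ _ v); apply: tWr.
have [||lam [lamB lamE]] := tensor_lift_param
  (mu := fun a c x => a * x * sigma c) tET.
- move=> x; split=> [a a' c|a c c'|a k c].
  + by rewrite !mulrDl.
  + by rewrite linearD mulrDr.
  + by rewrite /kr /kl linearZ /= -scalerAr -!scalerAl.
- by move=> a c x x'; rewrite mulrDr mulrDl.
pose s u v := f (t u v).
have sT : is_tensor (@ract K A U) la s by apply: is_tensor_bij.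
have sB := tensor_biadditive sT; have [_ _ sr] := tensor_balanced sT.
have [||tt [ttB ttE]] := tensor_lift_param
  (mu := fun u v a => s (ract u a) v) tWT.
- move=> a; split=> [u u' v|u v v'|u k v].
  + by rewrite (biaddl RU) (biaddl sB).
  + by rewrite (biaddr sB).
  + by rewrite /akr /akl ZC sr /la (sigmaZ invol).
- by move=> u v a a'; rewrite (biaddr RU) (biaddl sB).
have sg := tensor_gen sT; have Wg := tensor_gen tWT; have Eg := tensor_gen tET.
have ttb : balanced rho lam tt.
  split=> [y y' a|y a a'|y x a]; rewrite ?(biaddl ttB) ?(biaddr ttB) //.
  apply: (gen_ext2 (F := fun y x => tt (rho y x) a)
    (G := fun y x => tt y (lam x a)) Wg Eg).
  - by split=> *; rewrite ?(biaddl rhoB) ?(biaddr rhoB) (biaddl ttB).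
  - by split=> *; rewrite ?(biaddl lamB) ?(biaddl ttB) ?(biaddr ttB).
  - move=> [u v] [c d] /=; rewrite rhoE !ttE lamE.
    by rewrite ractM -[in RHS]ractM [RHS]sr /la sigK.
exists E, tE, W, tW, rho, lam, tt; split=> [||||u v a u' v' a'].
- by [].
- by split; [case: rhoB | split; [case: rhoB | ]].
- by split; [case: lamB | split; [case: lamB | ]].
- split.
    apply: is_tensorI => // [y|X q l qb].
      have [k ->] := sg y; exists [seq (tW p.1 p.2, 1) | p <- k].
      by rewrite big_map; apply: eq_bigr => p _; rewrite ttE ract1.
    have qB := balanced_biadditive qb; have [_ _ qr] := qb.
    have tW1 u a v : q (tW (ract u a) v) 1 = q (tW u v) a.
      have := qr (tW u v) (tE a 1) 1.
      by rewrite rhoE lamE ract1 sigma1 // !mulr1.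
    have [|r rE] := tensor_lift sT (f := fun u v => q (tW u v) 1).
      split=> [u u' v|u v v'|u a v].
      + by rewrite (biaddl tWB) (biaddl qB).
      + by rewrite (biaddr tWB) (biaddl qB).
      have := qr (tW u v) (tE 1 (sigma a)) 1.
      by rewrite rhoE lamE ract1 sigK !mul1r tW1 => <-.
    have hq y a : r (tt y a) = q y a.
      have [k ->] := Wg y; rewrite (biadd_suml ttB) (biadd_suml qB) raddf_sum.
      by apply: eq_bigr => p _; rewrite ttE rE tW1.
    move=> l0; transitivity (r (\sum_(p <- l) tt p.1 p.2));
      last by rewrite l0 raddf0.
    by rewrite raddf_sum; apply: eq_bigr => p _; rewrite hq.
  move=> k y a; have [l ->] := Wg y; rewrite !(biadd_suml ttB) scaler_sumr.
  by apply: eq_bigr => p _; rewrite !ttE /s RZ tZ linearZ.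
by rewrite !ttE /s fF Fg /gamma hm_sesqui.
Qed.
End Existence.

(** * Spaces of both kinds and their classes *)

(** An element is determined by its pairings with generators. *)
Lemma gen_dual (S : Type) (P Y : zmodType) (p : S -> P) (F : P -> P -> Y) x y :
  biadditive F -> (forall x, (forall y, F x y = 0) -> x = 0) -> gen_by p ->
  (forall s, F x (p s) = F y (p s)) -> x = y.
Proof.
move=> FB Fn gp xy; apply/eqP; rewrite -subr_eq0; apply/eqP/Fn => z.
have [l ->] := gp z; rewrite (biadd_sumr FB) big1 // => s _.
by rewrite (biaddl FB) (biaddNl FB) xy subrr.
Qed.

(** The isometry f is the map with F' (f x) (p' s) = F x (p s) for all s. *)
Lemma family_isometry (S : Type) (P P' Y : zmodType) (p : S -> P) (p' : S -> P')
    (F : P -> P -> Y) (F' : P' -> P' -> Y) :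
  biadditive F -> biadditive F' ->
  (forall x, (forall y, F x y = 0) -> x = 0) ->
  (forall x, (forall y, F' x y = 0) -> x = 0) ->
  gen_by p -> gen_by p' ->
  (forall s s', F (p s) (p s') = F' (p' s) (p' s')) ->
  exists f : P -> P', [/\ bijective f, forall x y, F' (f x) (f y) = F x y
    & forall x s, F' (f x) (p' s) = F x (p s)].
Proof.
move=> FB FB' Fn Fn' gp gp' FF'.
have half (Q Q' : zmodType) (q : S -> Q) (q' : S -> Q') (G : Q -> Q -> Y)
    (G' : Q' -> Q' -> Y) : biadditive G -> biadditive G' -> gen_by q ->
    (forall s s', G (q s) (q s') = G' (q' s) (q' s')) ->
    exists f : Q -> Q', forall x s, G' (f x) (q' s) = G x (q s).
  move=> GB GB' gq GG'; pose l x := sval (cid (gq x)).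
  exists (fun x => \sum_(s <- l x) q' s) => x s.
  rewrite [in RHS](svalP (cid (gq x))) (biadd_suml GB) (biadd_suml GB').
  by apply: eq_bigr => s' _; rewrite GG'.
have [f fE] := half _ _ _ _ _ _ FB FB' gp FF'.
have [g gE] := half _ _ _ _ _ _ FB' FB gp' (fun s s' => esym (FF' s s')).
have fp s : f (p s) = p' s by apply: (gen_dual FB' Fn' gp') => s'; rewrite fE.
have fK : cancel f g.
  by move=> x; apply: (gen_dual FB Fn gp) => s; rewrite gE fE.
have gK : cancel g f.
  by move=> x; apply: (gen_dual FB' Fn' gp') => s; rewrite fE gE.
exists f; split=> // [|x y]; first by exists g.
have [l lE] := gp y.
have -> : f y = \sum_(s <- l) p' s.
  apply: (gen_dual FB' Fn' gp') => s.
  rewrite fE lE (biadd_suml FB) (biadd_suml FB').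
  by apply: eq_bigr => s' _.
rewrite lE (biadd_sumr FB) (biadd_sumr FB'); apply: eq_bigr => s _.
exact: fE.
Qed.

Section Uniform.
Variables (K : fieldType) (A : falgType K) (sigma : {linear A -> A}).

(** The spaces of all four kinds as one family, indexed by the kind k (K for
    [false], A for [true]) and the sign e; the product adds both indices. *)
Definition spc (k e : bool) : Type :=
  if k then hermMod sigma e else bilSpace K e.

Definition car k e : spc k e -> zmodType :=
  match k with
  | true => fun U : hermMod sigma e => hm_car U
  | false => fun V : bilSpace K e => bs_car V
  end.

(** Forms of both kinds take their values in A. *)
Definition frm k e : forall X : spc k e, car X -> car X -> A :=
  match k with
  | true => fun U u v => hm_form u v
  | false => fun V u v => (bs_form u v)%:A
  end.

Definition SGW (k e : bool) : nmodType :=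
  match k return nmodType with true => SGWA sigma e | false => SGWK K e end.

Definition cl k e : spc k e -> SGW k e :=
  match k with
  | true => @clsA K A sigma e
  | false => @clsK K e
  end.

Definition sprod k k' e e' : spc k e -> spc k' e' ->
    spc (k (+) k') (e (+) e') -> Prop :=
  match k, k' with
  | false, false => @prodKK K e e'
  | false, true => @prodKA K A sigma e e'
  | true, false => @prodAK K A sigma e e'
  | true, true => @prodAA K A sigma e e'
  end.

Definition cmul k k' e e' : SGW k e -> SGW k' e' -> SGW (k (+) k') (e (+) e') :=
  class_prod (@cl k e) (@cl k' e') (@cl (k (+) k') (e (+) e'))
    (@sprod k k' e e').

(** The Gram value of two pure tensors, as a function of the Gram values of
    their factors. *)
Definition gram_mul (k k' : bool) (a b : A) : A :=
  if k && k' then (Trd (a * sigma b))%:A else a * b.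

(** What remains of a product when the scalars are forgotten; it still
    determines the class of P ([gram_prod_unique]). *)
Definition gram_prod k k' e e' (X : spc k e) (Y : spc k' e')
    (P : spc (k (+) k') (e (+) e')) : Prop :=
  exists t : car X -> car Y -> car P,
  [/\ biadditive t, gen_by (fun s : car X * car Y => t s.1 s.2)
    & forall x y x' y',
      frm (t x y) (t x' y') = gram_mul k k' (frm x x') (frm y y')].

Hypothesis char2 : 2%N \notin [pchar K].
Hypothesis csA : central_simple A.
Hypothesis invol : involution_first_kind sigma.
Local Notation TrD := (TrdD char2 csA invol).
Local Notation TrZ := (TrdZ char2 csA invol).
Local Notation TrC := (TrdC char2 csA invol).
Local Notation sigM := (sigmaM invol).
Local Notation sigK := (sigmaK invol).

Lemma algA_inj : injective (fun k : K => k%:A : A).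
Proof.
move=> k l /eqP; rewrite -subr_eq0 -scalerBl scaler_eq0 oner_eq0 orbF.
by rewrite subr_eq0 => /eqP.
Qed.

Section OneSpace.
Variables (k e : bool).
Implicit Types X Y : spc k e.

Lemma frmB X : biadditive (@frm k e X).
Proof.
case: k X => X; first exact: hmB.
by split=> *; rewrite /= ?(biaddl (bsB X)) ?(biaddr (bsB X)) scalerDl.
Qed.

Lemma frm_nondegenerate X (x : car X) : (forall y, frm x y = 0) -> x = 0.
Proof.
case: k X x => X x x0; first exact: hm_nondegenerate.
by apply: bs_nondegenerate => y; apply: algA_inj; rewrite [LHS]x0 scale0r.
Qed.

Lemma cl_onto (x : SGW k e) : exists X, x = cl X.
Proof. by case: k x => x; exists (rep x); rewrite [RHS]repK. Qed.

(** Additivity of f is recorded because the carriers are only groups here. *)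
Lemma cl_isom X Y : cl X = cl Y -> exists f : car X -> car Y,
  [/\ {morph f : x y / x + y}, bijective f
    & forall x y, frm (f x) (f y) = frm x y].
Proof.
case: k X Y => X Y.
  move/clsAP => [f [fL fb fE]]; exists f; split=> // x y.
  by have := fL 1 x y; rewrite !scale1r.
move/clsKP => [f [fL fb fE]]; exists f; split=> // x y /=.
  by have := fL 1 x y; rewrite !scale1r.
by rewrite fE.
Qed.

Lemma cl_eq X Y (S : Type) (p : S -> car X) (q : S -> car Y) :
  gen_by p -> gen_by q -> (forall s s', frm (p s) (p s') = frm (q s) (q s')) ->
  cl X = cl Y.
Proof.
move=> gp gq pq.
have [f [fb fF fp]] := family_isometry (frmB X) (frmB Y)
  (@frm_nondegenerate X) (@frm_nondegenerate Y) gp gq pq.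
have feq z x : (forall s, frm z (q s) = frm x (p s)) -> z = f x.
  move=> zx; apply: (gen_dual (frmB Y) (@frm_nondegenerate Y) gq) => s.
  by rewrite fp zx.
case: k X Y p q gp gq pq f fb fF fp feq => X Y p q gp gq pq f fb fF fp feq.
  apply/clsAP; exists f; split=> // a x y; apply/esym/feq => s /=.
  rewrite !(biaddl (hmB _)) -[a *: f x]/(ract _ a) -[a *: x]/(ract _ a).
  by rewrite !hm_ractl; congr (_ * _ + _); apply: fp.
apply/clsKP; exists f; split=> // [a x y|x y]; last exact/algA_inj/fF.
apply/esym/feq => s /=; rewrite !(biaddl (bsB _)) !bsZl !scalerDl -!scalerA.
by congr (_ *: _ + _); apply: fp.
Qed.

End OneSpace.

Section Products.
Variables (k k' e e' : bool).
Implicit Types (X : spc k e) (Y : spc k' e') (P : spc (k (+) k') (e (+) e')).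

Lemma sprod_gram X Y P : sprod X Y P -> gram_prod X Y P.
Proof.
case: k k' X Y P => -[] X Y P.
- move=> [E [tE [T [tT [rho [lam [t]]]]]]].
  move=> [[tET tTT] [rhoDl [rhoDr rhoE]] [lamDl [lamDr lamE]] [tT' _] tF].
  have tB := tensor_biadditive tT'; have [_ _ tr] := tensor_balanced tT'.
  have tTB := tensor_biadditive tTT.
  exists (fun u v => t (tT u v) 1); split=> [|x|u v u' v'].
  + by split=> *; rewrite ?(biaddl tTB) ?(biaddr tTB) (biaddl tB).
  + have tg : gen_by (fun s : T * A => t s.1 s.2) := tensor_gen tT'.
    have [l ->] := gen_compl tB (tensor_gen tTT) tg x.
    exists [seq (ract s.1.1 s.2, s.1.2) | s <- l]; rewrite big_map.
    apply: eq_bigr => -[[u v] a] _ /=.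
    have := tr (tT u v) (tE a 1) 1.
    by rewrite rhoE lamE ract1 (sigma1 invol) !mulr1 => ->.
  + by rewrite /= tF (sigma1 invol) mul1r mulr1.
- move=> [t [tT _ tF]]; exists t; split.
  + exact: tensor_biadditive tT.
  + exact: tensor_gen tT.
  + by move=> u v u' v'; rewrite /= tF /gram_mul /= mulr_algr.
- move=> [t [tT _ tF]]; exists t; split.
  + exact: tensor_biadditive tT.
  + exact: tensor_gen tT.
  + by move=> u v u' v'; rewrite /= tF /gram_mul /= mulr_algl.
- move=> [t [tT _ tF]]; exists t; split.
  + exact: tensor_biadditive tT.
  + exact: tensor_gen tT.
  + by move=> u v u' v'; rewrite /= tF /gram_mul /= mulr_algl scalerA.
Qed.

Lemma sprod_exists X Y : exists P, sprod X Y P.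
Proof.
case: k k' X Y => -[] X Y.
- exact: prodAA_exists.
- exact: prodAK_exists.
- exact: prodKA_exists.
- exact: prodKK_exists.
Qed.

Lemma gram_prod_unique X X' Y Y' P P' : gram_prod X Y P -> gram_prod X' Y' P' ->
  cl X = cl X' -> cl Y = cl Y' -> cl P = cl P'.
Proof.
move=> [t [tB tg tF]] [t' [tB' tg' tF']].
move=> /cl_isom[f [fD [f' fK f'K] fF]] /cl_isom[g [gD [g' gK g'K] gF]].
apply: (cl_eq (p := fun s : car X * car Y => t s.1 s.2)
  (q := fun s : car X * car Y => t' (f s.1) (g s.2))) => // [x|s s'].
  have [l ->] := tg' x; exists [seq (f' s.1, g' s.2) | s <- l].
  by rewrite big_map; apply: eq_bigr => s _; rewrite /= f'K g'K.
by rewrite tF tF' fF gF.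
Qed.

Lemma well_defined_sprod :
  well_defined_prod (@cl k e) (@cl k' e') (@cl (k (+) k') (e (+) e'))
    (@sprod k k' e e').
Proof.
move=> X Y; split; first exact: sprod_exists.
move=> P pP; apply: xget_unique; first by exists X, Y, P.
move=> z [X' [Y' [P' [XX' YY' -> pP']]]].
by apply/esym/(gram_prod_unique (sprod_gram pP) (sprod_gram pP')).
Qed.

Lemma cmul_gram X Y P : cmul (cl X) (cl Y) = cl P -> gram_prod X Y P.
Proof.
have [Q pQ] := sprod_exists X Y; have [_ wd] := well_defined_sprod X Y.
have -> : cmul (cl X) (cl Y) = cl Q := wd _ pQ.
move=> /cl_isom[f [fD [f' fK f'K] fF]]; have [t [tB tg tF]] := sprod_gram pQ.
exists (fun x y => f (t x y)); split=> [|x|x y x' y'].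
- by split=> *; rewrite ?(biaddl tB) ?(biaddr tB) fD.
- have [l lE] := tg (f' x); exists l; rewrite -[LHS]f'K lE.
  have f0 : f 0 = 0 by apply: (addrI (f 0)); rewrite -fD !addr0.
  exact: (big_morph f fD f0).
by rewrite fF tF.
Qed.

End Products.
End Uniform.

(** * The laws of the product of classes *)

Section Laws.
Variables (K : fieldType) (A : falgType K) (sigma : {linear A -> A}).
Hypothesis char2 : 2%N \notin [pchar K].
Hypothesis csA : central_simple A.
Hypothesis invol : involution_first_kind sigma.
Local Notation TrD := (TrdD char2 csA invol).
Local Notation TrZ := (TrdZ char2 csA invol).
Local Notation TrC := (TrdC char2 csA invol).
Local Notation sigM := (sigmaM invol).
Local Notation sigK := (sigmaK invol).
Local Notation spc := (spc sigma).
Local Notation SGW := (SGW sigma).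
Local Notation gram_mul := (gram_mul sigma).
Local Notation N := (\dim {:A}).
Local Notation b i := ((vbasis {:A})`_i).

Definition sgw_in (k e : bool) : SGW k e -> SGWt sigma :=
  match k, e with
  | false, false => @inK0 (SGWK K) (SGWA sigma)
  | false, true => @inK1 (SGWK K) (SGWA sigma)
  | true, false => @inA0 (SGWK K) (SGWA sigma)
  | true, true => @inA1 (SGWK K) (SGWA sigma)
  end.

Lemma sgw_in_inj k e : injective (@sgw_in k e).
Proof. by case: k e => -[] x y []. Qed.

Lemma sgw_inD k e (x y : SGW k e) : sgw_in (x + y) = sgw_in x + sgw_in y.
Proof.
case: k e x y => -[] x y; rewrite /= /inK0 /inK1 /inA0 /inA1.
all: by congr (_, _, _, _); rewrite ?addr0.
Qed.

Lemma sgw_in0 k e : @sgw_in k e 0 = 0.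
Proof. by case: k e => -[]. Qed.

(** The indices of the two sides are equal, but not convertible; after
    inclusion in the sum no transport is necessary. *)
Lemma sgw_in_cl_eq k k' e e' (X : spc k e) (Y : spc k' e') (S : Type)
    (p : S -> car X) (q : S -> car Y) : k = k' -> e = e' ->
  gen_by p -> gen_by q -> (forall s s', frm (p s) (p s') = frm (q s) (q s')) ->
  sgw_in (cl X) = sgw_in (cl Y).
Proof.
move=> kk' ee'; case: k' / kk' Y q => Y; case: e' / ee' Y => Y q gp gq pq.
by congr sgw_in; apply: (cl_eq gp gq pq).
Qed.

(** The possible values of a form of kind k. *)
Definition kind_scalar (k : bool) (a : A) : Prop :=
  if k then True else exists c : K, a = c%:A.

Lemma frm_kind_scalar k e (X : spc k e) (x y : car X) : kind_scalar k (frm x y).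
Proof. by case: k X x y => X x y //; exists (bs_form x y). Qed.

Lemma gram_mulC k k' a c : kind_scalar k a -> kind_scalar k' c ->
  gram_mul k k' a c = gram_mul k' k c a.
Proof.
case: k k' => -[] /=; rewrite /gram_mul /=.
- by move=> _ _; rewrite -[in LHS](Trd_sigma char2 csA invol) sigM sigK.
- by move=> _ [l ->]; rewrite mulr_algl mulr_algr.
- by move=> [l ->] _; rewrite mulr_algl mulr_algr.
- by move=> [l ->] _; rewrite mulr_algl mulr_algr.
Qed.

Lemma gram_mulA k k' k'' a c d : ~~ [&& k, k' & k''] ->
  kind_scalar k a -> kind_scalar k' c -> kind_scalar k'' d ->
  gram_mul (k (+) k') k'' (gram_mul k k' a c) d =
  gram_mul k (k' (+) k'') a (gram_mul k' k'' c d).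
Proof.
case: k k' k'' => -[] [] //= _; rewrite /gram_mul /= ?mulrA //.
- move=> _ _ [l ->]; rewrite !mulr_algr [sigma (_ *: _)]linearZ /= -scalerAr.
  by rewrite TrZ scalerA mulrC.
- move=> _ [l ->] _; rewrite mulr_algr mulr_algl [sigma (_ *: _)]linearZ /=.
  by rewrite -scalerAl -scalerAr.
- by move=> [l ->] _ _; rewrite !mulr_algl -scalerAl TrZ scalerA.
Qed.

Lemma cmul_rep k k' e e' (x : SGW k e) (y : SGW k' e') :
  exists (X : spc k e) (Y : spc k' e') (P : spc (k (+) k') (e (+) e')),
  [/\ x = cl X, y = cl Y, cmul x y = cl P & gram_prod X Y P].
Proof.
have [X ->] := cl_onto x; have [Y ->] := cl_onto y.
have [P Pxy] := cl_onto (cmul (cl X) (cl Y)).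
by exists X, Y, P; split=> //; apply: cmul_gram.
Qed.

Lemma cmulC k k' e e' (x : SGW k e) (y : SGW k' e') :
  sgw_in (cmul x y) = sgw_in (cmul y x).
Proof.
have [X [Y [P [-> -> -> [t [tB tg tF]]]]]] := cmul_rep x y.
have [Q Qyx] := cl_onto (cmul (cl Y) (cl X)).
have [t' [tB' tg' tF']] := cmul_gram char2 csA invol Qyx; rewrite Qyx.
apply: (sgw_in_cl_eq (p := fun s : car X * car Y => t s.1 s.2)
  (q := fun s => t' s.2 s.1)) => // [||z|s s']; rewrite 1?addbC //.
  have [l ->] := tg' z; exists [seq (s.2, s.1) | s <- l]; rewrite big_map.
  by apply: eq_bigr.
by rewrite tF tF' gram_mulC //; apply: frm_kind_scalar.
Qed.

Section Twist.
Variable x : 'I_N -> A.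
Hypothesis G1 : forall a, \sum_(i < N) x i * a * b i = (Trd a)%:A.
Hypothesis G2 : forall a, \sum_(i < N) b i * a * x i = (Trd a)%:A.
Hypothesis G3 : forall a, \sum_(i < N) Trd (b i * a) *: x i = a.
Hypothesis G4 : forall a, \sum_(i < N) Trd (x i * a) *: b i = a.

(** The operator associated with the square of the Goldman element is
    a |-> sum_j Trd (x_j a) b_j, which is the identity. *)
Lemma goldman_square (X : zmodType) (beta : A -> A -> X) : biadditive beta ->
  (forall k x y, beta x (k *: y) = beta (k *: x) y) ->
  \sum_(j < N) \sum_(i < N) beta (x i * x j) (b i * b j) = beta 1 1.
Proof.
move=> bB bZ.
transitivity (\sum_(p <- [:: tt]) beta 1 1); last by rewrite big_seq1.
transitivity (\sum_(p : 'I_N * 'I_N) beta (x p.2 * x p.1) (b p.2 * b p.1)).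
  by rewrite sum_pair.
apply: (sandwich_bilin_eq csA (a := fun p : 'I_N * 'I_N => x p.2 * x p.1)
  (c := fun p : 'I_N * 'I_N => b p.2 * b p.1) (d := fun _ : unit => 1)
  (e := fun _ : unit => 1) (biaddl bB) (biaddr bB) bZ) => a.
rewrite big_seq1 mul1r mulr1 -[RHS]G4 sum_pair; apply: eq_bigr => j _ /=.
rewrite -mulr_algl -G1 mulr_suml; apply: eq_bigr => i _.
by rewrite !mulrA.
Qed.

(** The sum over j is evaluated by G3, as x is dual to b; the sum over i is
    then the image under sigma of the Goldman operator. *)
Lemma twisted_gram h g l : \sum_(i < N) \sum_(j < N)
    (sigma (x i) * h * x j) * (Trd (g * sigma (sigma (b i) * l * b j)))%:A
  = (Trd (h * sigma g))%:A * l.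
Proof.
transitivity (\sum_(i < N) sigma (x i) * (h * sigma g) * sigma (b i) * l).
  apply: eq_bigr => i _.
  transitivity (sigma (x i) * h *
      \sum_(j < N) Trd (b j * (sigma g * sigma (b i) * l)) *: x j).
    rewrite mulr_sumr; apply: eq_bigr => j _; rewrite mulr_algr scalerAr.
    congr (_ * (_ *: _)); rewrite -(Trd_sigma char2 csA invol) !sigM !sigK.
    by rewrite -!mulrA [LHS]TrC -!mulrA [LHS]TrC -!mulrA.
  by rewrite G3 !mulrA.
rewrite -mulr_suml; congr (_ * _).
rewrite -(Trd_sigma char2 csA invol) -[RHS](sigmaZ invol) -G2 linear_sum.
by apply: eq_bigr => i _ /=; rewrite [RHS]sigM (sigM (b i)) sigK [RHS]mulrA.
Qed.

End Twist.

(** The iterated product on the right contains a generating family with the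
    Gram values of the iterated product on the left: the pure tensors, unless
    all three factors are modules over A. *)
Lemma assoc_family k k' k'' e e' e'' d d'
    (X : spc k e) (Y : spc k' e') (Z : spc k'' e'') (Q : spc (k' (+) k'') d)
    (P : spc (k (+) (k' (+) k'')) d') (t1 : car Y -> car Z -> car Q)
    (t2 : car X -> car Q -> car P) :
  biadditive t1 -> gen_by (fun s : car Y * car Z => t1 s.1 s.2) ->
  (forall x y x' y',
    frm (t1 x y) (t1 x' y') = gram_mul k' k'' (frm x x') (frm y y')) ->
  biadditive t2 -> gen_by (fun s : car X * car Q => t2 s.1 s.2) ->
  (forall x y x' y',
    frm (t2 x y) (t2 x' y') = gram_mul k (k' (+) k'') (frm x x') (frm y y')) ->
  exists2 p : car X * car Y * car Z -> car P, gen_by p &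
    forall x y z x' y' z', frm (p (x, y, z)) (p (x', y', z')) =
      gram_mul (k (+) k') k'' (gram_mul k k' (frm x x') (frm y y')) (frm z z').
Proof.
move=> t1B t1g t1F t2B t2g t2F; have p0g := gen_compr t2B t1g t2g.
have [kkk|nkkk] := boolP [&& k, k' & k'']; last first.
  exists (fun s => t2 s.1.1 (t1 s.1.2 s.2)) => [w|x y z x' y' z'].
    have [l ->] := p0g w; exists [seq ((s.1, s.2.1), s.2.2) | s <- l].
    by rewrite big_map; apply: eq_bigr.
  by rewrite t2F t1F gram_mulA //; apply: frm_kind_scalar.
case: k k' k'' kkk X Y Z Q P t1 t2 t1B t1g t1F t2B t2g t2F p0g => -[] [] // _.
move=> U V W Q P t1 t2 t1B t1g t1F t2B t2g t2F p0g.
have [x [G1 G2 G3 G4]] := goldman char2 csA invol.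
pose p (s : U * V * W) :=
  \sum_(i < N) t2 (ract s.1.1 (x i)) (t1 s.1.2 (ract s.2 (b i))).
have UB := ractB U; have WB := ractB W.
have tF u v w u' v' w' : hm_form (t2 u (t1 v w)) (t2 u' (t1 v' w')) =
    hm_form u u' * (Trd (hm_form v v' * sigma (hm_form w w')))%:A.
  by have := t2F u (t1 v w) u' (t1 v' w'); rewrite t1F.
exists p => [y|u v w u' v' w'].
  have [l ->] := p0g y.
  exists [seq (ract s.1 (x j), s.2.1, ract s.2.2 (b j)) | s <- l,
    j <- index_enum 'I_N].
  rewrite big_allpairs_dep; apply: eq_bigr => -[u [v w]] _ /=; rewrite /p /=.
  pose beta a c := t2 (ract u a) (t1 v (ract w c)).
  have betaB : biadditive beta.
    split=> [a a' c|a c c']; rewrite /beta.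
      by rewrite (biaddr UB) (biaddl t2B).
    by rewrite (biaddr WB) (biaddr t1B) (biaddr t2B).
  have betaZ k a c : beta a (k *: c) = beta (k *: a) c.
    apply: (gen_dual (frmB (P : spc true d'))
      (@frm_nondegenerate _ _ _ true d' P) p0g).
    have hZ e0 (M : hermMod sigma e0) (m m' : M) a0 :
        hm_form (ract m (k *: a0)) m' = k *: hm_form (ract m a0) m'.
      by rewrite !hm_ractl linearZ -scalerAl.
    move=> -[u' [v' w']]; rewrite /= !tF !hZ [sigma (_ *: _)]linearZ /=.
    rewrite -(scalerAr k (hm_form v v')) TrZ.
    by rewrite -scalerA -scalerAr -scalerAl.
  transitivity (beta 1 1); first by rewrite /beta !ract1.
  rewrite -(goldman_square G1 G4 betaB betaZ) exchange_big.
  by apply: eq_bigr => j _; apply: eq_bigr => i _; rewrite /beta !ractM.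
have PB := hmB P.
transitivity (\sum_(i < N) \sum_(j < N)
    (sigma (x i) * hm_form u u' * x j) *
    (Trd (hm_form v v' * sigma (sigma (b i) * hm_form w w' * b j)))%:A).
  rewrite /p /= (biadd_suml PB); apply: eq_bigr => i _.
  rewrite (biadd_sumr PB); apply: eq_bigr => j _.
  by rewrite tF !hm_sesqui.
by rewrite (twisted_gram G2 G3).
Qed.

Lemma cmulA k k' k'' e e' e'' (x : SGW k e) (y : SGW k' e') (z : SGW k'' e'') :
  sgw_in (cmul x (cmul y z)) = sgw_in (cmul (cmul x y) z).
Proof.
have [X ->] := cl_onto x; have [Y ->] := cl_onto y; have [Z ->] := cl_onto z.
have [Q Qyz] := cl_onto (cmul (cl Y) (cl Z)).
have [R Rxy] := cl_onto (cmul (cl X) (cl Y)); rewrite Qyz Rxy.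
have [P Pxq] := cl_onto (cmul (cl X) (cl Q)).
have [P' Prz] := cl_onto (cmul (cl R) (cl Z)); rewrite Pxq Prz.
have [t1 [t1B t1g t1F]] := cmul_gram char2 csA invol Qyz.
have [t2 [t2B t2g t2F]] := cmul_gram char2 csA invol Pxq.
have [t3 [t3B t3g t3F]] := cmul_gram char2 csA invol Rxy.
have [t4 [t4B t4g t4F]] := cmul_gram char2 csA invol Prz.
have [p pg pF] := assoc_family t1B t1g t1F t2B t2g t2F.
apply: (sgw_in_cl_eq (p := p) (q := fun s => t4 (t3 s.1.1 s.1.2) s.2));
  rewrite 1?addbA //.
  exact: gen_compl t4B t3g t4g.
by move=> [[x1 y1] z1] [[x2 y2] z2] /=; rewrite pF t4F t3F.
Qed.

Definition osum k e : spc k e -> spc k e -> spc k e :=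
  match k with
  | true => fun U U' : hermMod sigma e => osumA U U'
  | false => fun V V' : bilSpace K e => osumK V V'
  end.

Definition opair k e : forall X Y : spc k e, car X -> car Y -> car (osum X Y) :=
  match k with
  | true => fun U U' u u' => (u, u')
  | false => fun V V' v v' => (v, v')
  end.

Lemma opair_frm k e (X Y : spc k e) (x x' : car X) (y y' : car Y) :
  frm (opair x y) (opair x' y') = frm x x' + frm y y'.
Proof. by case: k X Y x x' y y' => //= *; rewrite scalerDl. Qed.

Lemma opair_onto k e (X Y : spc k e) z :
  exists x y, z = opair (X := X) (Y := Y) x y.
Proof. by case: k X Y z => X Y [x y]; exists x, y. Qed.

Lemma opairD k e (X Y : spc k e) (x x' : car X) (y y' : car Y) :
  opair (x + x') (y + y') = opair x y + opair x' y'.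
Proof. by case: k X Y x x' y y'. Qed.

Lemma cl_osum k e (X Y : spc k e) : cl (osum X Y) = cl X + cl Y.
Proof.
case: k X Y => X Y.
  apply/clsAP.
  have [f [fL [f' fK f'K] fE]] := (clsAP X (rep (clsA X))).1 (esym (repK _)).
  have [g [gL [g' gK g'K] gE]] := (clsAP Y (rep (clsA Y))).1 (esym (repK _)).
  exists (fun p => (f p.1, g p.2)); split=> [k u v|| [u u'] [v v']].
  - by rewrite /= fL gL.
  - exists (fun p => (f' p.1, g' p.2)) => -[u v] /=; first by rewrite fK gK.
    by rewrite f'K g'K.
  - by rewrite /= /sumA_form /= fE gE.
apply/clsKP.
have [f [fL [f' fK f'K] fE]] := (clsKP X (rep (clsK X))).1 (esym (repK _)).
have [g [gL [g' gK g'K] gE]] := (clsKP Y (rep (clsK Y))).1 (esym (repK _)).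
exists (fun p => (f p.1, g p.2)); split=> [k u v|| [u u'] [v v']].
- by rewrite /= fL gL.
- by exists (fun p => (f' p.1, g' p.2)) => -[u v] /=; rewrite ?fK ?gK ?f'K ?g'K.
- by rewrite /= /sumK_form /= fE gE.
Qed.

Lemma gram_mulDl k k' a a' c :
  gram_mul k k' (a + a') c = gram_mul k k' a c + gram_mul k k' a' c.
Proof.
by rewrite /gram_mul; case: ifP => _; rewrite mulrDl // TrD scalerDl.
Qed.

Lemma cmulDl k k' e e' (x y : SGW k e) (z : SGW k' e') :
  cmul (x + y) z = cmul x z + cmul y z.
Proof.
have [X ->] := cl_onto x; have [Y ->] := cl_onto y; have [Z ->] := cl_onto z.
have [P Pxz] := cl_onto (cmul (cl X) (cl Z)).
have [Q Qyz] := cl_onto (cmul (cl Y) (cl Z)).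
have [R Rxyz] := cl_onto (cmul (cl (osum X Y)) (cl Z)).
rewrite Pxz Qyz -!cl_osum Rxyz; apply/esym.
have [t1 [t1B t1g t1F]] := cmul_gram char2 csA invol Pxz.
have [t2 [t2B t2g t2F]] := cmul_gram char2 csA invol Qyz.
have [t3 [t3B t3g t3F]] := cmul_gram char2 csA invol Rxyz.
pose S := ((car X * car Y) * car Z)%type.
apply: (cl_eq (p := fun s : S =>
  opair (X := P) (Y := Q) (t1 s.1.1 s.2) (t2 s.1.2 s.2))
  (q := fun s : S => t3 (opair s.1.1 s.1.2) s.2)) => [w|w|s s'].
- have [p [q ->]] := opair_onto w; have [l ->] := t1g p; have [m ->] := t2g q.
  exists ([seq ((s.1, 0), s.2) | s <- l] ++ [seq ((0, s.1), s.2) | s <- m]).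
  rewrite big_cat !big_map /=.
  have suml I (r : seq I) (F : I -> car P) :
      \sum_(i <- r) opair (F i) (0 : car Q) = opair (\sum_(i <- r) F i) 0.
    elim: r => [|i r IH]; last by rewrite !big_cons IH -opairD addr0.
    by rewrite !big_nil; apply: (addrI (opair 0 0)); rewrite -opairD !addr0.
  have sumr I (r : seq I) (F : I -> car Q) :
      \sum_(i <- r) opair (0 : car P) (F i) = opair 0 (\sum_(i <- r) F i).
    elim: r => [|i r IH]; last by rewrite !big_cons IH -opairD addr0.
    by rewrite !big_nil; apply: (addrI (opair 0 0)); rewrite -opairD !addr0.
  transitivity (\sum_(s <- l) opair (t1 s.1 s.2) (0 : car Q) +
    \sum_(s <- m) opair (0 : car P) (t2 s.1 s.2)).
    by rewrite suml sumr -opairD addr0 add0r.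
  by congr (_ + _); apply: eq_bigr => s _; rewrite (biadd0l t1B, biadd0l t2B).
- have [l ->] := t3g w.
  elim: l => [|[v z0] l [m IH]]; first by exists [::]; rewrite !big_nil.
  have [x0 [y0 E]] := opair_onto v.
  by exists (((x0, y0), z0) :: m); rewrite !big_cons IH /= E.
- by rewrite opair_frm t1F t2F t3F opair_frm gram_mulDl.
Qed.

Lemma cmulDr k k' e e' (x : SGW k e) (y z : SGW k' e') :
  cmul x (y + z) = cmul x y + cmul x z.
Proof.
apply: sgw_in_inj; rewrite sgw_inD cmulC cmulDl sgw_inD.
by congr (_ + _); apply: cmulC.
Qed.

Lemma trivial_spc k e : exists2 Z : spc k e,
  forall z : car Z, z = 0 & 0 = cl Z.
Proof.
case: k; [exists (zeroA sigma e) | exists (zeroK K e)] => // z.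
all: by apply/rowP => -[].
Qed.

Lemma cl_trivial k e (X : spc k e) : (forall x : car X, x = 0) -> cl X = 0.
Proof.
have triv (Y : spc k e) : (forall y : car Y, y = 0) ->
    gen_by (fun v : void => match v with end : car Y).
  by move=> Y0 y; exists [::]; rewrite big_nil (Y0 y).
move=> X0; have [Z Z0 ->] := trivial_spc k e.
exact: (cl_eq (triv X X0) (triv Z Z0)).
Qed.

Lemma cmul0l k k' e e' (y : SGW k' e') : cmul (0 : SGW k e) y = 0.
Proof.
have [Y ->] := cl_onto y.
have [Z Z0 ->] := trivial_spc k e.
have [P Pzy] := cl_onto (cmul (cl Z) (cl Y)); rewrite Pzy.
have [t [tB tg _]] := cmul_gram char2 csA invol Pzy.
apply: cl_trivial => x; have [l ->] := tg x.
by rewrite big1 // => s _; rewrite (Z0 s.1) (biadd0l tB).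
Qed.

Lemma cmul0r k k' e e' (x : SGW k e) : cmul x (0 : SGW k' e') = 0.
Proof. by apply: sgw_in_inj; rewrite cmulC cmul0l !sgw_in0. Qed.

Lemma cmul1l k e (x : SGW k e) :
  sgw_in (cmul (clsK (unitK K) : SGW false false) x) = sgw_in x.
Proof.
have [X ->] := cl_onto x.
have [P PX] := cl_onto (cmul (cl (unitK K : spc false false)) (cl X)).
rewrite [X in sgw_in X]PX.
have [t [tB tg tF]] := cmul_gram char2 csA invol PX.
pose act (c : K) : car X -> car X :=
  match k return forall X : spc k e, car X -> car X with
  | true => fun U u => ract u c%:A
  | false => fun V v => c *: v
  end X.
have act1 u : act 1 u = u.
  by rewrite /act; case: (k) X {P PX t tB tg tF act} u => X u;
    rewrite scale1r ?ract1.
have actF c c' u u' : frm (act c u) (act c' u') = (c * c') *: frm u u'.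
  rewrite /act; case: (k) X {P PX t tB tg tF act act1} u u' => X u u' /=.
    by rewrite hm_scalel // hm_scaler // scalerA.
  by rewrite bsZl bsZr mulrA scalerA.
apply: (sgw_in_cl_eq
  (p := fun s : car (unitK K : spc false false) * car X => t s.1 s.2)
  (q := fun s : K * car X => act s.1 s.2)) => // [u|s s'].
  by exists [:: (1, u)]; rewrite big_seq1 act1.
by rewrite tF actF /gram_mul /= mulr_algl.
Qed.

End Laws.

(** * Grothendieck groups and graded sums *)

Local Open Scope classical_set_scope.

(** Biadditivity for monoids, where preservation of 0 is not automatic. *)
Record bimorph (M N P : nmodType) (f : M -> N -> P) : Prop := Bimorph {
  bimDl : forall x y z, f (x + y) z = f x z + f y z;
  bimDr : forall x y z, f x (y + z) = f x y + f x z;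
  bim0l : forall y, f 0 y = 0;
  bim0r : forall x, f x 0 = 0 }.

Section Grothendieck.
Variable M : nmodType.
Implicit Types a b c d : M * M.

(** It suffices that [groth_rel] is an equivalence. *)
Lemma grothP a b :
  cls (@groth_rel M) a = cls (@groth_rel M) b <-> groth_rel a b.
Proof.
have trans x y z : groth_rel x y -> groth_rel y z -> @groth_rel M x z.
  case=> k E [l F]; exists (y.1 + y.2 + k + l).
  transitivity ((x.1 + y.2 + k) + (y.1 + z.2 + l)).
    by rewrite !addrA [LHS](ACl (1*4*5*3*2*6)).
  by rewrite E F !addrA [LHS](ACl (4*2*1*5*3*6)).
have sym x y : groth_rel x y -> @groth_rel M y x by case=> k E; exists k.
split=> [/(congr1 sval) /= -> |ab]; first by exists 0.
apply: eq_exist; apply: funext => z; apply: propext.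
by split; [apply/trans/sym | apply: trans].
Qed.

Lemma groth_addE a b :
  (cls (@groth_rel M) a : groth M) + cls (@groth_rel M) b =
  cls (@groth_rel M) (groth_addr a b).
Proof.
apply/grothP.
have [k E] : groth_rel (rep (cls (@groth_rel M) a)) a.
  by apply/grothP; rewrite repK.
have [l F] : groth_rel (rep (cls (@groth_rel M) b)) b.
  by apply/grothP; rewrite repK.
exists (k + l); rewrite /groth_addr /=.
set x := rep _ in E *; set y := rep _ in F *.
transitivity ((x.1 + a.2 + k) + (y.1 + b.2 + l)).
  by rewrite !addrA [LHS](ACl (1*3*5*2*4*6)).
by rewrite E F !addrA [LHS](ACl (1*4*2*5*3*6)).
Qed.

Lemma groth_inD (x y : M) :
  groth_in (x + y) = groth_in x + groth_in y :> groth M.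
Proof. by rewrite [RHS]groth_addE /groth_addr /= addr0. Qed.

Lemma groth_in0 : groth_in 0 = 0 :> groth M.
Proof. by apply: (addrI (groth_in 0)); rewrite -groth_inD !addr0. Qed.

Section Lift.
Variables (Z : zmodType) (phi : M -> Z).
Hypothesis phiD : forall x y, phi (x + y) = phi x + phi y.

Definition groth_lift (x : groth M) : Z := phi (rep x).1 - phi (rep x).2.

Lemma groth_lift_cls a : groth_lift (cls _ a) = phi a.1 - phi a.2.
Proof.
have [k E] : groth_rel (rep (cls (@groth_rel M) a)) a.
  by apply/grothP; rewrite repK.
rewrite /groth_lift; set x := rep _ in E *.
apply/eqP; rewrite subr_eq addrAC eq_sym subr_eq -!phiD; apply/eqP.
by apply: (addIr (phi k)); rewrite -!phiD E.
Qed.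

Lemma groth_liftD x y : groth_lift (x + y) = groth_lift x + groth_lift y.
Proof.
by rewrite -[x]repK -[y]repK groth_addE !groth_lift_cls /= !phiD opprD addrACA.
Qed.

Lemma groth_lift_in x : groth_lift (groth_in x) = phi x.
Proof.
have phi0 : phi 0 = 0 by apply: (addrI (phi 0)); rewrite -phiD !addr0.
by rewrite groth_lift_cls /= phi0 subr0.
Qed.
End Lift.

Lemma groth_diff (x : groth M) : x = groth_in (rep x).1 - groth_in (rep x).2.
Proof.
apply/eqP; rewrite eq_sym subr_eq; apply/eqP.
rewrite -{2}[x]repK [RHS]groth_addE; apply/grothP.
by exists 0; rewrite /groth_addr /= !addr0.
Qed.

End Grothendieck.

Section GrothExt.
Variables (M N P : nmodType).

Lemma groth_ext2_flip (f : M -> N -> P) x y :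
  groth_ext2 f x y = groth_ext2 (fun n m => f m n) y x.
Proof.
rewrite /groth_ext2; case: (rep x) => a b; case: (rep y) => c d.
by rewrite [f a d + _]addrC.
Qed.

Variables (f : M -> N -> P).
Hypothesis fB : bimorph f.

Let F a c : groth P := groth_in (f a c).
Let FDl c a b : F (a + b) c = F a c + F b c.
Proof. by rewrite /F (bimDl fB) groth_inD. Qed.

(** In this form the extension inherits additivity in x from the liftings. *)
Lemma groth_ext2E x y :
  groth_ext2 f x y
    = groth_lift (F^~ (rep y).1) x - groth_lift (F^~ (rep y).2) x.
Proof.
rewrite /groth_ext2 /groth_lift; case: (rep x) => a b; case: (rep y) => c d /=.
rewrite !groth_inD !opprD opprK [LHS]addrACA [RHS]addrACA.
by rewrite [_ - groth_in (f b c)]addrC.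
Qed.

Lemma groth_ext2Dl x x' y :
  groth_ext2 f (x + x') y = groth_ext2 f x y + groth_ext2 f x' y.
Proof. by rewrite !groth_ext2E !groth_liftD // opprD addrACA. Qed.

Lemma groth_ext2_in x y :
  groth_ext2 f (groth_in x) (groth_in y) = groth_in (f x y).
Proof.
rewrite groth_ext2E !groth_lift_in //.
have FDr a c d : F a (c + d) = F a c + F a d by rewrite /F (bimDr fB) groth_inD.
exact: (groth_lift_in (FDr x)).
Qed.
End GrothExt.

Lemma groth_ext2_bimorph (M N P : nmodType) (f : M -> N -> P) :
  bimorph f -> bimorph (groth_ext2 f).
Proof.
move=> fB; have fB' : bimorph (fun n m => f m n).
  by case: fB => f1 f2 f3 f4; split.
have Dl := groth_ext2Dl fB.
have Dr x y z : groth_ext2 f x (y + z) = groth_ext2 f x y + groth_ext2 f x z.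
  by rewrite !(groth_ext2_flip f x) groth_ext2Dl.
by split=> // [y|x]; [apply: (addrI (groth_ext2 f 0 y)); rewrite -Dl !addr0
  | apply: (addrI (groth_ext2 f x 0)); rewrite -Dr !addr0].
Qed.

(** Every law is additive in each of its arguments, and the differences of
    elements j a generate G. *)
Lemma semiring_completion (S : nmodType) (G : zmodType) (j : S -> G)
    (one : S) (m : S -> S -> S) (mG : G -> G -> G) :
  comm_semiring one m -> bimorph mG ->
  (forall x y, j (m x y) = mG (j x) (j y)) ->
  (forall z, exists a b, z = j a - j b) ->
  comm_semiring (j one) mG.
Proof.
move=> [mA mC m1 _ _] mB jM jz.
have mBl x y z : mG (x - y) z = mG x z - mG y z.
  by apply: (addIr (mG y z)); rewrite subrK -(bimDl mB) subrK.
have mBr x y z : mG x (y - z) = mG x y - mG x z.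
  by apply: (addIr (mG x z)); rewrite subrK -(bimDr mB) subrK.
have ind (P : G -> Prop) : (forall a, P (j a)) ->
    (forall x y, P x -> P y -> P (x - y)) -> forall x, P x.
  by move=> Pj PB x; have [a [b ->]] := jz x; apply: PB.
split=> [x y z|x y|x|x y z|x].
- elim/ind: x => [x|x x' IH IH']; last by rewrite !mBl IH IH'.
  elim/ind: y => [y|y y' IH IH']; last by rewrite mBl !mBr mBl IH IH'.
  elim/ind: z => [z|z z' IH IH']; last by rewrite !mBr IH IH'.
  by rewrite -!jM mA.
- elim/ind: x => [x|x x' IH IH']; last by rewrite mBl mBr IH IH'.
  elim/ind: y => [y|y y' IH IH']; last by rewrite mBl mBr IH IH'.
  by rewrite -!jM mC.
- elim/ind: x => [x|x x' IH IH']; last by rewrite mBr IH IH'.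
  by rewrite -jM m1.
- exact: (bimDl mB).
- exact: (bim0l mB).
Qed.

Section FourSum.
Variables (XK XA : bool -> nmodType).
Variable pKK : forall e e', XK e -> XK e' -> XK (e (+) e').
Variable pKA : forall e e', XK e -> XA e' -> XA (e (+) e').
Variable pAK : forall e e', XA e -> XK e' -> XA (e (+) e').
Variable pAA : forall e e', XA e -> XA e' -> XK (e (+) e').
Hypothesis KK : forall e e', bimorph (@pKK e e').
Hypothesis KA : forall e e', bimorph (@pKA e e').
Hypothesis AK : forall e e', bimorph (@pAK e e').
Hypothesis AA : forall e e', bimorph (@pAA e e').

Local Notation S := (foursum XK XA).
Local Notation m := (@foursum_mul XK XA pKK pKA pAK pAA).

Lemma foursum_bimorph : bimorph (m : S -> S -> S).
Proof.
have shuffle (V : nmodType) (a b c d a' b' c' d' : V) :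
    (a + a') + (b + b') + (c + c') + (d + d')
      = (a + b + c + d) + (a' + b' + c' + d').
  by rewrite (addrACA a) (addrACA (a + b)) (addrACA (a + b + c)).
split=> [[[[x0 x1] u0] u1] [[[y0 y1] v0] v1] [[[z0 z1] w0] w1]
  |[[[x0 x1] u0] u1] [[[y0 y1] v0] v1] [[[z0 z1] w0] w1]
  |[[[y0 y1] v0] v1]|[[[x0 x1] u0] u1]];
  rewrite /foursum_mul /=.
- by rewrite !(bimDl (KK _ _), bimDl (KA _ _), bimDl (AK _ _),
    bimDl (AA _ _)) !shuffle.
- by rewrite !(bimDr (KK _ _), bimDr (KA _ _), bimDr (AK _ _),
    bimDr (AA _ _)) !shuffle.
- by rewrite !(bim0l (KK _ _), bim0l (KA _ _), bim0l (AK _ _),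
    bim0l (AA _ _)) !addr0.
- by rewrite !(bim0r (KK _ _), bim0r (KA _ _), bim0r (AK _ _),
    bim0r (AA _ _)) !addr0.
Qed.

Definition foursum_in (k e : bool) : (if k then XA e else XK e) -> S :=
  match k, e with
  | false, false => @inK0 XK XA
  | false, true => @inK1 XK XA
  | true, false => @inA0 XK XA
  | true, true => @inA1 XK XA
  end.

Definition foursum_prod k k' e e' :
    (if k then XA e else XK e) -> (if k' then XA e' else XK e') ->
    (if k (+) k' then XA (e (+) e') else XK (e (+) e')) :=
  match k, k' with
  | false, false => @pKK e e'
  | false, true => @pKA e e'
  | true, false => @pAK e e'
  | true, true => @pAA e e'
  end.

Lemma foursum_mul_in k k' e e' x y :
  m (@foursum_in k e x) (@foursum_in k' e' y) = foursum_in (foursum_prod x y).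
Proof.
case: k e x k' e' y => -[] x [] [] y;
  rewrite /= /inK0 /inK1 /inA0 /inA1 /foursum_mul;
  by rewrite !(bim0l (KK _ _), bim0l (KA _ _), bim0l (AK _ _), bim0l (AA _ _),
    bim0r (KK _ _), bim0r (KA _ _), bim0r (AK _ _), bim0r (AA _ _))
    ?addr0 ?add0r.
Qed.

Lemma foursum_ind (P : S -> Prop) :
  (forall k e x, P (@foursum_in k e x)) ->
  (forall x y, P x -> P y -> P (x + y)) ->
  forall x, P x.
Proof.
move=> Pin PD [[[x0 x1] u0] u1].
have -> : (x0, x1, u0, u1) = @foursum_in false false x0
    + @foursum_in false true x1 + @foursum_in true false u0
    + @foursum_in true true u1 :> S.
  by congr (_, _, _, _); rewrite /= ?addr0 ?add0r.
by do 3! [apply: (PD); last exact: (Pin)]; apply: (Pin).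
Qed.

Variable orth : Prop.
Local Notation comp := (@foursum_comp XK XA orth).

(** For modules over A the degree depends on the type of sigma; [orth] says
    that sigma is orthogonal. *)
Definition degree (k e : bool) : Gamma :=
  if k then if `[< orth >] (+) e then Go else Gs else if e then Gm else Gp.

Lemma compP g x : comp g x <-> exists k e y,
  x = @foursum_in k e y /\ degree k e = g.
Proof.
rewrite /degree; split.
  case: g => /=; [case=> y _ <- | case=> y _ <-
    | case: ifP => o [y _ <-] | case: ifP => o [y _ <-]].
  - by exists false, false, y.
  - by exists false, true, y.
  - by exists true, false, y.
  - by exists true, true, y.
  - by exists true, true, y.
  - by exists true, false, y.
case=> k [e [y [-> <-]]]; case: k y => y; case: e y => y; try by exists y.
  by case o: `[< orth >]; rewrite /foursum_comp /= o; exists y.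
by case o: `[< orth >]; rewrite /foursum_comp /= o; exists y.
Qed.

Lemma degreeM k k' e e' :
  degree (k (+) k') (e (+) e') = Gamma_mul (degree k e) (degree k' e').
Proof.
by rewrite /degree; case: asbool; case: k; case: k'; case: e; case: e'.
Qed.

Lemma foursum_graded (one : S) : comp Gp one -> Gamma_graded one m comp.
Proof.
move=> comp1; split=> // [g|x|g d x y].
- have sub (V : nmodType) (h : V -> S) :
      h 0 = 0 -> (forall x y, h (x + y) = h x + h y) ->
      range h 0 /\ forall x y, range h x -> range h y -> range h (x + y).
    move=> h0 hD; split=> [|_ _ [x _ <-] [y _ <-]]; first by exists 0.
    by exists (x + y).
  have D k e x y : @foursum_in k e (x + y) = foursum_in x + foursum_in y.
    by case: k e x y => -[] x y; congr (_, _, _, _); rewrite /= ?addr0.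
  have Z k e : @foursum_in k e 0 = 0 by case: k e => -[].
  case: g => /=; [|  | case: ifP => _ | case: ifP => _].
  + exact: (sub _ _ (Z false false) (@D false false)).
  + exact: (sub _ _ (Z false true) (@D false true)).
  + exact: (sub _ _ (Z true false) (@D true false)).
  + exact: (sub _ _ (Z true true) (@D true true)).
  + exact: (sub _ _ (Z true true) (@D true true)).
  + exact: (sub _ _ (Z true false) (@D true false)).
- case: x => [[[x0 x1] u0] u1].
  pose c g : S := match g with
    | Gp => inK0 XK XA x0
    | Gm => @inK1 XK XA x1
    | Go => if `[< orth >] then @inA0 XK XA u0 else @inA1 XK XA u1
    | Gs => if `[< orth >] then @inA1 XK XA u1 else @inA0 XK XA u0
    end.
  exists c; split.
    split.
      by case=> /=; [exists x0 | exists x1 | case: ifP => _; eexists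
        | case: ifP => _; eexists].
    by rewrite /c; case: ifP => _; congr (_, _, _, _);
      rewrite /= ?addr0 ?add0r.
  move=> c' [c'P]; have [y0 _ E0] := c'P Gp; have [y1 _ E1] := c'P Gm.
  have := c'P Gs; have := c'P Go; rewrite /= => c'o c's.
  rewrite -E0 -E1 => E; apply: funext => g; rewrite /c.
  move: c'o c's E; case: ifP => o [v _ Ev] [w _ Ew]; rewrite -Ev -Ew.
    by case=> /=; rewrite ?addr0 ?add0r => -> -> -> ->; case: g;
      rewrite ?E0 ?E1 ?Ev ?Ew.
  by case=> /=; rewrite ?addr0 ?add0r => -> -> -> ->; case: g;
    rewrite ?E0 ?E1 ?Ev ?Ew.
- move=> /compP[k [e [{}x [-> <-]]]] /compP[k' [e' [{}y [-> <-]]]].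
  rewrite foursum_mul_in; apply/compP.
  by exists (k (+) k'), (e (+) e'), (foursum_prod x y); rewrite degreeM.
Qed.

End FourSum.

(** * The mixed semiring and the mixed ring *)

Section Final.
Variables (K : fieldType) (A : falgType K) (sigma : {linear A -> A}).
Hypothesis char2 : 2%N \notin [pchar K].
Hypothesis csA : central_simple A.
Hypothesis invol : involution_first_kind sigma.

Lemma cmul_bimorph k k' e e' : bimorph (@cmul K A sigma k k' e e').
Proof.
split.
- exact: cmulDl.
- exact: cmulDr.
- exact: cmul0l.
- exact: cmul0r.
Qed.

Let KK e e' : bimorph (@mulKK K e e') := @cmul_bimorph false false e e'.
Let KA e e' : bimorph (@mulKA K A sigma e e') := @cmul_bimorph false true e e'.
Let AK e e' : bimorph (@mulAK K A sigma e e') := @cmul_bimorph true false e e'.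
Let AA e e' : bimorph (@mulAA K A sigma e e') := @cmul_bimorph true true e e'.

Lemma SGWt_bimorph : bimorph (@SGWt_mul K A sigma).
Proof. exact: foursum_bimorph. Qed.

Lemma SGWt_mul_in k k' e e' (x : SGW sigma k e) (y : SGW sigma k' e') :
  SGWt_mul (sgw_in x) (sgw_in y) = sgw_in (cmul x y).
Proof.
have := foursum_mul_in KK KA AK AA (k := k) (k' := k') (e := e) (e' := e').
by case: k e k' e' x y => -[] [] [] x y; apply.
Qed.

Lemma SGWt_ind (P : SGWt sigma -> Prop) :
  (forall k e (x : SGW sigma k e), P (sgw_in x)) ->
  (forall x y, P x -> P y -> P (x + y)) -> forall x, P x.
Proof.
move=> Pin PD; apply: (foursum_ind (P := P)); last exact: PD.
move=> k e x.
by case: k e x => -[] x; [apply: (Pin true true) | apply: (Pin true false)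
  | apply: (Pin false true) | apply: (Pin false false)].
Qed.

Lemma SGWt_semiring : comm_semiring (SGWt_one sigma) (@SGWt_mul K A sigma).
Proof.
have mB := SGWt_bimorph; split=> [x y z|x y|x|x y z|x].
- elim/SGWt_ind: x => [k e x|x x' IH IH']; last by rewrite !(bimDl mB) IH IH'.
  elim/SGWt_ind: y => [k' e' y|y y' IH IH'];
    last by rewrite (bimDl mB) !(bimDr mB) (bimDl mB) IH IH'.
  elim/SGWt_ind: z => [k'' e'' z|z z' IH IH'];
    last by rewrite !(bimDr mB) IH IH'.
  by rewrite !SGWt_mul_in cmulA.
- elim/SGWt_ind: x => [k e x|x x' IH IH'];
    last by rewrite (bimDl mB) (bimDr mB) IH IH'.
  elim/SGWt_ind: y => [k' e' y|y y' IH IH'];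
    last by rewrite (bimDl mB) (bimDr mB) IH IH'.
  by rewrite !SGWt_mul_in cmulC.
- elim/SGWt_ind: x => [k e x|x x' IH IH']; last by rewrite (bimDr mB) IH IH'.
  rewrite -[SGWt_one sigma]/(sgw_in (clsK (unitK K) : SGW sigma false false)).
  by rewrite SGWt_mul_in cmul1l.
- exact: (bimDl mB).
- exact: (bim0l mB).
Qed.

Let gKK e e' := groth_ext2_bimorph (KK e e').
Let gKA e e' := groth_ext2_bimorph (KA e e').
Let gAK e e' := groth_ext2_bimorph (AK e e').
Let gAA e e' := groth_ext2_bimorph (AA e e').

Lemma GWt_bimorph : bimorph (@GWt_mul K A sigma).
Proof. exact: (foursum_bimorph gKK gKA gAK gAA). Qed.

Lemma GWt_inM (x y : SGWt sigma) :
  GWt_in (SGWt_mul x y) = GWt_mul (GWt_in x) (GWt_in y).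
Proof.
case: x y => [[[x0 x1] u0] u1] [[[y0 y1] v0] v1].
rewrite /GWt_mul /SGWt_mul /GWt_in /foursum_mul /=.
by rewrite !(groth_ext2_in (KK _ _), groth_ext2_in (KA _ _),
  groth_ext2_in (AK _ _), groth_ext2_in (AA _ _)) !groth_inD.
Qed.

Lemma GWt_diff (x : GWt sigma) : exists a b, x = GWt_in a - GWt_in b.
Proof.
case: x => [[[x0 x1] u0] u1].
exists ((rep x0).1, (rep x1).1, (rep u0).1, (rep u1).1).
exists ((rep x0).2, (rep x1).2, (rep u0).2, (rep u1).2).
by congr (_, _, _, _); apply: groth_diff.
Qed.

Lemma GWt_semiring : comm_semiring (GWt_one sigma) (@GWt_mul K A sigma).
Proof.
exact: semiring_completion SGWt_semiring GWt_bimorph GWt_inM GWt_diff.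
Qed.

Lemma GWt_oneE : inK0 (@GWK K) (@GWA K A sigma) (GWK_one K) = GWt_one sigma.
Proof. by rewrite /GWt_one /GWt_in /= !groth_in0. Qed.

Lemma GWK_semiring : comm_semiring (GWK_one K) (@GWK_mul K).
Proof.
have [gA gC g1 gD g0] := GWt_semiring.
pose i (a : GWK K false) : GWt sigma := inK0 (@GWK K) (@GWA K A sigma) a.
have iI : injective i by move=> a b [].
have iM a b : i (GWK_mul a b) = GWt_mul (i a) (i b).
  exact/esym/(foursum_mul_in gKK gKA gAK gAA (k := false) (k' := false)
    (e := false) (e' := false)).
have i1 : i (GWK_one K) = GWt_one sigma := GWt_oneE.
split=> [a b c|a b|a|a b c|a].
- by apply: iI; rewrite !iM gA.
- by apply: iI; rewrite !iM gC.
- by apply: iI; rewrite iM i1 g1.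
- exact: (bimDl (gKK false false)).
- exact: (bim0l (gKK false false)).
Qed.

End Final.

Local Close Scope classical_set_scope.
Local Close Scope ring_scope.

Theorem mainTheorem9 (K : fieldType) (A : falgType K)
    (sigma : {linear A -> A}) :
  2 \notin [pchar K]%R ->
  central_simple A ->
  involution_first_kind sigma ->
  [/\ well_defined_products sigma,
      comm_graded_semiring (SGWt_one sigma) (@SGWt_mul K A sigma)
        (@SGWt_comp K A sigma),
      forall x y : SGWt sigma,
        GWt_in (SGWt_mul x y) = GWt_mul (GWt_in x) (GWt_in y)
    & comm_graded_algebra (GWK_one K) (@GWK_mul K) (@GWt_scale K A sigma)
        (GWt_one sigma) (@GWt_mul K A sigma) (@GWt_comp K A sigma)].
Proof.
move=> char2 csA invol.
have Bm := cmul_bimorph char2 csA invol.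
have gB k k' e e' := groth_ext2_bimorph (Bm k k' e e').
have [gA gC g1 gD g0] := GWt_semiring char2 csA invol.
have gG : Gamma_graded (GWt_one sigma) (@GWt_mul K A sigma)
    (@GWt_comp K A sigma).
  apply: (foursum_graded (gB false false) (gB false true)
    (gB true false) (gB true true)).
  by exists (GWK_one K) => //; apply: GWt_oneE.
split.
- move=> e e'; split.
  + exact: (@well_defined_sprod _ _ _ char2 csA invol false false).
  + exact: (@well_defined_sprod _ _ _ char2 csA invol false true).
  + exact: (@well_defined_sprod _ _ _ char2 csA invol true false).
  + exact: (@well_defined_sprod _ _ _ char2 csA invol true true).
- split; first exact: SGWt_semiring.
  apply: (foursum_graded (Bm false false) (Bm false true)
    (Bm true false) (Bm true true)).
  by exists (clsK (unitK K)).
- exact: GWt_inM.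
have mB := GWt_bimorph char2 csA invol.
split.
- exact: GWK_semiring char2 csA invol.
- by split; first exact: GWt_semiring.
- split=> [a b x|x|a x y|x a b]; rewrite /GWt_scale.
  + rewrite gA; congr (GWt_mul _ x).
    exact: (foursum_mul_in (gB false false) (gB false true) (gB true false)
      (gB true true) (k := false) (k' := false) (e := false) (e' := false)).
  + by rewrite -[RHS]g1; congr (GWt_mul _ x).
  + exact: (bimDr mB).
  + rewrite -(bimDl mB); congr (GWt_mul _ x).
    by congr (_, _, _, _); rewrite /= addr0.
- by move=> a x y; rewrite /GWt_scale gA.
by move=> g a x gx; have [_ _ _ /(_ Gp g _ x _ gx)] := gG; apply; exists a.
Qed.
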